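(* Let $A\subset\mathbb{R}^2$ be the disjoint union of a square of edge length $1$ and a right isosceles triangle of area $2$ (legs of length $2$), and let $B\subset\mathbb{R}^2$ be the disjoint union of a rectangle with edge lengths $1$ and $2$ and a right isosceles triangle of area $1$ (legs of length $\sqrt2$), all with Dirichlet boundary conditions. Then $A$ and $B$ are isospectral but not isoheat. In particular: (i) for $t\to\infty$, $$Q_A(t)=\frac{1024}{9\pi^4}e^{-5\pi^2t/4}+O(e^{-2\pi^2t});$$ (ii) for $t\to\infty$, $$Q_B(t)=\frac{1152}{9\pi^4}e^{-5\pi^2t/4}+O(e^{-2\pi^2t}).$$
   Context: For a planar open set $M$ (possibly with several components) with Dirichlet Laplacian $-\Delta_M$ on $L^2(M)$, let $\lambda_1(M)\le\lambda_2(M)\le\cdots$ be its eigenvalues counted with multiplicity. Two sets $M_1,M_2$ are isospectral if $\lambda_j(M_1)=\lambda_j(M_2)$ for all $j\in\mathbb{N}$. The heat content is $Q_M(t)=\int_M u(x;t)\,dx$, where $u$ is the solution of $\Delta u=\partial u/\partial t$ on $M$ for $t>0$ with $\lim_{t\downarrow0}u(\cdot;t)=1$ in $L^2(M)$ and $u(x;t)=0$ for $x\in\partial M$, $t>0$; equivalently $Q_M(t)=\sum_{j\ge1}e^{-t\lambda_j(M)}\left(\int_M\phi_{j,M}(x)\,dx\right)^2$ for an orthonormal basis $\{\phi_{j,M}\}$ of eigenfunctions corresponding to $\lambda_j(M)$. $M_1,M_2$ are isoheat if $Q_{M_1}(t)=Q_{M_2}(t)$ for all $t>0$. *)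

(* Defs.v *)
(* MathComp-Analysis. *)
From HB Require Import structures.
From mathcomp Require Import all_boot all_order all_algebra.
From mathcomp Require Import all_classical all_reals all_analysis.

Set Implicit Arguments.
Unset Strict Implicit.
Unset Printing Implicit Defensive.

Import Order.TTheory GRing.Theory Num.Theory.
Import numFieldNormedType.Exports.

Local Open Scope classical_set_scope.
Local Open Scope ring_scope.

Section DirichletLaplacian.
Variable R : realType.
Implicit Types (M : set (R * R)) (f g u v : R * R -> R).

(* R * R with the Borel structure on which lebesgue_measure is defined. *)
Definition borel_plane := (measurableTypeR R * measurableTypeR R)%type.

Definition leb2 : {measure set borel_plane -> \bar R} :=
  (@lebesgue_measure R \x @lebesgue_measure R)%E.

Definition e1 : R * R := (1, 0).
Definition e2 : R * R := (0, 1).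

(* Differentiability of every iterated partial derivative makes all of them
   continuous, so this is C^oo; [true] stands for d/dx and [false] for d/dy. *)
Definition smooth f : Prop :=
  forall (s : seq bool) (x : R * R),
    differentiable
      (foldr (fun b h => 'D_(if b then e1 else e2) h) f s) x.

Definition test_function M f : Prop :=
  smooth f /\
  exists K : set (R * R), [/\ compact K, K `<=` M &
    forall x, ~ K x -> f x = 0].

(* Elements of L^2(M) are represented by functions on the whole plane, whose
   values off M are irrelevant. *)
Definition L2 M f : Prop :=
  measurable_fun (M : set borel_plane) f /\
  (\int[leb2]_(x in M) ((f x) ^+ 2)%:E < +oo)%E.

Definition L2dot M f g : R := \int[leb2]_(x in M) (f x * g x).

(* The square of the L^2(M) distance. *)
Definition L2dist2 M f g : \bar R :=
  (\int[leb2]_(x in M) ((f x - g x) ^+ 2)%:E)%E.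

(* H^1_0(M), the closure of the test functions in H^1(M). The limits gx and gy
   are automatically the weak partial derivatives of u. *)
Definition H10 M u : Prop :=
  L2 M u /\
  exists (psi : nat -> R * R -> R) (gx gy : R * R -> R),
    [/\ L2 M gx /\ L2 M gy,
        forall n, test_function M (psi n),
        L2dist2 M (psi n) u @[n --> \oo] --> 0%E,
        L2dist2 M ('D_e1 (psi n)) gx @[n --> \oo] --> 0%E &
        L2dist2 M ('D_e2 (psi n)) gy @[n --> \oo] --> 0%E].

Definition laplacian f : R * R -> R :=
  fun x => 'D_e1 ('D_e1 f) x + 'D_e2 ('D_e2 f) x.

(* The graph of the Dirichlet Laplacian Delta_M, a nonpositive self-adjoint
   operator on L^2(M): its domain consists of the u in H^1_0(M) whose
   distributional Laplacian v lies in L^2(M), and Delta_M u = v. *)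
Definition dirichlet_laplacian M u v : Prop :=
  [/\ H10 M u, L2 M v &
      forall psi, test_function M psi ->
        L2dot M u (laplacian psi) = L2dot M v psi].

Definition orthonormal_basis M (phi : nat -> R * R -> R) : Prop :=
  [/\ forall j, L2 M (phi j),
      forall i j, L2dot M (phi i) (phi j) = (i == j)%:R &
      forall f, L2 M f ->
        L2dist2 M
          (fun x => \sum_(j < n) L2dot M f (phi j) * phi j x) f
          @[n --> \oo] --> 0%E].

(* lam j is the (j+1)-st eigenvalue of - Delta_M, counted with multiplicity;
   these conditions determine lam. *)
Definition dirichlet_eigenvalues M (lam : nat -> R) : Prop :=
  nondecreasing_seq lam /\
  exists2 phi : nat -> R * R -> R, orthonormal_basis M phi &
    forall j, dirichlet_laplacian M (phi j) (fun x => - (lam j * phi j x)).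

Definition isospectral M1 M2 : Prop :=
  exists lam : nat -> R,
    dirichlet_eigenvalues M1 lam /\ dirichlet_eigenvalues M2 lam.

(* u' = Delta_M u for t > 0, the time derivative being taken in L^2(M);
   membership of u t in H^1_0(M) is the boundary condition. *)
Definition heat_solution M (u : R -> R * R -> R) : Prop :=
  (forall t, 0 < t ->
     exists2 v, dirichlet_laplacian M (u t) v &
       L2dist2 M (fun x => (u (t + h) x - u t x) / h) v
         @[h --> 0^'] --> 0%E) /\
  L2dist2 M (u t) (fun=> 1) @[t --> 0^'+] --> 0%E.

(* For M of finite area the solution exists and each u t with t > 0 is unique
   up to a null set, so the integral does not depend on the choice made. *)
Definition heat_content M (t : R) : R :=
  \int[leb2]_(x in M) xget (fun _ _ => 0) (heat_solution M) t x.

Definition isoheat M1 M2 : Prop :=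
  forall t, 0 < t -> heat_content M1 t = heat_content M2 t.

(* f =O_F g for F = pinfty_nbhs R, which is not a canonical filter_on and so
   cannot be used in the Landau notations. *)
Definition bigO_pinfty (f g : R -> R) : Prop :=
  exists2 C : R, 0 < C & \forall t \near +oo, `|f t| <= C * `|g t|.

End DirichletLaplacian.

Section Shapes.
Variable R : realType.

(* R * R carries the sup norm, hence the explicit Euclidean inner product. *)
Definition dot2 (v w : R * R) : R := v.1 * w.1 + v.2 * w.2.

Definition orthonormal_frame (v w : R * R) : Prop :=
  [/\ dot2 v v = 1, dot2 w w = 1 & dot2 v w = 0].

Definition open_rectangle (a b : R) (S : set (R * R)) : Prop :=
  exists p v w : R * R, orthonormal_frame v w /\
    S = [set x | exists s t : R,
           [/\ 0 < s < a, 0 < t < b & x = p + s *: v + t *: w]].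

Definition open_square (a : R) : set (R * R) -> Prop := open_rectangle a a.

(* The right angle is at p and both legs have length a. *)
Definition open_right_isosceles_triangle (a : R) (S : set (R * R)) : Prop :=
  exists p v w : R * R, orthonormal_frame v w /\
    S = [set x | exists s t : R,
           [/\ 0 < s, 0 < t, s + t < a & x = p + s *: v + t *: w]].

End Shapes.

(* Main.v *)
(** Both [A] and [B] have explicit Dirichlet eigenfunctions: in units of [pi ^+ 2 / 4]
    the eigenvalues are [4 (p^2 + q^2)] and [m^2 + n^2] with [m > n] for [A], and
    [4 p^2 + q^2] and [2 (m^2 + n^2)] with [m > n] for [B]. The pairs [m > n] of equal
    parity correspond to the triangle of [B] through [((m + n) / 2, (m - n) / 2)], and
    the rest of [A] matches the rectangle of [B]. The lowest value [5] is simple and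
    every other one is at least [8], so each heat content is a multiple of
    [exp (- 5 pi^2 t / 4)] up to [O (exp (- 2 pi^2 t))], the multiple being the squared
    integral of the ground state: that of the triangle of [A] and of the rectangle of
    [B]. The two constants differ.

    An eigenfunction supported on one component is [d * U] with [d] vanishing exactly
    on the boundary, hence lies in [H^1_0], being the limit of cutoffs in [d].
    Completeness of the sines comes from polynomial approximation of indicators in
    [cos x] and [cos y] against the weight [sin x sin y], and completeness on the
    triangle from antisymmetric extension. Pairing any solution of the heat equation with
    an eigenfunction gives an ordinary differential equation in [t], so the heat content is
    [\sum_j exp (- lam_j t) (\int phi_j)^2] by Parseval. *)

Require Import Defs.
From HB Require Import structures.
From mathcomp Require Import all_boot all_order all_algebra.
From mathcomp Require Import all_classical all_reals all_analysis.
From mathcomp Require Import measurable_realfun.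
From mathcomp Require Import ring lra zify.

Set Implicit Arguments.
Unset Strict Implicit.
Unset Printing Implicit Defensive.

Import Order.TTheory GRing.Theory Num.Theory.
Import numFieldNormedType.Exports.

Local Open Scope classical_set_scope.
Local Open Scope ring_scope.

(** * The space L^2 *)

(** Membership in [H10] has to be shown by exhibiting test functions. Factoring every eigenfunction
    through one explicit [d] reduces this to a one-variable cutoff for which the derivative of its
    profile, multiplied by [d], stays bounded. For the triangle the factorization comes from divided
    differences of polynomials in the cosine.

    The value of [heat_content] is that of an arbitrary solution selected by [xget], with a default
    when there is none. So a solution has to be built from its Fourier series, and the coefficients
    have to be computed for every solution. Summability rests on the crude growth
    [n.+1 <= K * lam n ^+ 2], obtained by counting lattice points in a square.

    The constants: on the models of side [pi] the ground states have integrals 4 and -8/3.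
    Normalizing and rescaling gives [64 * (a * b) / pi ^+ 4] for a rectangle and
    [256 * a ^+ 2 / (9 * pi ^+ 4)] for a triangle, hence 1152 and 1024 over [9 * pi ^+ 4]. The
    remainder is shown to lie between 0 and the area times [expR (- (2 * pi ^+ 2 * t))], so one
    explicit time already separates the two heat contents. *)

Section L2_space.
Variables (R : realType) (M : set (R * R)).
Hypothesis mM : measurable (M : set (borel_plane R)).
Local Notation mu := (@leb2 R).
Local Notation mfun f := (measurable_fun (M : set (borel_plane R)) f).
Implicit Types f g h : R * R -> R.

(** Real-valued, so that estimates are plain real arithmetic; [L2dist2E] and [cvg_L2dist2] translate
    to and from the extended-real distance of the definitions. Working with squares avoids roots
    throughout. *)
Definition nrm2 f := L2dot M f f.

(** The integrable majorant is [f ^+ 2 + g ^+ 2]. *)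
Lemma L2_integrable_mul f g : L2 M f -> L2 M g ->
  mu.-integrable M (EFin \o (fun x => f x * g x)).
Proof.
move=> [mf f2] [mg g2].
have mfg : measurable_fun (M : set (borel_plane R)) (fun x => f x ^+ 2 + g x ^+ 2).
  by apply: measurable_funD; apply: measurable_funX.
have h2 : mu.-integrable M (EFin \o (fun x => f x ^+ 2 + g x ^+ 2)).
  apply/integrableP; split; first exact/measurable_EFinP.
  under eq_integral => x _ do rewrite /= ger0_norm ?addr_ge0 ?sqr_ge0// EFinD.
  rewrite ge0_integralD//; first exact: lte_add_pinfty.
  - by move=> x _; rewrite lee_fin sqr_ge0.
  - by apply/measurable_EFinP; apply: measurable_funX.
  - by move=> x _; rewrite lee_fin sqr_ge0.
  - by apply/measurable_EFinP; apply: measurable_funX.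
apply: (le_integrable _ _ _ h2) => //.
  by apply/measurable_EFinP; apply: measurable_funM.
move=> x _ /=; rewrite lee_fin.
rewrite [leRHS]ger0_norm ?addr_ge0 ?sqr_ge0// normrM.
rewrite -[f x ^+ 2]real_normK ?num_real// -[g x ^+ 2]real_normK ?num_real//.
have := normr_ge0 (f x); have := normr_ge0 (g x).
nra.
Qed.

Lemma L2_of_integrable f : mfun f ->
  mu.-integrable M (EFin \o (fun x => f x * f x)) -> L2 M f.
Proof.
move=> mf /integrableP[_ h]; split => //.
apply: le_lt_trans h; rewrite le_eqVlt; apply/orP; left; apply/eqP.
by apply: eq_integral => x _ /=; rewrite -expr2 ger0_norm ?sqr_ge0.
Qed.

Lemma L2Z a f : L2 M f -> L2 M (fun x => a * f x).
Proof.
move=> Lf; apply: L2_of_integrable.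
  by apply: measurable_funM => //; case: Lf.
have := @integrableZl _ _ _ mu M mM (a ^+ 2) _ (L2_integrable_mul Lf Lf).
apply: eq_integrable => // x _ /=; rewrite -EFinM; congr EFin; ring.
Qed.

Lemma L2D f g : L2 M f -> L2 M g -> L2 M (fun x => f x + g x).
Proof.
move=> Lf Lg; apply: L2_of_integrable.
  by apply: measurable_funD; [case: Lf|case: Lg].
have i1 := L2_integrable_mul Lf Lf.
have i2 := L2_integrable_mul Lg Lg.
have i3 := L2_integrable_mul Lf (L2Z 2 Lg).
have := integrableD mM (integrableD mM i1 i2) i3.
apply: eq_integrable => // x _ /=; rewrite -!EFinD; congr EFin; ring.
Qed.

Lemma L2N f : L2 M f -> L2 M (fun x => - f x).
Proof.
move=> /(L2Z (-1)); congr (L2 _ _); apply/funext => x; ring.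
Qed.

Lemma L2B f g : L2 M f -> L2 M g -> L2 M (fun x => f x - g x).
Proof. by move=> Lf Lg; apply: L2D => //; apply: L2N. Qed.

Lemma L2_0 : L2 M (fun=> 0).
Proof.
split; first exact: measurable_cst.
by under eq_integral do rewrite expr0n/=; rewrite integral0.
Qed.

Lemma L2_sum (I : Type) (r : seq I) (F : I -> R * R -> R) :
  (forall i, L2 M (F i)) -> L2 M (fun x => \sum_(i <- r) F i x).
Proof.
move=> LF; elim: r => [|i r IH].
  by under eq_fun do rewrite big_nil; exact: L2_0.
by under eq_fun do rewrite big_cons; exact: L2D.
Qed.

Lemma L2_ext f g : (forall x, M x -> f x = g x) -> L2 M f -> L2 M g.
Proof.
move=> fg [mf f2]; split.
  by apply: eq_measurable_fun mf => x /set_mem /fg.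
apply: le_lt_trans f2; rewrite le_eqVlt; apply/orP; left; apply/eqP.
by apply: eq_integral => x /set_mem /fg ->.
Qed.

Lemma L2dot_ext f f' g g' : (forall x, M x -> f x = f' x) ->
  (forall x, M x -> g x = g' x) -> L2dot M f g = L2dot M f' g'.
Proof.
by move=> ff gg; apply: eq_Rintegral => x /set_mem xM; rewrite ff ?gg.
Qed.

Lemma L2dotC f g : L2dot M f g = L2dot M g f.
Proof. by apply: eq_Rintegral => x _; rewrite mulrC. Qed.

Lemma L2dotDl f g h : L2 M f -> L2 M g -> L2 M h ->
  L2dot M (fun x => f x + g x) h = L2dot M f h + L2dot M g h.
Proof.
move=> Lf Lg Lh; rewrite -RintegralD//; try exact: L2_integrable_mul.
by apply: eq_Rintegral => x _; rewrite mulrDl.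
Qed.

Lemma L2dotZl a f h : L2 M f -> L2 M h ->
  L2dot M (fun x => a * f x) h = a * L2dot M f h.
Proof.
move=> Lf Lh; rewrite -RintegralZl//; try exact: L2_integrable_mul.
by apply: eq_Rintegral => x _; rewrite mulrA.
Qed.

Lemma L2dotDr f g h : L2 M f -> L2 M g -> L2 M h ->
  L2dot M h (fun x => f x + g x) = L2dot M h f + L2dot M h g.
Proof. by move=> *; rewrite L2dotC L2dotDl// ![L2dot M h _]L2dotC. Qed.

Lemma L2dotZr a f h : L2 M f -> L2 M h ->
  L2dot M h (fun x => a * f x) = a * L2dot M h f.
Proof. by move=> *; rewrite L2dotC L2dotZl// L2dotC. Qed.

Lemma L2dotNl f h : L2 M f -> L2 M h ->
  L2dot M (fun x => - f x) h = - L2dot M f h.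
Proof.
move=> Lf Lh; rewrite -mulN1r -L2dotZl//.
by apply: L2dot_ext => // x _; rewrite mulN1r.
Qed.

Lemma L2dotBl f g h : L2 M f -> L2 M g -> L2 M h ->
  L2dot M (fun x => f x - g x) h = L2dot M f h - L2dot M g h.
Proof. by move=> Lf Lg Lh; rewrite L2dotDl ?L2dotNl//; exact: L2N. Qed.

Lemma L2dotBr f g h : L2 M f -> L2 M g -> L2 M h ->
  L2dot M h (fun x => f x - g x) = L2dot M h f - L2dot M h g.
Proof. by move=> *; rewrite L2dotC L2dotBl// ![L2dot M h _]L2dotC. Qed.

Lemma L2dot_suml (I : Type) (r : seq I) (F : I -> R * R -> R) h :
  (forall i, L2 M (F i)) -> L2 M h ->
  L2dot M (fun x => \sum_(i <- r) F i x) h = \sum_(i <- r) L2dot M (F i) h.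
Proof.
move=> LF Lh; elim: r => [|i r IH].
  rewrite big_nil /L2dot; under eq_Rintegral do rewrite big_nil mul0r.
  by rewrite Rintegral_cst ?mul0r.
rewrite big_cons -IH -L2dotDl//; last exact: L2_sum.
by apply: L2dot_ext => // x _; rewrite big_cons.
Qed.

Lemma nrm2_ge0 f : 0 <= nrm2 f.
Proof. by apply: Rintegral_ge0 => x _; rewrite -expr2 sqr_ge0. Qed.

Lemma nrm2Z a f : L2 M f -> nrm2 (fun x => a * f x) = a ^+ 2 * nrm2 f.
Proof.
by move=> Lf; rewrite /nrm2 L2dotZl ?L2dotZr//; [rewrite mulrA expr2|exact: L2Z].
Qed.

Lemma nrm2D f g : L2 M f -> L2 M g ->
  nrm2 (fun x => f x + g x) = nrm2 f + 2 * L2dot M f g + nrm2 g.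
Proof.
move=> Lf Lg; rewrite /nrm2 L2dotDl ?L2dotDr//; last exact: L2D.
rewrite [L2dot M g f]L2dotC; ring.
Qed.

Lemma nrm2B f g : L2 M f -> L2 M g ->
  nrm2 (fun x => f x - g x) = nrm2 f - 2 * L2dot M f g + nrm2 g.
Proof.
move=> Lf Lg; rewrite /nrm2 L2dotBl ?L2dotBr//; last exact: L2B.
rewrite [L2dot M g f]L2dotC; ring.
Qed.

(** Parallelogram law: the gap between the two sides is the squared norm of [f - g]. It plays the
    role of the triangle inequality for squared norms, whence the recurring tolerance [e / 4]. *)
Lemma nrm2D_le f g : L2 M f -> L2 M g ->
  nrm2 (fun x => f x + g x) <= 2 * nrm2 f + 2 * nrm2 g.
Proof.
move=> Lf Lg.
have := nrm2_ge0 (fun x => f x - g x).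
rewrite nrm2B// nrm2D//; lra.
Qed.

Lemma nrm2B_le f g h : L2 M f -> L2 M g -> L2 M h ->
  nrm2 (fun x => f x - h x) <=
  2 * nrm2 (fun x => f x - g x) + 2 * nrm2 (fun x => g x - h x).
Proof.
move=> Lf Lg Lh; apply: le_trans (nrm2D_le (L2B Lf Lg) (L2B Lg Lh)).
by rewrite le_eqVlt; apply/orP; left; apply/eqP/L2dot_ext => x _; rewrite subrKA.
Qed.

Lemma nrm2BC f g : nrm2 (fun x => f x - g x) = nrm2 (fun x => g x - f x).
Proof. by apply: eq_Rintegral => x _; ring. Qed.

(** Discriminant argument: the squared norm of [f - t g] is nonnegative for every [t]. *)
Lemma L2dot_CS f g : L2 M f -> L2 M g ->
  L2dot M f g ^+ 2 <= nrm2 f * nrm2 g.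
Proof.
move=> Lf Lg.
have key t : 0 <= nrm2 f - 2 * (t * L2dot M f g) + t ^+ 2 * nrm2 g.
  rewrite -nrm2Z// -L2dotZr//  -nrm2B//; first exact: nrm2_ge0.
  exact: L2Z.
have [g0|g0] := eqVneq (nrm2 g) 0.
  have {}key t : 0 <= nrm2 f - 2 * (t * L2dot M f g).
    by have := key t; rewrite g0 mulr0 addr0.
  rewrite g0 mulr0 leNgt; apply/negP => d0.
  (* With [nrm2 g = 0] the quadratic is affine in [t], and this [t] gives it the negative value
     [- nrm2 f - 2]. *)
  have := key ((nrm2 f + 1) / L2dot M f g).
  rewrite divfK; last by apply: contraTneq d0 => ->; rewrite expr0n ltxx.
  have := nrm2_ge0 f; lra.
have {}g0 : 0 < nrm2 g by rewrite lt_def g0 nrm2_ge0.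
have := key (L2dot M f g / nrm2 g).
rewrite -(pmulr_lge0 _ g0).
set a := nrm2 f; set b := nrm2 g; set c := L2dot M f g.
suff -> : (a - 2 * (c / b * c) + (c / b) ^+ 2 * b) * b = a * b - c ^+ 2.
  by rewrite subr_ge0.
by field; rewrite gt_eqF.
Qed.

Lemma L2dist2E f g : L2 M f -> L2 M g ->
  L2dist2 M f g = (nrm2 (fun x => f x - g x))%:E.
Proof.
move=> Lf Lg; rewrite /nrm2 /L2dot /Rintegral fineK; last first.
  by apply: integrable_fin_num => //; apply: L2_integrable_mul; exact: L2B.
by apply: eq_integral => x _; rewrite expr2.
Qed.

(** Membership in L^2 is asked only along the filter: a difference quotient at time [t] is
    controlled only for small increments. *)
Lemma cvg_L2dist2 (T : Type) (F : set_system T) {FF : Filter F}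
    (f_ : T -> R * R -> R) f :
  (\forall n \near F, L2 M (f_ n)) -> L2 M f ->
  (L2dist2 M (f_ n) f @[n --> F] --> 0%E) <->
  (nrm2 (fun x => f_ n x - f x) @[n --> F] --> (0 : R)).
Proof.
move=> Lf_ Lf.
have E : {near F, (fun n => L2dist2 M (f_ n) f) =1
                  (fun n => (nrm2 (fun x => f_ n x - f x))%:E)}.
  by apply: filterS Lf_ => n Ln; exact: L2dist2E.
have E' : {near F, (fun n => (nrm2 (fun x => f_ n x - f x))%:E) =1
                    (fun n => L2dist2 M (f_ n) f)}.
  by apply: filterS E => n ->.
split => h.
  apply: (@fine_cvg _ _ _ _ (fun n => (nrm2 (fun x => f_ n x - f x))%:E) 0).
  by apply: cvg_trans h; exact: near_eq_cvg.
apply: cvg_trans (_ : (nrm2 (fun x => f_ n x - f x))%:E @[n --> F] --> 0%E).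
  exact: near_eq_cvg.
by apply: cvg_EFin => //; apply: nearW.
Qed.

Lemma cvg_L2dot (T : Type) (F : set_system T) {FF : Filter F}
    (f_ : T -> R * R -> R) f g :
  (\forall n \near F, L2 M (f_ n)) -> L2 M f -> L2 M g ->
  nrm2 (fun x => f_ n x - f x) @[n --> F] --> (0 : R) ->
  L2dot M (f_ n) g @[n --> F] --> L2dot M f g.
Proof.
move=> Lf_ Lf Lg h.
have h1 : nrm2 (fun x => f_ n x - f x) * nrm2 g @[n --> F] --> (0 : R).
  by rewrite -[X in _ --> X](mul0r (nrm2 g)); apply: cvgM => //; exact: cvg_cst.
apply/cvgrPdist_lt => e e0.
move/cvgrPdist_lt : h1 => /(_ (e ^+ 2)).
rewrite exprn_gt0// => /(_ isT).
apply: filterS2 Lf_ => n Ln; rewrite sub0r normrN => h1.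
rewrite distrC -L2dotBl// -(@ltr_pXn2r _ 2) ?nnegrE//; last exact: ltW.
rewrite -normrX (le_lt_trans _ h1)// !ger0_norm ?sqr_ge0 ?mulr_ge0 ?nrm2_ge0//.
by apply: L2dot_CS => //; exact: L2B.
Qed.

End L2_space.

(** * Smooth functions *)

Section near_eq_differentiable.
Variables (R : realType) (V W : normedModType R).

Lemma near0_differentiable (k : V -> W) (x : V) :
  (\forall y \near x, k y = 0) -> differentiable k x.
Proof.
move=> k0.
have kx : k x = 0 by exact: nbhs_singleton k0.
have E : k \o shift x = cst (k x) + (0 : V -> W) +o_ 0 id.
  apply: eqaddoE; rewrite kx.
  have -> : cst (0 : W) = 0 :> (V -> W) by [].
  rewrite add0r add0r; apply/eqoP => _/posnumP[e].
  have : \forall y \near 0, k (y + x) = 0.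
    by move: k0; rewrite (near_shift 0) /= subr0.
  by apply: filterS => y /= ->; rewrite normr0 mulr_ge0.
have d0 : 'd k x = 0 :> (V -> W).
  by apply/diff_unique => //; exact: cst_continuous.
by apply/diff_locallyP; rewrite d0; split => //; exact: cst_continuous.
Qed.

(** Differentiability is local because [f - g] vanishes near [x], where its differential is 0. *)
Lemma near_eq_differentiable (f g : V -> W) (x : V) :
  (\forall y \near x, f y = g y) -> differentiable g x -> differentiable f x.
Proof.
move=> fg dg; have -> : f = (g + (f - g))%R by rewrite addrC subrK.
apply: differentiableD => //; apply: near0_differentiable.
by apply: filterS fg => y /= fgy; rewrite !fctE fgy subrr.
Qed.

End near_eq_differentiable.

Section smooth.
Variable R : realType.
Implicit Types f g : R * R -> R.

Definition evec (b : bool) : R * R := if b then e1 R else e2 R.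

Lemma smooth_differentiable f : smooth f -> forall x, differentiable f x.
Proof. by move=> /(_ [::]). Qed.

Lemma smooth_derive f b : smooth f -> smooth ('D_(evec b) f).
Proof. by move=> sf s x; have := sf (rcons s b) x; rewrite foldr_rcons. Qed.

(** Any class of differentiable functions stable under both partial derivatives consists of smooth
    functions. [foldr] applies the last letter of the word first, hence the induction from the right
    end. *)
Lemma smooth_coind (C : (R * R -> R) -> Prop) :
  (forall f, C f -> forall x, differentiable f x) ->
  (forall f b, C f -> C ('D_(evec b) f)) ->
  forall f, C f -> smooth f.
Proof.
move=> Cd CD f Cf s; elim/last_ind: s f Cf => [|s b IH] f Cf x; first exact: Cd.
by rewrite foldr_rcons; apply: IH; exact: CD.
Qed.

(** This is what allows gluing a smooth function on an open set with zero elsewhere. *)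
Lemma smooth_local f :
  (forall x : R * R, exists2 g, smooth g & \forall y \near x, f y = g y) -> smooth f.
Proof.
move: f; apply: (@smooth_coind (fun f => forall x : R * R, exists2 g, smooth g &
  \forall y \near x, f y = g y)) => [f Cf x|f b Cf x].
  have [g sg fg] := Cf x.
  by apply: near_eq_differentiable fg _; exact: smooth_differentiable.
have [g sg fg] := Cf x; exists ('D_(evec b) g); first exact: smooth_derive.
move/near_join : fg; apply: filterS => y fgy; exact: near_eq_derive.
Qed.

Definition smooth1 (h : R -> R) := forall n x, derivable (derive1n n h) x 1.

Lemma smooth1_coind (C : (R -> R) -> Prop) :
  (forall h, C h -> forall x, derivable h x 1) ->
  (forall h, C h -> C (derive1 h)) -> forall h, C h -> smooth1 h.
Proof.
move=> Cd CD h Ch n; elim: n h Ch => [|n IH] h Ch x; first exact: Cd.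
by rewrite derive1Sn; apply: IH; exact: CD.
Qed.

Lemma smooth1_derive1 h : smooth1 h -> smooth1 (derive1 h).
Proof. by move=> sh n x; rewrite -derive1Sn. Qed.

(** A syntactic class stable under derivation, composition with smooth functions of one variable
    included. Eigenfunctions, boundary functions and cutoffs all belong to it, so their smoothness
    is structural. *)
Inductive elementary : (R * R -> R) -> Prop :=
| elementary_cst c : elementary (fun=> c)
| elementary_fst : elementary fst
| elementary_snd : elementary snd
| elementaryD f g : elementary f -> elementary g ->
    elementary (fun x => f x + g x)
| elementaryM f g : elementary f -> elementary g ->
    elementary (fun x => f x * g x)
| elementary_comp h f : smooth1 h -> elementary f ->
    elementary (fun x => h (f x)).

Lemma differentiable_fst (x : R * R) : differentiable (@fst R R) x.
Proof.
apply: linear_differentiable => y; exact: cvg_fst.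
Qed.

Lemma differentiable_snd (x : R * R) : differentiable (@snd R R) x.
Proof.
apply: linear_differentiable => y; exact: cvg_snd.
Qed.

Lemma elementary_differentiable f : elementary f ->
  forall x, differentiable f x.
Proof.
elim=> {f} [c||| f g _ df _ dg | f g _ df _ dg | h f sh _ df] x.
- exact: differentiable_cst.
- exact: differentiable_fst.
- exact: differentiable_snd.
- exact: differentiableD.
- exact: differentiableM.
- apply: (@differentiable_comp _ _ _ _ f h) => //.
  by apply/derivable1_diffP; exact: (sh 0%N).
Qed.

Lemma derive_fst v (x : R * R) : 'D_v fst x = v.1.
Proof.
rewrite deriveE; last exact: differentiable_fst.
by rewrite diff_lin// => y; exact: cvg_fst.
Qed.

Lemma derive_snd v (x : R * R) : 'D_v snd x = v.2.
Proof.
rewrite deriveE; last exact: differentiable_snd.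
by rewrite diff_lin// => y; exact: cvg_snd.
Qed.

Lemma derive_comp1 (h : R -> R) f v x : differentiable f x ->
  derivable h (f x) 1 -> 'D_v (fun x => h (f x)) x = derive1 h (f x) * 'D_v f x.
Proof.
move=> df dh; have dh' : differentiable h (f x) by apply/derivable1_diffP.
rewrite (deriveE _ (differentiable_comp df dh')) diff_comp//= deriveE//.
by rewrite deriv1E// /GRing.scale/= mulrC.
Qed.

Lemma elementary_derive f v : elementary f -> elementary ('D_v f).
Proof.
elim=> {f} [c||| f g ef edf eg edg | f g ef edf eg edg | h f sh ef edf].
- have -> : 'D_v (fun=> c) = (fun=> 0) :> (R * R -> R) by apply/funext => x; rewrite derive_cst.
  exact: elementary_cst.
- have -> : 'D_v fst = (fun=> v.1) :> (R * R -> R) by apply/funext => x; rewrite derive_fst.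
  exact: elementary_cst.
- have -> : 'D_v snd = (fun=> v.2) :> (R * R -> R) by apply/funext => x; rewrite derive_snd.
  exact: elementary_cst.
- have -> : 'D_v (fun x => f x + g x) = (fun x => 'D_v f x + 'D_v g x).
    by apply/funext => x; apply: deriveD; apply: diff_derivable; exact: elementary_differentiable.
  exact: elementaryD.
- have -> : 'D_v (fun x => f x * g x) = (fun x => f x * 'D_v g x + g x * 'D_v f x).
    by apply/funext => x; apply: deriveM; apply: diff_derivable; exact: elementary_differentiable.
  by apply: elementaryD; exact: elementaryM.
- have -> : 'D_v (fun x => h (f x)) = (fun x => derive1 h (f x) * 'D_v f x).
    apply/funext => x; apply: derive_comp1; first exact: elementary_differentiable.
    exact: (sh 0%N).
  by apply: elementaryM => //; apply: elementary_comp => //; exact: smooth1_derive1.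
Qed.

Lemma elementary_smooth f : elementary f -> smooth f.
Proof.
apply: smooth_coind => {}f; first exact: elementary_differentiable.
by move=> b; exact: elementary_derive.
Qed.

(** Sums and products of arbitrary smooth functions, test functions among them. By the Leibniz rule
    this class is stable under derivation, which a single product is not; it serves to prove
    [smoothD] and [smoothM]. *)
Inductive smooth_poly : (R * R -> R) -> Prop :=
| smooth_poly_base f : smooth f -> smooth_poly f
| smooth_polyD f g : smooth_poly f -> smooth_poly g ->
    smooth_poly (fun x => f x + g x)
| smooth_polyM f g : smooth_poly f -> smooth_poly g ->
    smooth_poly (fun x => f x * g x).

Lemma smooth_poly_differentiable f : smooth_poly f ->
  forall x, differentiable f x.
Proof.
elim=> {f} [f sf|f g _ df _ dg|f g _ df _ dg] x.
- exact: smooth_differentiable.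
- exact: differentiableD.
- exact: differentiableM.
Qed.

Lemma smooth_poly_derive f b : smooth_poly f -> smooth_poly ('D_(evec b) f).
Proof.
elim=> {f} [f sf|f g ef edf eg edg | f g ef edf eg edg].
- by apply: smooth_poly_base; exact: smooth_derive.
- have -> : 'D_(evec b) (fun x => f x + g x) = (fun x => 'D_(evec b) f x + 'D_(evec b) g x).
    by apply/funext => x; apply: deriveD; apply: diff_derivable; exact: smooth_poly_differentiable.
  exact: smooth_polyD.
- have -> : 'D_(evec b) (fun x => f x * g x) =
      (fun x => f x * 'D_(evec b) g x + g x * 'D_(evec b) f x).
    by apply/funext => x; apply: deriveM; apply: diff_derivable; exact: smooth_poly_differentiable.
  by apply: smooth_polyD; exact: smooth_polyM.
Qed.

Lemma smooth_poly_smooth f : smooth_poly f -> smooth f.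
Proof.
apply: smooth_coind => {}f; first exact: smooth_poly_differentiable.
by move=> b; exact: smooth_poly_derive.
Qed.

Lemma smoothD f g : smooth f -> smooth g -> smooth (fun x => f x + g x).
Proof.
by move=> sf sg; apply: smooth_poly_smooth; apply: smooth_polyD; exact: smooth_poly_base.
Qed.

Lemma smoothM f g : smooth f -> smooth g -> smooth (fun x => f x * g x).
Proof.
by move=> sf sg; apply: smooth_poly_smooth; apply: smooth_polyM; exact: smooth_poly_base.
Qed.

Lemma smooth_cst c : smooth (fun=> c : R).
Proof. by apply: elementary_smooth; exact: elementary_cst. Qed.

Lemma smooth_continuous f : smooth f -> continuous f.
Proof. by move=> sf x; apply: differentiable_continuous; exact: smooth_differentiable. Qed.

Lemma smooth_derivable f v x : smooth f -> derivable f x v.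
Proof. by move=> sf; apply: diff_derivable; exact: smooth_differentiable. Qed.

Lemma smooth_deriveD f g v (x : R * R) : smooth f -> smooth g ->
  'D_v (fun y => f y + g y) x = 'D_v f x + 'D_v g x.
Proof. by move=> sf sg; apply: deriveD; exact: smooth_derivable. Qed.

Lemma smooth_deriveM f g v (x : R * R) : smooth f -> smooth g ->
  'D_v (fun y => f y * g y) x = f x * 'D_v g x + g x * 'D_v f x.
Proof. by move=> sf sg; apply: deriveM; exact: smooth_derivable. Qed.

Lemma smooth_deriveZ (c : R) f v (x : R * R) : smooth f ->
  'D_v (fun y => c * f y) x = c * 'D_v f x.
Proof. by move=> sf; apply: deriveZ; exact: smooth_derivable. Qed.

Lemma smooth_derive_comp1 h f v (x : R * R) : smooth1 h -> smooth f ->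
  'D_v (fun y => h (f y)) x = derive1 h (f x) * 'D_v f x.
Proof.
move=> sh sf; apply: derive_comp1; first exact: smooth_differentiable.
exact: (sh 0%N).
Qed.

Lemma smooth1_sin : smooth1 (@sin R).
Proof.
(* The span of [sin] and [cos] is stable under derivation. *)
pose C (h : R -> R) := exists a b, h = (fun x => a * sin x + b * cos x).
have dC a b x : is_derive x (1 : R) (fun x => a * sin x + b * cos x)
    (- b * sin x + a * cos x).
  by apply: is_derive_eq; rewrite /GRing.scale/=; ring.
apply: (@smooth1_coind C) => [h [a [b ->]] x|h [a [b ->]]|].
- by have [] := dC a b x.
- exists (- b), a; apply/funext => x; rewrite derive1E.
  by have [_ ->] := dC a b x.
- by exists 1, 0; apply/funext => x; ring.
Qed.

Lemma smooth1_cos : smooth1 (@cos R).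
Proof.
have -> : @cos R = derive1 (@sin R).
  by apply/funext => x; rewrite derive1E; have [_ ->] := is_derive_sin x.
exact: smooth1_derive1 smooth1_sin.
Qed.

End smooth.

(** * Flat functions, the profiles of the cutoffs *)

Section flat_exp.
Variable R : realType.
Implicit Types (p : {poly R}) (y : R).

(** For [p = 1] this is the classical function that is flat at 0. The polynomial in [y^-1] makes the
    family stable under derivation. *)
Definition flat_exp p y : R := if 0 < y then p.[y^-1] * expR (- y^-1) else 0.

Lemma is_derive_comp1 (f g : R -> R) (x df dg : R) :
  is_derive x 1 f df -> is_derive (f x) 1 g dg ->
  is_derive x 1 (fun x => g (f x)) (dg * df).
Proof.
move=> [f1 <-] [g1 <-]; split.
  apply/derivable1_diffP; apply: (@differentiable_comp _ _ _ _ f g);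
  exact/derivable1_diffP.
by have := derive1_comp f1 g1; rewrite !derive1E.
Qed.

(** For positive [n], raise [t / n <= expR (t / n)] to the power [n]. *)
Lemma exprn_le_expR n (t : R) : 0 <= t -> t ^+ n <= n%:R ^+ n * expR t.
Proof.
case: n => [|n] t0; first by rewrite !expr0 mul1r -expR0 ler_expR.
have n0 : (0 : R) < n.+1%:R by rewrite ltr0n.
have -> : expR t = expR (t / n.+1%:R) ^+ n.+1.
  by rewrite -expRM_natl -mulrC divfK// gt_eqF.
rewrite -exprMn ler_pXn2r ?nnegrE ?mulr_ge0 ?expR_ge0//.
  rewrite -ler_pdivrMl// mulrC; apply: le_trans (expR_ge1Dx _).
  by rewrite lerDr.
Qed.

Lemma horner_le_expR p : exists2 C, 0 <= C &
  forall t, 0 <= t -> `|p.[t]| <= C * expR t.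
Proof.
exists (\sum_(i < size p) `|p`_i| * i%:R ^+ i).
  by apply: sumr_ge0 => i _; rewrite mulr_ge0// exprn_ge0.
move=> t t0; rewrite horner_coef (le_trans (ler_norm_sum _ _ _))//.
rewrite mulr_suml ler_sum// => i _; rewrite normrM -mulrA ler_wpM2l//.
by rewrite ger0_norm ?exprn_ge0// exprn_le_expR.
Qed.

Lemma flat_exp_bounded p : exists2 C, 0 <= C & forall y, `|flat_exp p y| <= C.
Proof.
have [C C0 hC] := horner_le_expR p; exists C => // y; rewrite /flat_exp.
case: ifPn => [y0|_]; last by rewrite normr0.
rewrite normrM [X in _ * X]ger0_norm ?expR_ge0//.
by rewrite expRN ler_pdivrMr ?expR_gt0// hC// invr_ge0 ltW.
Qed.

(** Boundedness for [p * 'X] is the claim, since the extra factor evaluates to [y^-1]. *)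
Lemma flat_exp_le_linear p : exists2 C, 0 <= C & forall y, `|flat_exp p y| <= C * `|y|.
Proof.
have [C C0 hC] := flat_exp_bounded (p * 'X); exists C => // y.
rewrite /flat_exp; case: ifPn => [y0|_]; last by rewrite normr0 mulr_ge0.
have := hC y; rewrite /flat_exp y0 hornerM hornerX => h.
rewrite (_ : p.[y^-1] * expR (- y^-1) = p.[y^-1] * y^-1 * expR (- y^-1) * y); last first.
  by rewrite -[LHS]mulr1 -(mulVf (lt0r_neq0 y0)); ring.
by rewrite normrM ler_wpM2r.
Qed.

Lemma is_derive_flat_exp p y : is_derive y 1 (flat_exp p) (flat_exp ((p - p^`()) * 'X^2) y).
Proof.
have [y0|y0|->] := ltgtP y 0.
- have -> : flat_exp ((p - p^`()) * 'X^2) y = 0 by rewrite /flat_exp ltNge (ltW y0).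
  apply: (@near_eq_is_derive _ _ _ (cst 0)).
  have : \forall z \near y, z < 0 by exact: lt_nbhsl.
  by apply: filterS => z z0; rewrite /flat_exp ltNge (ltW z0).
- have yn0 : y != 0 by rewrite gt_eqF.
  have dV : is_derive y 1 (fun z : R => z^-1) (- y^-2).
    split; first by apply: derivableV => //; exact: derivable_id.
    by rewrite (@deriveV _ _ id y 1)// derive_id /GRing.scale/= mulr1.
  have dp : is_derive y 1 (fun z => p.[z^-1]) (p^`().[y^-1] * - y^-2).
    exact: (is_derive_comp1 dV).
  have de : is_derive y 1 (fun z => expR (- z^-1)) (expR (- y^-1) * - - y^-2).
    by apply: (is_derive_comp1 (f := fun z => - z^-1)).
  have dpe : is_derive y 1 (fun z => p.[z^-1] * expR (- z^-1))
      (flat_exp ((p - p^`()) * 'X^2) y).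
    apply: is_derive_eq; rewrite /flat_exp y0 /GRing.scale /=.
    by rewrite hornerM hornerXn hornerD hornerN exprVn; ring.
  apply: near_eq_is_derive dpe.
  have : \forall z \near y, 0 < z by exact: lt_nbhsr.
  by apply: filterS => z z0; rewrite /flat_exp z0.
- have -> : flat_exp ((p - p^`()) * 'X^2) 0 = 0 by rewrite /flat_exp ltxx.
  have h : (fun h : R => h^-1 *: (flat_exp p (h + 0) - flat_exp p 0)) h @[h --> 0^'] --> (0 : R).
    have [C C0 hC] := flat_exp_le_linear (p * 'X).
    (* At 0 the difference quotient is itself the flat function of [p * 'X], and the linear bound
       sends it to 0. *)
    have E h : h^-1 *: (flat_exp p (h + 0) - flat_exp p 0) = flat_exp (p * 'X) h.
      rewrite addr0 /flat_exp ltxx subr0 /GRing.scale /= hornerM hornerX.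
      by case: ifPn => _; rewrite ?mulr0//; ring.
    under eq_fun do rewrite E.
    apply/cvgrPdist_lt => e e0.
    have C1 : 0 < C + 1 by rewrite ltr_wpDl.
    have : \forall x \near (0 : R)^', `|x| * (C + 1) < e.
      have : \forall x \near (0 : R)^', `|x| < e / (C + 1) by apply: dnbhs0_lt; rewrite divr_gt0.
      by apply: filterS => x; rewrite ltr_pdivlMr.
    apply: filterS => x; apply: le_lt_trans.
    by rewrite sub0r normrN (le_trans (hC x))// mulrC ler_wpM2l// lerDl.
  have h' : (fun h : R => h^-1 *: (flat_exp p (h *: 1 + 0) - flat_exp p 0)) h @[h --> 0^'] --> (0 : R).
    by under eq_fun do rewrite [_ *: 1]mulr1.
  by split; [apply/cvg_ex; exists 0|exact: cvg_lim h'].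
Qed.

Lemma smooth1_flat_exp p : smooth1 (flat_exp p).
Proof.
apply: (@smooth1_coind _ (fun h => exists q, h = flat_exp q)) => [h [q ->] x|h [q ->]|].
- by have [] := is_derive_flat_exp q x.
- exists ((q - q^`()) * 'X^2); apply/funext => x; rewrite derive1E.
  by have [_ ->] := is_derive_flat_exp q x.
- by exists p.
Qed.

(** The argument tends to infinity, so its inverse tends to 0 and the exponential to 1. For [p = 1]
    the limit is 1: the cutoff becomes inactive at every point where [d] is positive. *)
Lemma cvg_flat_exp p (d : R) : 0 < d ->
  flat_exp p (n.+1%:R * d - 1) @[n --> \oo] --> p.[0].
Proof.
move=> d0.
have h1 : n.+1%:R * d - 1 @[n --> \oo] --> +oo.
  apply/cvgryPge => A; near=> n; rewrite lerBrDr -ler_pdivrMr// -natr1 (@le_trans _ _ n%:R)//.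
    by near: n; exact: nbhs_infty_ger.
  by rewrite lerDl.
have h0 : \forall n \near \oo, 0 < n.+1%:R * d - 1 by move/cvgryPgt : h1; exact.
have h2 : (n.+1%:R * d - 1)^-1 @[n --> \oo] --> (0 : R) by exact/gtr0_cvgV0.
have h3 : p.[(n.+1%:R * d - 1)^-1] * expR (- (n.+1%:R * d - 1)^-1) @[n --> \oo] --> p.[0] * expR (- 0).
  apply: cvgM.
    by apply: continuous_cvg => //; exact: continuous_horner.
  by apply: continuous_cvg; [exact: continuous_expR|exact: cvgN].
rewrite oppr0 expR0 mulr1 in h3; apply: cvg_trans h3; apply: near_eq_cvg.
by apply: filterS h0 => n h0; rewrite /flat_exp h0.
Unshelve. all: by end_near. Qed.

End flat_exp.

(** * Test functions *)

Section plane_measure.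
Variable R : realType.
Implicit Types (f g : R * R -> R) (U K : set (R * R)).
Local Notation mu1 := (@lebesgue_measure R).
Local Notation mu := (@leb2 R).

Definition box (a b c d : R) : set (R * R) :=
  [set` `]a, b[] `*` [set` `]c, d[].

Lemma measurable_box a b c d : measurable (box a b c d : set (borel_plane R)).
Proof. by apply: measurableX; exact: measurable_itv. Qed.

(** The sigma-algebra is the product one, so the open set is written as the union of the countably
    many boxes with rational corners that it contains. *)
Lemma open_measurable2 U : open U -> measurable (U : set (borel_plane R)).
Proof.
move=> oU.
pose F (q : rat * rat * (rat * rat)) : set (borel_plane R) :=
  let B := box (ratr q.1.1) (ratr q.1.2) (ratr q.2.1) (ratr q.2.2) in
  if `[< B `<=` U >] then B else set0.
have -> : U = \bigcup_q F q.
  apply/seteqP; split => [[x y] Uxy|z [q _]].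
    have /nbhs_ballP[e /= e0 He] : nbhs (x, y) U by exact: open_nbhs_nbhs.
    have [a ax] := @rat_in_itvoo R (x - e) x ltac:(by rewrite ltrBlDr ltrDl).
    have [b bx] := @rat_in_itvoo R x (x + e) ltac:(by rewrite ltrDl).
    have [c cy] := @rat_in_itvoo R (y - e) y ltac:(by rewrite ltrBlDr ltrDl).
    have [d dy] := @rat_in_itvoo R y (y + e) ltac:(by rewrite ltrDl).
    move: ax bx cy dy; rewrite !in_itv/= => /andP[a1 a2] /andP[b1 b2] /andP[c1 c2] /andP[d1 d2].
    exists ((a, b), (c, d)) => //; rewrite /F /= asboolT.
      by split; rewrite /= in_itv/= ?a2 ?b1 ?c2 ?d1.
    move=> [u v] [/=]; rewrite !in_itv/= => /andP[u1 u2] /andP[v1 v2].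
    apply: He; split => /=; rewrite /ball /= ltr_norml; apply/andP; split; lra.
  by rewrite /F; case: asboolP => // BU /BU.
apply: countable_bigcupT_measurable => [|q]; first exact: countableP.
rewrite /F; case: asboolP => _; [exact: measurable_box|exact: measurable0].
Qed.

Lemma closed_measurable2 U : closed U -> measurable (U : set (borel_plane R)).
Proof.
move=> cU; rewrite -(setCK U); apply: measurableC; apply: open_measurable2.
exact: closed_openC.
Qed.

Lemma continuous_measurable2 f : continuous f ->
  measurable_fun (setT : set (borel_plane R)) f.
Proof.
move=> /continuousP cf; apply: (measurability _ (RGenOpens.measurableE R)).
move=> _ [_ [a [b ->] <-]]; rewrite setTI; apply: open_measurable2.
exact/cf/interval_open.
Qed.

Lemma continuous_measurable2S f (D : set (R * R)) : continuous f ->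
  measurable_fun (D : set (borel_plane R)) f.
Proof. by move=> cf; apply: measurable_funTS; exact: continuous_measurable2. Qed.

Lemma compact_closed2 K : compact K -> closed K.
Proof. by apply: compact_closed; exact: norm_hausdorff. Qed.

Lemma compact_measurable2 K : compact K -> measurable (K : set (borel_plane R)).
Proof. by move=> /compact_closed2; exact: closed_measurable2. Qed.

Lemma compact_box K : compact K -> exists2 r, 0 < r & K `<=` box (- r) r (- r) r.
Proof.
move=> /compact_bounded[r [_ Hr]]; exists (`|r| + 1); first by rewrite ltr_pwDr.
have {}Hr z : K z -> `|z| < `|r| + 1.
  move=> /(Hr (`|r| + 1 / 2)) h; apply: le_lt_trans (h _) _.
    by rewrite (le_lt_trans (ler_norm r))// ltrDl.
  by rewrite ltrD2l ltr_pdivrMr// mul1r ltr1n.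
move=> [x y] /Hr; rewrite prod_normE/= gt_max => /andP[]; rewrite !ltr_norml => h1 h2.
by split; rewrite /= in_itv.
Qed.

Lemma leb2_setX (A B : set R) : measurable A -> measurable B ->
  mu (A `*` B) = (mu1 A * mu1 B)%E.
Proof. by move=> mA mB; exact: (product_measure1E lebesgue_measure lebesgue_measure mA mB). Qed.

Lemma leb2_box_lty a b c d : (mu (box a b c d) < +oo)%E.
Proof.
rewrite leb2_setX// !lebesgue_measure_itv/=.
by case: ifP => _; case: ifP => _; rewrite ?mule0 ?mul0e//= -!EFinD -EFinM ltry.
Qed.

Lemma compact_leb2_lty K : compact K -> (mu K < +oo)%E.
Proof.
move=> cK; have [r r0 Kr] := compact_box cK.
apply: le_lt_trans (leb2_box_lty (-r) r (-r) r).
by apply: le_measure => //; rewrite inE; [exact: compact_measurable2|exact: measurable_box].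
Qed.

Lemma continuous_compact_bounded f K : continuous f -> compact K ->
  exists2 C, 0 < C & forall x, K x -> `|f x| <= C.
Proof.
move=> cf cK.
have /compact_bounded[r [_ Hr]] : compact (f @` K).
  by apply: continuous_compact => //; exact: continuous_subspaceT.
exists (`|r| + 1); first by rewrite ltr_pwDr.
move=> x Kx; apply: (Hr (`|r| + 1)); last by exists x.
by rewrite (le_lt_trans (ler_norm r))// ltrDl.
Qed.

Lemma bounded_L2 M f C : measurable (M : set (borel_plane R)) ->
  (mu M < +oo)%E -> measurable_fun (M : set (borel_plane R)) f ->
  (forall x, M x -> `|f x| <= C) -> L2 M f.
Proof.
move=> mM fM mf bf; split => //.
have : mu.-integrable M (EFin \o (fun x => f x ^+ 2)).
  apply: measurable_bounded_integrable => //; first exact: measurable_funX.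
  exists (C ^+ 2); split; first exact: num_real.
  move=> y Cy x Mx; apply: le_trans (ltW Cy).
  by rewrite normrX ler_pXn2r ?nnegrE ?bf// (le_trans _ (bf _ Mx)).
move=> /integrableP[_]; apply: le_lt_trans.
rewrite le_eqVlt; apply/orP; left; apply/eqP.
by apply: eq_integral => x _ /=; rewrite ger0_norm ?sqr_ge0.
Qed.

Lemma compact_support_integrable f K : continuous f -> compact K ->
  (forall x, ~ K x -> f x = 0) -> mu.-integrable setT (EFin \o f).
Proof.
move=> cf cK f0; have mK := compact_measurable2 cK.
have : mu.-integrable K (EFin \o f).
  apply: measurable_bounded_integrable => //; first exact: compact_leb2_lty.
    exact: continuous_measurable2S.
  have [C C0 HC] := continuous_compact_bounded cf cK.
  exists C; split; first exact: num_real.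
  by move=> y Cy x Kx; apply: le_trans (ltW Cy); exact: HC.
move/(integrable_mkcond _ mK); congr (integrable _ _ _).
apply/funext => x; rewrite patchE; case: ifPn => // /negP xK /=.
by rewrite f0// => Kx; apply: xK; rewrite inE.
Qed.

Lemma Rintegral_zero_off f (M : set (R * R)) : measurable (M : set (borel_plane R)) ->
  (forall x, ~ M x -> f x = 0) -> \int[mu]_(x in M) f x = \int[mu]_x f x.
Proof.
move=> mM f0; rewrite Rintegral_mkcond; apply: eq_Rintegral => x _.
rewrite patchE; case: ifPn => // /negP xK.
by rewrite f0// => Kx; apply: xK; rewrite inE.
Qed.

(** The fundamental theorem on the interval from [- r] to [r], at whose ends [g] vanishes. *)
Lemma integral_derivative_eq0 (g dg : R -> R) (r : R) : 0 < r ->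
  (forall x, is_derive x (1 : R) g (dg x)) -> continuous dg ->
  (forall x, r <= `|x| -> g x = 0) -> (forall x, r <= `|x| -> dg x = 0) ->
  (\int[mu1]_x (dg x)%:E = 0)%E.
Proof.
move=> r0 dgP cdg g0 dg0.
have -> : (\int[mu1]_x (dg x)%:E = \int[mu1]_(x in `[(- r)%R, r]) (dg x)%:E)%E.
  rewrite [RHS]integral_mkcond; apply: eq_integral => x _.
  rewrite patchE; case: ifPn => //; rewrite notin_setE/= in_itv/= => /negP h.
  by rewrite dg0// leNgt; apply: contra h => h; rewrite -ler_norml ltW.
have dgx x : derivable g x 1 by have [] := dgP x.
have cg : continuous g by move=> x; apply: differentiable_continuous; exact/derivable1_diffP.
rewrite (@continuous_FTC2 _ dg g)//.
- have nr : `|r| = r by rewrite ger0_norm// ltW.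
  by rewrite (g0 r) ?nr// (g0 (- r)) ?normrN ?nr// -EFinB subrr.
- by lra.
- exact: continuous_subspaceT.
- by split; [move=> x _|apply: cvg_at_right_filter; exact: cg|apply: cvg_at_left_filter; exact: cg].
- by move=> x _; rewrite derive1E; have [_ ->] := dgP x.
Qed.

End plane_measure.

(** * Calculus of test functions and integration by parts *)

Section test_functions.
Variable R : realType.
Implicit Types (f g h : R * R -> R) (M K : set (R * R)).
Local Notation mu1 := (@lebesgue_measure R).
Local Notation mu := (@leb2 R).

Lemma derive_zero_off K f b : closed K -> (forall x, ~ K x -> f x = 0) ->
  forall x, ~ K x -> 'D_(evec R b) f x = 0.
Proof.
move=> cK f0 x Kx; have : \forall y \near x, ~ K y.
  have oK : open (~` K) by exact: closed_openC.
  exact: open_nbhs_nbhs.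
move=> nK; have : \forall y \near x, f y = (cst 0 : R * R -> R) y.
  by apply: filterS nK => y /f0.
by move/near_eq_derive => ->; exact: derive_cst.
Qed.

Lemma test_function_derive M f b : test_function M f ->
  test_function M ('D_(evec R b) f).
Proof.
move=> [sf [K [cK KM f0]]]; split; first exact: smooth_derive.
by exists K; split => //; apply: derive_zero_off => //; exact: compact_closed2.
Qed.

Lemma test_function_mul M f g : smooth g -> test_function M f ->
  test_function M (fun x => g x * f x).
Proof.
move=> sg [sf [K [cK KM f0]]]; split; first exact: smoothM.
by exists K; split => // x Kx; rewrite f0 ?mulr0.
Qed.

Lemma test_function_add M f g : test_function M f -> test_function M g ->
  test_function M (fun x => f x + g x).
Proof.
move=> [sf [K [cK KM f0]]] [sg [L [cL LM g0]]]; split; first exact: smoothD.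
exists (K `|` L); split; first exact: compactU.
  by move=> x [/KM|/LM].
by move=> x /not_orP[/f0 -> /g0 ->]; rewrite addr0.
Qed.

Lemma test_function_scale M (a : R) f : test_function M f ->
  test_function M (fun x => a * f x).
Proof. by apply: test_function_mul; exact: smooth_cst. Qed.

Lemma test_function_zero M f x : test_function M f -> ~ M x -> f x = 0.
Proof. by move=> [_ [K [_ KM f0]]] nMx; apply: f0 => /KM. Qed.

Lemma test_function_integrable M f : test_function M f ->
  mu.-integrable setT (EFin \o f).
Proof.
move=> [sf [K [cK KM f0]]]; apply: compact_support_integrable cK f0.
exact: smooth_continuous.
Qed.

Lemma test_function_laplacian M f : test_function M f -> test_function M (laplacian f).
Proof.
move=> tf; apply: test_function_add.
  exact: (test_function_derive true (test_function_derive true tf)).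
exact: (test_function_derive false (test_function_derive false tf)).
Qed.

(** Fubini, integrating first along the direction of the derivative, where compact support leaves
    nothing. *)
Lemma Rintegral_derive_eq0 M f b : test_function M f ->
  \int[mu]_x 'D_(evec R b) f x = 0.
Proof.
move=> tf; have idf := test_function_integrable (test_function_derive b tf).
have [sf [K [cK _ f0]]] := tf.
have sdf := smooth_derive b sf.
have df0 := derive_zero_off b (compact_closed2 cK) f0.
have [r r0 Kr] := compact_box cK.
have out1 x y : r <= `|x| -> ~ K (x, y).
  by move=> rx /Kr[/=]; rewrite in_itv/= -ltr_norml ltNge rx.
have out2 x y : r <= `|y| -> ~ K (x, y).
  by move=> rx /Kr[_/=]; rewrite in_itv/= -ltr_norml ltNge rx.
have cpair1 (y : R) : continuous (fun x : R => (x, y)).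
  by move=> x; apply: (@cvg_pair _ _ _ _ (nbhs x) (nbhs y)) => //; exact: cvg_cst.
have cpair2 (x : R) : continuous (fun y : R => (x, y)).
  by move=> y; apply: (@cvg_pair _ _ _ _ (nbhs x) (nbhs y)) => //; exact: cvg_cst.
have cdf := smooth_continuous sdf.
rewrite /Rintegral; case: b idf sdf df0 cdf => idf sdf df0 cdf /=.
  rewrite -(integral21_prod_meas1 idf) /fubini_G /=.
  rewrite integral0_eq// => y _.
  apply: (@integral_derivative_eq0 _ (fun x => f (x, y)) _ r) => //.
  - move=> x.
    have E : (fun h : R => h^-1 *: (f (h *: e1 R + (x, y)) - f (x, y))) =
             (fun h : R => h^-1 *: (f (h *: 1 + x, y) - f (x, y))).
      apply/funext => h; have -> // : h *: e1 R + (x, y) = (h *: 1 + x, y).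
      by congr pair; rewrite /= scaler0 add0r.
    have dfx := @smooth_derivable R f (e1 R) (x, y) sf.
    split.
      by move: dfx; rewrite /derivable E.
    by rewrite /derive -E.
  - move=> x; apply: (@continuous_comp _ _ _ (fun x : R => (x, y : R)) ('D_(evec R true) f) x).
      exact: cpair1.
    exact: cdf.
  - by move=> x rx; apply: f0; exact: out1.
  - by move=> x rx; apply: df0; exact: out1.
rewrite -(integral12_prod_meas1 idf) /fubini_F /=.
rewrite integral0_eq// => x _.
apply: (@integral_derivative_eq0 _ (fun y => f (x, y)) _ r) => //.
- move=> y.
  have E : (fun h : R => h^-1 *: (f (h *: e2 R + (x, y)) - f (x, y))) =
           (fun h : R => h^-1 *: (f (x, h *: 1 + y) - f (x, y))).
    apply/funext => h; have -> // : h *: e2 R + (x, y) = (x, h *: 1 + y).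
    by congr pair; rewrite /= scaler0 add0r.
  have dfy := @smooth_derivable R f (e2 R) (x, y) sf.
  split.
    by move: dfy; rewrite /derivable E.
  by rewrite /derive -E.
- move=> y; apply: (@continuous_comp _ _ _ (fun y : R => (x : R, y)) ('D_(evec R false) f) y).
    exact: cpair2.
  exact: cdf.
- by move=> y ry; apply: f0; exact: out2.
- by move=> y ry; apply: df0; exact: out2.
Qed.

Section on_domain.
Variable M : set (R * R).
Hypothesis mM : measurable (M : set (borel_plane R)).
Hypothesis fM : (mu M < +oo)%E.

Lemma test_function_L2 f : test_function M f -> L2 M f.
Proof.
move=> [sf [K [cK KM f0]]]; have cf := smooth_continuous sf.
have [C C0 HC] := continuous_compact_bounded cf cK.
apply: (bounded_L2 (C := C)) => //; first exact: continuous_measurable2S.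
move=> x _; have [/HC//|/f0 ->] := pselect (K x); rewrite normr0; exact: ltW.
Qed.

Lemma test_function_L2dot f g : test_function M g ->
  L2dot M f g = \int[mu]_x (f x * g x).
Proof.
move=> tg; apply: Rintegral_zero_off => // x nMx.
by rewrite (test_function_zero tg)// mulr0.
Qed.

(** The product [f * g] is again a test function, so the integral of its derivative vanishes. *)
Lemma test_function_ibp f g b : smooth f -> test_function M g ->
  L2dot M f ('D_(evec R b) g) = - L2dot M ('D_(evec R b) f) g.
Proof.
move=> sf tg; have tdg := test_function_derive b tg.
rewrite !test_function_L2dot//.
have sdf := smooth_derive b sf.
have tfg := test_function_mul sf tg.
have i1 := test_function_integrable (test_function_mul sf tdg).
have i2 := test_function_integrable (test_function_mul sdf tg).
apply/eqP; rewrite -subr_eq0 opprK -RintegralD//; apply/eqP.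
rewrite -[RHS](Rintegral_derive_eq0 b tfg); apply: eq_Rintegral => x _.
rewrite deriveM//; [|exact: smooth_derivable|apply: smooth_derivable; exact: tg.1].
by rewrite /GRing.scale/= [g x * _]mulrC.
Qed.

Lemma L2dot_laplacianr f g : smooth f -> test_function M g ->
  L2dot M f (laplacian g) = L2dot M (laplacian f) g.
Proof.
move=> sf tg.
have h b : L2dot M f ('D_(evec R b) ('D_(evec R b) g)) =
           L2dot M ('D_(evec R b) ('D_(evec R b) f)) g.
  rewrite test_function_ibp//; last exact: test_function_derive.
  by rewrite test_function_ibp ?opprK//; exact: smooth_derive.
have td b : test_function M ('D_(evec R b) ('D_(evec R b) g)).
  by do 2 apply: test_function_derive.
have i b : mu.-integrable setT (EFin \o (fun x => f x * 'D_(evec R b) ('D_(evec R b) g) x)).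
  by apply: (@test_function_integrable M); exact: test_function_mul.
have j b : mu.-integrable setT (EFin \o (fun x => 'D_(evec R b) ('D_(evec R b) f) x * g x)).
  by apply: (@test_function_integrable M); apply: test_function_mul => //; do 2 apply: smooth_derive.
have E1 b := test_function_L2dot f (td b).
have E2 b := test_function_L2dot ('D_(evec R b) ('D_(evec R b) f)) tg.
pose D2 b h := 'D_(evec R b) ('D_(evec R b) h).
have S1 : \int[mu]_x (f x * D2 true g x + f x * D2 false g x) =
  \int[mu]_x (f x * D2 true g x) + \int[mu]_x (f x * D2 false g x).
  by apply: RintegralD; [exact: measurableT|exact: i|exact: i].
have S2 : \int[mu]_x (D2 true f x * g x + D2 false f x * g x) =
  \int[mu]_x (D2 true f x * g x) + \int[mu]_x (D2 false f x * g x).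
  by apply: RintegralD; [exact: measurableT|exact: j|exact: j].
rewrite (test_function_L2dot f (test_function_laplacian tg)).
rewrite (test_function_L2dot (laplacian f) tg).
apply: etrans (etrans (_ : _ = \int[mu]_x (f x * D2 true g x + f x * D2 false g x)) S1) _.
  by apply: eq_Rintegral => x _; rewrite -mulrDr.
apply: etrans (esym (congr2 +%R (E1 true) (E1 false))) _.
apply: etrans (congr2 +%R (h true) (h false)) _.
apply: etrans (congr2 +%R (E2 true) (E2 false)) _.
apply: etrans (esym S2) _.
by apply: eq_Rintegral => x _; rewrite -mulrDl.
Qed.

End on_domain.
End test_functions.

(** * The Sobolev space H^1_0 *)

Section sobolev.
Variable R : realType.
Local Notation mu := (@leb2 R).
Variable M : set (R * R).
Hypothesis mM : measurable (M : set (borel_plane R)).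
Hypothesis fM : (mu M < +oo)%E.
Implicit Types (f u v psi : R * R -> R) (g : bool -> R * R -> R).
Local Notation nrm2 := (nrm2 M).

(** The pair of a function and its weak gradient, as a point of the closure of the graph of the
    gradient on test functions. Tolerances instead of sequences make closure under sums and limits
    direct. *)
Definition H10_grad u g := [/\ L2 M u, forall b, L2 M (g b) &
  forall e : R, 0 < e -> exists2 psi, test_function M psi &
    nrm2 (fun x => psi x - u x) < e /\
    forall b, nrm2 (fun x => 'D_(evec R b) psi x - g b x) < e].

Lemma cvgn_unique (a : nat -> R) (x y : R) :
  a n @[n --> \oo] --> x -> a n @[n --> \oo] --> y -> x = y.
Proof. by move=> ax ay; exact: (cvg_unique (@Rhausdorff R) ax ay). Qed.

Lemma cvg_inv_succ0 : (n.+1%:R^-1 : R) @[n --> \oo] --> (0 : R).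
Proof. exact: cvg_harmonic. Qed.

Lemma H10_grad_seq u g : H10_grad u g -> exists psi : nat -> R * R -> R,
  [/\ forall n, test_function M (psi n),
      nrm2 (fun x => psi n x - u x) @[n --> \oo] --> (0 : R) &
      forall b, nrm2 (fun x => 'D_(evec R b) (psi n) x - g b x) @[n --> \oo] --> (0 : R)].
Proof.
move=> [Lu Lg H].
have /choice[psi Hpsi] : forall n : nat, exists psi, test_function M psi /\
   (nrm2 (fun x => psi x - u x) < n.+1%:R^-1 /\
    forall b, nrm2 (fun x => 'D_(evec R b) psi x - g b x) < n.+1%:R^-1).
  by move=> n; have [|psi ? ?] := H n.+1%:R^-1; [rewrite invr_gt0|exists psi].
have sq (a : nat -> R) : (forall n, 0 <= a n) -> (forall n, a n < n.+1%:R^-1) ->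
    a n @[n --> \oo] --> (0 : R).
  move=> a0 a1; apply: (@squeeze_cvgr _ _ _ _ (fun=> 0) (fun n => n.+1%:R^-1)).
  - by apply: nearW => n; rewrite a0 ltW.
  - exact: cvg_cst.
  - exact: cvg_inv_succ0.
exists psi; split => [n|| b]; first by have [] := Hpsi n.
- by apply: sq => n; [exact: nrm2_ge0|have [_ []] := Hpsi n].
- by apply: sq => n; [exact: nrm2_ge0|have [_ [_ ]] := Hpsi n].
Qed.

Lemma cvg0_bool_lt (a : nat -> R) (c : bool -> nat -> R) (e : R) :
  a n @[n --> \oo] --> (0 : R) -> (forall b, c b n @[n --> \oo] --> (0 : R)) ->
  0 < e -> exists N, a N < e /\ forall b, c b N < e.
Proof.
move=> ca cc e0.
have [N _ HN] : \forall n \near \oo, [/\ a n < e, c true n < e & c false n < e].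
  near=> n; split; near: n.
  - exact: cvgr_lt ca _ e0.
  - exact: cvgr_lt (cc true) _ e0.
  - exact: cvgr_lt (cc false) _ e0.
by exists N; have [h1 h2 h3] := HN N (leqnn N); split => //; case.
Unshelve. all: by end_near. Qed.

Lemma seq_H10_grad (psi : nat -> R * R -> R) u g : L2 M u -> (forall b, L2 M (g b)) ->
  (forall n, test_function M (psi n)) ->
  nrm2 (fun x => psi n x - u x) @[n --> \oo] --> (0 : R) ->
  (forall b, nrm2 (fun x => 'D_(evec R b) (psi n) x - g b x) @[n --> \oo] --> (0 : R)) ->
  H10_grad u g.
Proof.
move=> Lu Lg tpsi c1 c2; split => // e e0.
have [N [h1 h2]] := cvg0_bool_lt c1 c2 e0.
by exists (psi N).
Qed.

Lemma H10_gradW u g : H10_grad u g -> H10 M u.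
Proof.
move=> H; have [psi [tpsi c1 c2]] := H10_grad_seq H; case: H => Lu Lg _.
split => //; exists psi, (g true), (g false).
have tL n := test_function_L2 mM fM (tpsi n).
have tLd b n := test_function_L2 mM fM (test_function_derive b (tpsi n)).
split => //.
- by apply/cvg_L2dist2 => //; apply: nearW.
- by apply/cvg_L2dist2 => //; [apply: nearW; exact: (tLd true)|exact: (c2 true)].
- by apply/cvg_L2dist2 => //; [apply: nearW; exact: (tLd false)|exact: (c2 false)].
Qed.

Lemma H10P u : H10 M u -> exists g, H10_grad u g.
Proof.
move=> [Lu [psi [gx [gy [[Lgx Lgy] tpsi c cx cy]]]]].
exists (fun b => if b then gx else gy).
have tL n := test_function_L2 mM fM (tpsi n).
have tLd b n := test_function_L2 mM fM (test_function_derive b (tpsi n)).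
apply: (@seq_H10_grad psi) => //; first by case.
  by apply/cvg_L2dist2 => //; apply: nearW.
case.
  by apply/cvg_L2dist2 => //; apply: nearW; exact: (tLd true).
by apply/cvg_L2dist2 => //; apply: nearW; exact: (tLd false).
Qed.

Lemma H10_grad_add u1 g1 u2 g2 : H10_grad u1 g1 -> H10_grad u2 g2 ->
  H10_grad (fun x => u1 x + u2 x) (fun b x => g1 b x + g2 b x).
Proof.
move=> [Lu1 Lg1 H1] [Lu2 Lg2 H2]; split.
- exact: L2D.
- by move=> b; exact: L2D.
move=> e e0; have e4 : 0 < e / 4 by rewrite divr_gt0.
have [p1 t1 [n1 d1]] := H1 _ e4; have [p2 t2 [n2 d2]] := H2 _ e4.
exists (fun x => p1 x + p2 x); first exact: test_function_add.
have key a1 a2 b1 b2 : L2 M a1 -> L2 M a2 -> L2 M b1 -> L2 M b2 ->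
  nrm2 (fun x => a1 x - b1 x) < e / 4 -> nrm2 (fun x => a2 x - b2 x) < e / 4 ->
  nrm2 (fun x => a1 x + a2 x - (b1 x + b2 x)) < e.
  move=> *; have := nrm2D_le mM (f := fun x => a1 x - b1 x) (g := fun x => a2 x - b2 x).
  move=> /(_ (L2B _ _ _) (L2B _ _ _)) h.
  apply: le_lt_trans (_ : nrm2 (fun x => (a1 x - b1 x) + (a2 x - b2 x)) < e).
    by rewrite le_eqVlt; apply/orP; left; apply/eqP/L2dot_ext => x _; ring.
  apply: le_lt_trans (h _ _ _ _ _ _) _ => //; lra.
have tL := test_function_L2 mM fM.
split; first by apply: key => //; exact: tL.
move=> b; have DE x : 'D_(evec R b) (fun x => p1 x + p2 x) x =
    'D_(evec R b) p1 x + 'D_(evec R b) p2 x.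
  by apply: deriveD; apply: smooth_derivable; [case: t1|case: t2].
under eq_fun do rewrite DE.
by apply: key => //; apply: tL; exact: test_function_derive.
Qed.

Lemma H10_grad_scale (a : R) u g : H10_grad u g ->
  H10_grad (fun x => a * u x) (fun b x => a * g b x).
Proof.
move=> [Lu Lg H]; split.
- exact: L2Z.
- by move=> b; exact: L2Z.
move=> e e0; have a1 : 0 < a ^+ 2 + 1 by rewrite ltr_wpDl ?sqr_ge0.
have e4 : 0 < e / (a ^+ 2 + 1) by rewrite divr_gt0.
have [p t [n d]] := H _ e4.
exists (fun x => a * p x); first exact: test_function_scale.
have key f1 f2 : L2 M f1 -> L2 M f2 -> nrm2 (fun x => f1 x - f2 x) < e / (a ^+ 2 + 1) ->
    nrm2 (fun x => a * f1 x - a * f2 x) < e.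
  move=> L1 L2; rewrite ltr_pdivlMr// => h.
  have -> : nrm2 (fun x => a * f1 x - a * f2 x) = a ^+ 2 * nrm2 (fun x => f1 x - f2 x).
    rewrite -nrm2Z//; last exact: L2B.
    by apply: L2dot_ext => x _; rewrite mulrBr.
  apply: le_lt_trans h; rewrite mulrC ler_wpM2l ?nrm2_ge0//; lra.
have tL := test_function_L2 mM fM.
split; first by apply: key => //; exact: tL.
move=> b; have DE x : 'D_(evec R b) (fun x => a * p x) x = a * 'D_(evec R b) p x.
  by apply: deriveZ; apply: smooth_derivable; case: t.
under eq_fun do rewrite DE.
by apply: key => //; apply: tL; exact: test_function_derive.
Qed.

Lemma H10_grad0 : H10_grad (fun=> 0) (fun _ _ => 0).
Proof.
have L0 := @L2_0 R M; split => // e e0.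
exists (fun=> 0); first by split; [exact: smooth_cst|exists set0; split => //; exact: compact0].
have z f : (forall x, f x = 0) -> nrm2 f < e.
  move=> f0; rewrite -[nrm2 f]/(L2dot M f f) /L2dot; under eq_Rintegral do rewrite f0 mul0r.
  by rewrite Rintegral_cst// mul0r.
split; first by apply: z => x; rewrite subr0.
by move=> b; apply: z => x; rewrite derive_cst subr0.
Qed.

Lemma H10_grad_sum (I : Type) (r : seq I) (F : I -> R * R -> R) G :
  (forall i, H10_grad (F i) (G i)) ->
  H10_grad (fun x => \sum_(i <- r) F i x) (fun b x => \sum_(i <- r) G i b x).
Proof.
move=> H; elim: r => [|i r IH].
  under eq_fun do rewrite big_nil.
  under [X in H10_grad _ X]eq_fun do under eq_fun do rewrite big_nil.
  exact: H10_grad0.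
under eq_fun do rewrite big_cons.
under [X in H10_grad _ X]eq_fun do under eq_fun do rewrite big_cons.
exact: H10_grad_add.
Qed.

(** Closedness of [H^1_0], used to pass from the partial sums of the heat series to its limit. *)
Lemma H10_grad_lim u g : L2 M u -> (forall b, L2 M (g b)) ->
  (forall e : R, 0 < e -> exists u' g', [/\ H10_grad u' g',
     nrm2 (fun x => u' x - u x) < e &
     forall b, nrm2 (fun x => g' b x - g b x) < e]) ->
  H10_grad u g.
Proof.
move=> Lu Lg H; split => // e e0; have e4 : 0 < e / 4 by rewrite divr_gt0.
have [u' [g' [[Lu' Lg' H'] n1 d1]]] := H _ e4.
have [p t [n2 d2]] := H' _ e4; exists p => //.
have tL := test_function_L2 mM fM.
split.
  apply: le_lt_trans (nrm2B_le mM (tL _ t) Lu' Lu) _; lra.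
move=> b; have := d1 b; have := d2 b => h1 h2.
apply: le_lt_trans (nrm2B_le mM (tL _ (test_function_derive b t)) (Lg' b) (Lg b)) _; lra.
Qed.

Lemma test_function_green f psi : test_function M f -> test_function M psi ->
  L2dot M f (laplacian psi) =
  - (L2dot M ('D_(evec R true) f) ('D_(evec R true) psi) +
     L2dot M ('D_(evec R false) f) ('D_(evec R false) psi)).
Proof.
move=> tf tp.
have tL := test_function_L2 mM fM.
have i b := test_function_ibp mM b tf.1 (test_function_derive b tp).
have T b := test_function_derive b (test_function_derive b tp).
apply: etrans (L2dotDr mM (tL _ (T true)) (tL _ (T false)) (tL _ tf)) _.
by apply: etrans (congr2 +%R (i true) (i false)) _; rewrite opprD.
Qed.

(** The weak equation speaks of test functions only. Approximating [u] and then [w] by test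
    functions turns it into the Dirichlet form, which is symmetric in the two gradients. *)
Lemma dirichlet_green u v w gu gw : dirichlet_laplacian M u v ->
  H10_grad u gu -> H10_grad w gw ->
  L2dot M v w = - (L2dot M (gu true) (gw true) + L2dot M (gu false) (gw false)).
Proof.
move=> [_ Lv weak] Hu Hw.
have tL := test_function_L2 mM fM.
have [f [tf cf cdf]] := H10_grad_seq Hu.
have [p [tp cp cdp]] := H10_grad_seq Hw.
have [Lu Lgu _] := Hu; have [Lw Lgw _] := Hw.
(* First limit: [psi] is fixed and [u] is approximated by test functions, for which Green's identity
   is integration by parts. *)
have E psi : test_function M psi -> L2dot M v psi =
    - (L2dot M (gu true) ('D_(evec R true) psi) + L2dot M (gu false) ('D_(evec R false) psi)).
  move=> tpsi; rewrite -weak//.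
  have c1 : L2dot M (f n) (laplacian psi) @[n --> \oo] --> L2dot M u (laplacian psi).
    by apply: cvg_L2dot => //; [apply: nearW => n; exact: tL|apply: tL; exact: test_function_laplacian].
  have c2 b : L2dot M ('D_(evec R b) (f n)) ('D_(evec R b) psi) @[n --> \oo] -->
      L2dot M (gu b) ('D_(evec R b) psi).
    by apply: cvg_L2dot => //; [apply: nearW => n; apply: tL|apply: tL]; exact: test_function_derive.
  apply: (cvgn_unique c1).
  under eq_fun do rewrite test_function_green//.
  exact: cvgN (cvgD (c2 true) (c2 false)).
have c1 : L2dot M v (p n) @[n --> \oo] --> L2dot M v w.
  rewrite L2dotC; under eq_fun do rewrite L2dotC.
  by apply: cvg_L2dot => //; apply: nearW => n; exact: tL.
have c2 b : L2dot M (gu b) ('D_(evec R b) (p n)) @[n --> \oo] --> L2dot M (gu b) (gw b).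
  rewrite L2dotC; under eq_fun do rewrite L2dotC.
  by apply: cvg_L2dot => //; apply: nearW => n; apply: tL; exact: test_function_derive.
apply: (cvgn_unique c1).
under eq_fun do rewrite E//.
exact: cvgN (cvgD (c2 true) (c2 false)).
Qed.

Lemma dirichlet_laplacian_sym u v w z : dirichlet_laplacian M u v ->
  dirichlet_laplacian M w z -> L2dot M v w = L2dot M u z.
Proof.
move=> Duv Dwz; have [Hu _ _] := Duv; have [Hw _ _] := Dwz.
have [gu Hgu] := H10P Hu; have [gw Hgw] := H10P Hw.
rewrite (dirichlet_green Duv Hgu Hgw) [RHS]L2dotC (dirichlet_green Dwz Hgw Hgu).
by rewrite [L2dot M (gu true) _]L2dotC [L2dot M (gu false) _]L2dotC.
Qed.

Lemma dominated_cvg_nrm2 (f_ : nat -> R * R -> R) (h : R * R -> R) :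
  (forall n, measurable_fun (M : set (borel_plane R)) (f_ n)) -> L2 M h ->
  (forall n x, M x -> `|f_ n x| <= h x) ->
  (forall x, M x -> f_ n x @[n --> \oo] --> (0 : R)) ->
  nrm2 (f_ n) @[n --> \oo] --> (0 : R).
Proof.
move=> mf Lh bf cf.
have mf2 n : measurable_fun (M : set (borel_plane R)) (EFin \o (fun x => f_ n x * f_ n x)).
  by apply/measurable_EFinP; exact: measurable_funM.
have ih := L2_integrable_mul mM Lh Lh.
have cf2 x : M x -> (EFin \o (fun x => f_ n x * f_ n x)) x @[n --> \oo] --> 0%E.
  move=> Mx; rewrite /=; apply: cvg_EFin; first exact: nearW.
  by rewrite /= -[X in _ --> X](mulr0 0); apply: cvgM; exact: cf.
have bf2 x n : M x ->
    (`|(EFin \o (fun x => (f_ n x * f_ n x)%R)) x| <= (EFin \o (fun x => (h x * h x)%R)) x)%E.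
  by move=> Mx; rewrite /= lee_fin normrM ler_pM ?bf.
pose F n := EFin \o (fun x => f_ n x * f_ n x).
have cfz : {ae mu, forall x, M x -> F ^~ x @ \oo --> cst (0%E : \bar R) x}.
  by apply: aeW => x Mx; exact: cf2.
have bfz : {ae mu, forall x n, M x -> (`|F n x| <= (EFin \o (fun x => (h x * h x)%R)) x)%E}.
  by apply: aeW => x n Mx; exact: bf2.
have [_ _ i] := @dominated_convergence _ _ _ mu M mM
  (fun n => EFin \o (fun x => f_ n x * f_ n x)) (cst 0%E) (EFin \o (fun x => h x * h x))
  mf2 (@measurable_cst _ _ _ _ _ _) cfz ih bfz.
rewrite integral0 in i; exact: fine_cvg i.
Qed.

Lemma L2_cst (c : R) : L2 M (fun=> c).
Proof. exact: (bounded_L2 (C := `|c|)). Qed.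

Lemma bounded_cvg_nrm2 (f_ : nat -> R * R -> R) (C : R) :
  (forall n, measurable_fun (M : set (borel_plane R)) (f_ n)) ->
  (forall n x, M x -> `|f_ n x| <= C) ->
  (forall x, M x -> f_ n x @[n --> \oo] --> (0 : R)) ->
  nrm2 (f_ n) @[n --> \oo] --> (0 : R).
Proof. by move=> mf bf; apply: dominated_cvg_nrm2 mf (L2_cst C) bf. Qed.

End sobolev.

(** * Membership in [H^1_0] through a boundary-defining function *)

Section cutoff.
Variable R : realType.
Local Notation mu := (@leb2 R).
Variables (M S C : set (R * R)) (d U : R * R -> R).
Hypothesis mM : measurable (M : set (borel_plane R)).
Hypothesis fM : (mu M < +oo)%E.
Hypothesis oS : open S.
Hypothesis cC : compact C.
Hypothesis SC : S `<=` C.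
Hypothesis SM : S `<=` M.
Hypothesis d_gt0 : forall x, S x -> 0 < d x.
Hypothesis d_bd : forall x, C x -> ~ S x -> d x = 0.
Hypothesis ed : elementary d.
Hypothesis eU : elementary U.

Lemma restrict_in (f : R * R -> R) x : S x -> (f \_ S) x = f x.
Proof. by move=> Sx; rewrite patchE mem_set. Qed.

Lemma restrict_out (f : R * R -> R) x : ~ S x -> (f \_ S) x = 0.
Proof. by move=> Sx; rewrite patchE memNset. Qed.

Let arg n x : R := n.+1%:R * d x - 1.

(* The smooth cutoff [d * flat_exp 1 (d / e - 1)] of [d] vanishes for [d <= e];
   its derivative is [flat_exp (1 + 'X + 'X^2) (d / e - 1)] times that of [d],
   hence bounded uniformly in [e]. *)
Let trunc n x : R := d x * flat_exp 1 (arg n x) * U x.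
Let K n : set (R * R) := C `&` [set x | 1 <= n.+1%:R * d x].

Lemma trunc_elementary n : elementary (trunc n).
Proof.
have e1 : elementary (arg n).
  apply: elementaryD; last exact: elementary_cst.
  by apply: elementaryM => //; exact: elementary_cst.
apply: elementaryM => //; apply: elementaryM => //.
by apply: elementary_comp => //; exact: smooth1_flat_exp.
Qed.

Lemma cutoff_zero n x : ~ K n x -> (trunc n \_ S) x = 0.
Proof.
move=> nK; have [Sx|Sx] := pselect (S x); last exact: restrict_out.
rewrite restrict_in// /trunc /flat_exp ifF ?mulr0 ?mul0r//.
apply/negbTE; rewrite -leNgt /arg subr_le0 ltW// ltNge; apply/negP => h.
by apply: nK; split => //; exact: SC.
Qed.

Let cd : continuous d.
Proof. by apply: smooth_continuous; exact: elementary_smooth. Qed.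

Lemma cutoff_compact n : compact (K n).
Proof.
apply: compact_closedI => //.
have -> : [set x | 1 <= n.+1%:R * d x] = (fun x => n.+1%:R * d x) @^-1` [set y | 1 <= y].
  by [].
apply: closed_comp => [x _|]; last exact: closed_ge.
by apply: cvgM; [exact: cvg_cst|exact: cd].
Qed.

(** On the part of [C] outside [S] the function [d] is 0, hence below [n.+1%:R^-1]: the support of
    the truncation stays away from the boundary. *)
Lemma cutoff_sub n : K n `<=` S.
Proof.
move=> x [Cx /= h]; apply: contrapT => nS.
by move: h; rewrite d_bd// mulr0 ler10.
Qed.

Lemma near_restrict (f : R * R -> R) x : S x -> \forall y \near x, (f \_ S) y = f y.
Proof.
move=> Sx; have : \forall y \near x, S y by exact: open_nbhs_nbhs.
by apply: filterS => y; exact: restrict_in.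
Qed.

Lemma cutoff_test n : test_function M (trunc n \_ S).
Proof.
split; last first.
  exists (K n); split; [exact: cutoff_compact|exact: subset_trans (@cutoff_sub n) SM|].
  exact: cutoff_zero.
apply: smooth_local => x; have [Sx|Sx] := pselect (S x).
  exists (trunc n); first exact/elementary_smooth/trunc_elementary.
  exact: near_restrict.
exists (cst 0); first exact: smooth_cst.
have oK : open (~` K n) by apply: closed_openC; apply: compact_closed2; exact: cutoff_compact.
have : \forall y \near x, ~ K n y.
  by apply: open_nbhs_nbhs; split => // /cutoff_sub.
by apply: filterS => y; exact: cutoff_zero.
Qed.

Let arg_elementary n : elementary (arg n).
Proof.
apply: elementaryD; last exact: elementary_cst.
by apply: elementaryM => //; exact: elementary_cst.
Qed.

Let derive_arg n b x : 'D_(evec R b) (arg n) x = n.+1%:R * 'D_(evec R b) d x.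
Proof.
have sd := elementary_smooth ed.
apply: etrans (smooth_deriveD _ _ _ _) _; [|exact: smooth_cst|].
  by apply: smoothM => //; exact: smooth_cst.
by rewrite smooth_deriveZ// derive_cst addr0.
Qed.

Lemma derive_trunc n b x : 'D_(evec R b) (trunc n) x =
  'D_(evec R b) d x * flat_exp (1 + 'X + 'X^2) (arg n x) * U x +
  d x * flat_exp 1 (arg n x) * 'D_(evec R b) U x.
Proof.
have sd := elementary_smooth ed.
have sU := elementary_smooth eU.
have sa := elementary_smooth (arg_elementary n).
have sb : smooth (fun x => flat_exp 1 (arg n x)).
  by apply: elementary_smooth; apply: elementary_comp => //; exact: smooth1_flat_exp.
apply: etrans (smooth_deriveM _ _ _ _) _ => //; first exact: smoothM.
rewrite (smooth_deriveM _ _ sd sb).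
rewrite (smooth_derive_comp1 _ _ (@smooth1_flat_exp R 1) sa) derive_arg.
rewrite derive1E; have [_ ->] := is_derive_flat_exp 1 (arg n x).
rewrite derivC subr0 mul1r.
(* The chain rule brings a factor [n.+1], which together with [d] equals [arg + 1]; and
   [(y + 1) * y ^- 2] is [y^-1 + y ^- 2], whence the terms ['X] and ['X^2]. *)
have -> : flat_exp (1 + 'X + 'X^2) (arg n x) =
  flat_exp 1 (arg n x) + n.+1%:R * d x * flat_exp 'X^2 (arg n x).
  have -> : n.+1%:R * d x = arg n x + 1 by rewrite /arg subrK.
  rewrite /flat_exp; case: ifPn => [y0|_]; last by rewrite mulr0 addr0.
  rewrite !hornerD !hornerC !hornerX !hornerXn; set y := arg n x in y0 *.
  by field; rewrite gt_eqF.
ring.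
Qed.

Lemma derive_cutoff_in n b x : S x -> 'D_(evec R b) (trunc n \_ S) x =
  'D_(evec R b) d x * flat_exp (1 + 'X + 'X^2) (arg n x) * U x +
  d x * flat_exp 1 (arg n x) * 'D_(evec R b) U x.
Proof.
move=> Sx; rewrite -derive_trunc; apply: near_eq_derive.
exact: near_restrict.
Qed.

Let prod x : R := d x * U x.

Lemma prod_elementary : elementary prod. Proof. exact: elementaryM. Qed.

Lemma derive_prod b x : 'D_(evec R b) prod x =
  'D_(evec R b) d x * U x + d x * 'D_(evec R b) U x.
Proof.
have sd := elementary_smooth ed; have sU := elementary_smooth eU.
by apply: etrans (smooth_deriveM _ _ sd sU) _; ring.
Qed.

Lemma restrict_L2 f : continuous f -> L2 M (f \_ S).
Proof.
move=> cf; have [B B0 HB] := continuous_compact_bounded cf cC.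
apply: (bounded_L2 (C := B)) => //.
  apply: measurable_funTS; apply: (measurable_restrictT _ _).1; first exact: open_measurable2.
  exact: continuous_measurable2S.
move=> x _; have [Sx|Sx] := pselect (S x).
  by rewrite restrict_in// HB//; exact: SC.
by rewrite restrict_out// normr0 ltW.
Qed.

(** On [S] the truncations and their derivatives are bounded uniformly in [n], and both profiles
    tend to their value 1 at 0; off [S] everything vanishes. Bounded convergence then gives both
    limits. *)
Lemma H10_grad_cutoff : H10_grad M (prod \_ S) (fun b => ('D_(evec R b) prod) \_ S).
Proof.
have ep := prod_elementary.
have Lp : L2 M (prod \_ S) by apply/restrict_L2; apply: smooth_continuous; exact: elementary_smooth.
have Lg b : L2 M (('D_(evec R b) prod) \_ S).
  by apply/restrict_L2; apply: smooth_continuous; apply: elementary_smooth; exact: elementary_derive.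
have cf (f : R * R -> R) : elementary f -> continuous f.
  by move=> ef; apply: smooth_continuous; exact: elementary_smooth.
have mtest f : test_function M f -> measurable_fun (M : set (borel_plane R)) f.
  by move=> [sf _]; apply: continuous_measurable2S; exact: smooth_continuous.
have [B1 B10 HB1] := flat_exp_bounded (1 : {poly R}).
have [B2 B20 HB2] := flat_exp_bounded (1 + 'X + 'X^2 : {poly R}).
have cb p x : S x -> flat_exp p (arg n x) @[n --> \oo] --> p.[0].
  by move=> Sx; apply: cvg_flat_exp; exact: d_gt0.
have p1 : (1 : {poly R}).[0] = 1 by rewrite hornerC.
have p2 : (1 + 'X + 'X^2 : {poly R}).[0] = 1.
  by rewrite !hornerE/= expr0n/= !addr0.
have bd (f : R * R -> R) : elementary f -> exists2 B, 0 < B & forall x, S x -> `|f x| <= B.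
  move=> ef; have [B B0 HB] := continuous_compact_bounded (cf _ ef) cC.
  by exists B => // x /SC; exact: HB.
have [Bp Bp0 HBp] := bd _ ep.
have c1 : nrm2 M (fun x => (trunc n \_ S) x - (prod \_ S) x) @[n --> \oo] --> (0 : R).
  apply: (@bounded_cvg_nrm2 _ M mM fM (fun n x => (trunc n \_ S) x - (prod \_ S) x)
     (Bp * (B1 + 1))).
  - by move=> n; apply: measurable_funB; [apply: mtest; exact: cutoff_test|case: Lp].
  - move=> n x _; have [Sx|Sx] := pselect (S x); last first.
      by rewrite !restrict_out// subrr normr0 mulr_ge0 ?addr_ge0// ltW.
    rewrite !restrict_in// /trunc /prod.
    have -> : d x * flat_exp 1 (arg n x) * U x - d x * U x = prod x * (flat_exp 1 (arg n x) - 1).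
      by rewrite /prod; ring.
    rewrite normrM ler_pM ?HBp//.
    by rewrite (le_trans (ler_normB _ _))// normr1 lerD2r.
  - move=> x _; have [Sx|Sx] := pselect (S x); last first.
      under eq_fun do rewrite !restrict_out// subrr; exact: cvg_cst.
    under eq_fun do rewrite !restrict_in//.
    suff h : trunc n x - prod x @[n --> \oo] --> (0 : R) by exact: h.
    rewrite -[X in _ --> X](subrr (prod x)); apply: cvgB; last exact: cvg_cst.
    have -> : prod x = d x * 1 * U x by rewrite mulr1.
    apply: cvgM; last exact: cvg_cst.
    by apply: cvgM; [exact: cvg_cst|rewrite -[X in _ --> X]p1; exact: cb].
have c2 b : nrm2 M (fun x => 'D_(evec R b) (trunc n \_ S) x -
    ('D_(evec R b) prod \_ S) x) @[n --> \oo] --> (0 : R).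
  have [Bd Bd0 HBd] := bd _ (elementaryM (elementary_derive (evec R b) ed) eU).
  have [BU BU0 HBU] := bd _ (elementaryM ed (elementary_derive (evec R b) eU)).
  have Dout n x : ~ S x -> 'D_(evec R b) (trunc n \_ S) x = 0.
    move=> Sx; have nK : ~ K n x by move/cutoff_sub.
    exact: (derive_zero_off b (compact_closed2 (@cutoff_compact n)) (@cutoff_zero n) nK).
  apply: (@bounded_cvg_nrm2 _ M mM fM (fun n x => 'D_(evec R b) (trunc n \_ S) x -
    ('D_(evec R b) prod \_ S) x) (Bd * (B2 + 1) + BU * (B1 + 1))).
  - move=> n; apply: measurable_funB; last by case: (Lg b).
    by apply: mtest; apply: test_function_derive; exact: cutoff_test.
  - move=> n x _; have [Sx|Sx] := pselect (S x); last first.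
      rewrite Dout// restrict_out// subrr normr0.
      by rewrite addr_ge0// mulr_ge0 ?addr_ge0// ltW.
    rewrite derive_cutoff_in// restrict_in// derive_prod.
    set D1 := 'D_(evec R b) d x; set D2 := 'D_(evec R b) U x.
    have -> : D1 * flat_exp (1 + 'X + 'X^2) (arg n x) * U x + d x * flat_exp 1 (arg n x) * D2 -
       (D1 * U x + d x * D2) = D1 * U x * (flat_exp (1 + 'X + 'X^2) (arg n x) - 1) +
         d x * D2 * (flat_exp 1 (arg n x) - 1) by ring.
    rewrite (le_trans (ler_normD _ _))// lerD// normrM ler_pM ?HBd ?HBU//.
      by rewrite (le_trans (ler_normB _ _))// normr1 lerD2r.
    by rewrite (le_trans (ler_normB _ _))// normr1 lerD2r.
  - move=> x _; have [Sx|Sx] := pselect (S x); last first.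
      under eq_fun do rewrite Dout// restrict_out// subrr; exact: cvg_cst.
    under eq_fun do rewrite derive_cutoff_in// restrict_in//.
    suff h : 'D_(evec R b) d x * flat_exp (1 + 'X + 'X^2) (arg n x) * U x +
      d x * flat_exp 1 (arg n x) * 'D_(evec R b) U x - 'D_(evec R b) prod x
      @[n --> \oo] --> (0 : R) by exact: h.
    rewrite -[X in _ --> X](subrr ('D_(evec R b) prod x)); apply: cvgB; last exact: cvg_cst.
    rewrite derive_prod; apply: cvgD.
      apply: cvgM; last exact: cvg_cst.
      rewrite -[X in _ --> X]mulr1 -p2.
      by apply: cvgM; [exact: cvg_cst|exact: cb].
    apply: cvgM; last exact: cvg_cst.
    rewrite -[X in _ --> X]mulr1 -p1.
    by apply: cvgM; [exact: cvg_cst|exact: cb].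
exact: (seq_H10_grad Lp Lg cutoff_test c1 c2).
Qed.

End cutoff.

(** * The weak eigenvalue equation on one component *)

Section weak_eigenfunction.
Variable R : realType.
Local Notation mu := (@leb2 R).

Lemma laplacian_near (f g : R * R -> R) (x : R * R) :
  (\forall y \near x, f y = g y) -> laplacian f x = laplacian g x.
Proof.
move=> fg; have D b : 'D_(evec R b) ('D_(evec R b) f) x = 'D_(evec R b) ('D_(evec R b) g) x.
  apply: near_eq_derive; move/near_join : fg; apply: filterS => y fgy.
  exact: near_eq_derive.
exact: (congr2 +%R (D true) (D false)).
Qed.

Variables (M S T : set (R * R)).
Hypotheses (oS : open S) (oT : open T) (dST : S `&` T = set0) (MST : M = S `|` T).
Hypothesis fM : (mu M < +oo)%E.

(** The part of the compact support lying in [S] is its intersection with the closed complement of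
    [T], hence compact. This is where disjointness from the other open component matters. *)
Lemma test_function_restrict (psi : R * R -> R) :
  test_function M psi -> test_function M (psi \_ S).
Proof.
move=> [sp [K [cK KM p0]]]; split; last first.
  exists (K `&` ~` T); split.
  - by apply: compact_closedI => //; exact: open_closedC.
  - by move=> x [/KM].
  - move=> x nx; have [Sx|Sx] := pselect (S x); last exact: restrict_out.
    rewrite restrict_in//; apply: p0 => Kx; apply: nx; split => // Tx.
    by have : (S `&` T) x by []; rewrite dST.
apply: smooth_local => x; have [Sx|Sx] := pselect (S x).
  by exists psi => //; exact: near_restrict.
exists (cst 0); first exact: smooth_cst.
have oU : open (T `|` ~` K).
  by apply: openU => //; apply: closed_openC; exact: compact_closed2.
have Ux : (T `|` ~` K) x.
  have [Kx|] := pselect (K x); last by right.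
  by left; have := KM _ Kx; rewrite MST => -[].
have : \forall y \near x, (T `|` ~` K) y by exact: open_nbhs_nbhs.
apply: filterS => y [Ty|nKy].
  apply: restrict_out => Sy; by have : (S `&` T) y by []; rewrite dST.
have [Sy|Sy] := pselect (S y); [by rewrite restrict_in// p0|exact: restrict_out].
Qed.

(** The restriction to [S] is moved from [phi] to the test function. Then [phi] is smooth on the
    whole plane, and the Laplacian can be carried over to it by integration by parts. *)
Lemma weak_eigenfunction (phi : R * R -> R) (lam : R) : smooth phi ->
  (forall x, laplacian phi x = - (lam * phi x)) ->
  forall psi, test_function M psi ->
  L2dot M (phi \_ S) (laplacian psi) = L2dot M (fun x => - (lam * (phi \_ S) x)) psi.
Proof.
move=> sphi eig psi tpsi.
have mM : measurable (M : set (borel_plane R)).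
  by apply: open_measurable2; rewrite MST; exact: openU.
have tchi := test_function_restrict tpsi.
apply: etrans (_ : _ = L2dot M phi (laplacian (psi \_ S))) _.
  apply: eq_Rintegral => x /set_mem Mx.
  have [Sx|Sx] := pselect (S x).
    rewrite (restrict_in phi Sx).
    apply: (congr1 (fun z => phi x * z)); apply: esym; apply: laplacian_near.
    exact: near_restrict.
  have Tx : T x by move: Mx; rewrite MST => -[].
  have E : laplacian (psi \_ S) x = laplacian (cst 0) x.
    apply: laplacian_near; have : \forall y \near x, T y by exact: open_nbhs_nbhs.
    apply: filterS => y Ty; apply: restrict_out => Sy.
    by have : (S `&` T) y by []; rewrite dST.
  have -> : (phi \_ S) x = 0.
    exact: restrict_out.
  rewrite mul0r E.
  have D b : 'D_(evec R b) (cst 0 : R * R -> R) = cst 0.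
    by apply/funext => y; rewrite derive_cst.
  suff -> : laplacian (cst 0) x = 0 by rewrite mulr0.
  have D2 b : 'D_(evec R b) ('D_(evec R b) (cst 0 : R * R -> R)) x = 0.
    by rewrite D derive_cst.
  by apply: etrans (congr2 +%R (D2 true) (D2 false)) _; rewrite addr0.
rewrite (L2dot_laplacianr mM sphi tchi).
apply: eq_Rintegral => x _; rewrite eig.
have [Sx|Sx] := pselect (S x); first by rewrite !restrict_in.
by rewrite !restrict_out// !mulr0 oppr0 mul0r.
Qed.

End weak_eigenfunction.

(** * Linear changes of variables in the plane *)

Section affine_change.
Variable R : realType.
Local Notation mu1 := (@lebesgue_measure R).
Local Notation mu := (@leb2 R).

Lemma measurable_affine (a b : R) :
  measurable_fun (setT : set (measurableTypeR R))
    ((fun x => a * x + b) : measurableTypeR R -> measurableTypeR R).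
Proof. by apply: measurable_funD => //; exact: measurable_funM. Qed.

(** Lebesgue measure is determined by its values on half-open intervals. A negative [a] exchanges
    the open and the closed end, which does not affect the length. *)
Lemma lebesgue_measure_affine (a b : R) (A : set (measurableTypeR R)) :
  a != 0 -> measurable A ->
  (mu1 A = `|a|%:E * mu1 ((fun x : R => (a * x + b)%R) @^-1` A))%E.
Proof.
move=> a0 mA.
pose f : measurableTypeR R -> measurableTypeR R := fun x => a * x + b.
pose F : {mfun measurableTypeR R >-> measurableTypeR R} :=
  HB.pack f (isMeasurableFun.Build _ _ _ _ f (measurable_affine a b)).
have := @lebesgue_measure_unique R (mscale (NngNum (normr_ge0 a)) (pushforward mu1 F)).
apply => // _ [[l r]] _ <-.
suff : (mu1 `]l, r]%classic = `|a|%:E * mu1 (f @^-1` `]l, r]%classic))%E by [].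
have [a_gt0|a_lt0] : 0 < a \/ a < 0 by move: a0; rewrite neq_lt => /orP[]; [right|left].
  have -> : f @^-1` `]l, r]%classic = `](l - b) / a, (r - b) / a]%classic.
    apply/seteqP; split => x; rewrite /f /= !in_itv /= ltr_pdivrMr// ler_pdivlMr//;
    by rewrite ltrBlDr lerBrDr [x * a]mulrC.
  rewrite !lebesgue_measure_itv /= !lte_fin ltr_pM2r ?invr_gt0// ltrD2r.
  case: ifPn => _; last by rewrite mule0.
  rewrite -!EFinD -EFinM; congr EFin; rewrite gtr0_norm//.
  by field; rewrite gt_eqF.
have -> : f @^-1` `]l, r]%classic = `[(r - b) / a, (l - b) / a[%classic.
  apply/seteqP; split => x; rewrite /f /= !in_itv /= ltr_ndivlMr// ler_ndivrMr//;
  by rewrite ltrBlDr lerBrDr [x * a]mulrC andbC.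
rewrite !lebesgue_measure_itv /= !lte_fin ltr_nM2r ?invr_lt0// ltrD2r.
case: ifPn => _; last by rewrite mule0.
rewrite -!EFinD -EFinM; congr EFin; rewrite ltr0_norm//.
by field; rewrite lt_eqF.
Qed.

Lemma ge0_integral_affine (a b : R) (f : R -> \bar R) : a != 0 ->
  measurable_fun (setT : set (measurableTypeR R)) f -> (forall x, (0 <= f x)%E) ->
  (`|a|%:E * \int[mu1]_x f (a * x + b)%R = \int[mu1]_x f x)%E.
Proof.
move=> a0 mf f0.
pose g : measurableTypeR R -> measurableTypeR R := fun x => a * x + b.
pose F : {mfun measurableTypeR R >-> measurableTypeR R} :=
  HB.pack g (isMeasurableFun.Build _ _ _ _ g (measurable_affine a b)).
rewrite -[RHS](@eq_measure_integral _ _ _ _ mu1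
  (mscale (NngNum (normr_ge0 a)) (pushforward mu1 F))); last first.
  by move=> A mA _; rewrite [RHS](lebesgue_measure_affine b a0 mA).
rewrite ge0_integral_mscale//; congr (_ * _)%E.
by rewrite ge0_integral_pushforward//; exact: measurable_affine.
Qed.

Lemma measurable_linear2 (a b p : R) :
  measurable_fun (setT : set (borel_plane R)) (fun z => a * z.1 + b * z.2 + p).
Proof.
by apply: measurable_funD => //; apply: measurable_funD; apply: measurable_funM.
Qed.

(* Tonelli reduces the planar change of variables to the affine one on the line,
   one coordinate at a time. *)
Lemma ge0_integral_linear (a b c d p q : R) (f : R * R -> \bar R) :
  a * d - b * c != 0 ->
  measurable_fun (setT : set (borel_plane R)) f -> (forall x, (0 <= f x)%E) ->
  (`|a * d - b * c|%:E *
    \int[mu]_z f (a * z.1 + b * z.2 + p, c * z.1 + d * z.2 + q)%R =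
   \int[mu]_z f z)%E.
Proof.
move=> det0 mf f0.
have mL (a' b' c' d' p' q' : R) : measurable_fun (setT : set (borel_plane R))
    (fun z => f (a' * z.1 + b' * z.2 + p', c' * z.1 + d' * z.2 + q')).
  apply: (@measurableT_comp _ _ _ (borel_plane R) (borel_plane R) _ f _
    (fun z => (a' * z.1 + b' * z.2 + p', c' * z.1 + d' * z.2 + q'))) => //.
  by apply: measurable_fun_pair; exact: measurable_linear2.
have msec1 (h : R * R -> \bar R) (y : R) : measurable_fun (setT : set (borel_plane R)) h ->
    measurable_fun (setT : set (measurableTypeR R)) (fun x => h (x, y)).
  by move=> mh; exact: (measurable_fun_pair1 y mh).
have msec2 (h : R * R -> \bar R) (x : R) : measurable_fun (setT : set (borel_plane R)) h ->
    measurable_fun (setT : set (measurableTypeR R)) (fun y => h (x, y)).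
  by move=> mh; exact: (measurable_fun_pair2 x mh).
have T1 (h : R * R -> \bar R) : measurable_fun (setT : set (borel_plane R)) h ->
    (forall x, 0 <= h x)%E ->
    (\int[mu]_z h z = \int[mu1]_x \int[mu1]_y h (x, y))%E.
  by move=> mh h0; exact: (@fubini_tonelli1 _ _ _ _ R mu1 mu1 h mh h0).
have T2 (h : R * R -> \bar R) : measurable_fun (setT : set (borel_plane R)) h ->
    (forall x, 0 <= h x)%E ->
    (\int[mu]_z h z = \int[mu1]_y \int[mu1]_x h (x, y))%E.
  by move=> mh h0; exact: (@fubini_tonelli2 _ _ _ _ R mu1 mu1 h mh h0).
rewrite (T2 _ (mL _ _ _ _ _ _))//= [RHS]T1//.
(* If [a = 0], the first coordinate depends on [y] alone, and the inner integral over [x] is a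
   substitution in the second argument. *)
have [a0|a0] := eqVneq a 0.
  have {}det0 : b != 0 /\ c != 0.
    by move: det0; rewrite a0 mul0r sub0r oppr_eq0 mulf_eq0 negb_or => /andP.
  have [b0 c0] := det0.
  have E1 y : (\int[mu1]_x f ((a * x + b * y + p)%R, (c * x + d * y + q)%R) =
     `|c|^-1%:E * \int[mu1]_v f ((b * y + p)%R, v))%E.
    rewrite -(@ge0_integral_affine c (d * y + q) (fun v => f (b * y + p, v)))//; last exact: msec2.
    rewrite muleA -EFinM mulVf ?normr_eq0// mul1e.
    by apply: eq_integral => x _; rewrite a0 mul0r add0r addrA.
  under eq_integral do rewrite E1.
  have mF : measurable_fun (setT : set (measurableTypeR R)) (fun u => \int[mu1]_v f (u, v))%E.
    exact: (@measurable_fun_fubini_tonelli_F _ _ _ _ R mu1 f mf f0).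
  rewrite ge0_integralZl//; last 2 first.
    exact: (measurableT_comp mF (measurable_affine b p)).
    by move=> y _; exact: integral_ge0.
  rewrite muleA -EFinM a0 mul0r sub0r normrN normrM mulfK ?normr_eq0//.
  by rewrite (@ge0_integral_affine b p (fun u => \int[mu1]_v f (u, v))%E)// => u; exact: integral_ge0.
(* Gaussian elimination: with [u = a x + b y + p], the second coordinate becomes [(c / a) u + e y]
   plus a constant, [e] being the Schur complement of [a]. *)
pose e := (a * d - b * c) / a.
have e0 : e != 0 by rewrite /e mulf_neq0// invr_eq0.
pose h (z : R * R) := f (1 * z.1 + 0 * z.2 + 0, (c / a) * z.1 + e * z.2 + (q - c * p / a)).
have mh : measurable_fun (setT : set (borel_plane R)) h by exact: mL.
have h0 z : (0 <= h z)%E by exact: f0.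
have E1 y : (\int[mu1]_x f ((a * x + b * y + p)%R, (c * x + d * y + q)%R) =
     `|a|^-1%:E * \int[mu1]_u h (u, y))%E.
  rewrite -(@ge0_integral_affine a (b * y + p) (fun u => h (u, y)) a0 (msec1 _ _ mh))//.
  rewrite muleA -EFinM mulVf ?normr_eq0// mul1e.
  apply: eq_integral => x _; rewrite /h /=; congr (f (_, _)); first by rewrite mul1r mul0r !addr0 addrA.
  by rewrite /e; field.
under eq_integral do rewrite E1.
have mG : measurable_fun (setT : set (measurableTypeR R)) (fun y => \int[mu1]_u h (u, y))%E.
  exact: (@measurable_fun_fubini_tonelli_G _ _ _ _ R mu1 h mh (fun z => f0 _)).
rewrite ge0_integralZl//; last first.
  by move=> y _; apply: integral_ge0 => u _; exact: f0.
rewrite -T2// T1//.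
have E2 u : (\int[mu1]_y h (u, y) = `|e|^-1%:E * \int[mu1]_v f (u, v))%E.
  rewrite -(@ge0_integral_affine e (c / a * u + (q - c * p / a)) (fun v => f (u, v)) e0 (msec2 _ _ mf))//.
  rewrite muleA -EFinM mulVf ?normr_eq0// mul1e.
  apply: eq_integral => y _; rewrite /h /=; congr (f (_, _)); first by rewrite mul1r mul0r !addr0.
  by ring.
under eq_integral do rewrite E2.
rewrite ge0_integralZl//; last 2 first.
  exact: (@measurable_fun_fubini_tonelli_F _ _ _ _ R mu1 f mf f0).
  by move=> y _; exact: integral_ge0.
rewrite !muleA -!EFinM.
have -> : `|a * d - b * c| / `|a| / `|e| = 1.
  by rewrite -normfV -normrM -/e divff// normr_eq0.
by rewrite mul1e.
Qed.

End affine_change.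

(** * Completeness of the sine systems *)

Section lin_span.
Variables (R : realType) (I : Type) (e : I -> R * R -> R).

Inductive lin_span : (R * R -> R) -> Prop :=
| span0 : lin_span (fun=> 0)
| spanS a i g : lin_span g -> lin_span (fun x => a * e i x + g x).

Lemma span_eq f g : lin_span f -> f = g -> lin_span g.
Proof. by move=> + <-. Qed.

Lemma span_add f g : lin_span f -> lin_span g -> lin_span (fun x => f x + g x).
Proof.
move=> sf sg; elim: sf => [|a i h _ IH].
  by apply: span_eq sg _; apply/funext => x; rewrite add0r.
by apply: span_eq (spanS a i IH) _; apply/funext => x; rewrite addrA.
Qed.

Lemma span_scale (c : R) f : lin_span f -> lin_span (fun x => c * f x).
Proof.
elim=> [|a i h _ IH].
  by apply: span_eq span0 _; apply/funext => x; rewrite mulr0.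
by apply: span_eq (spanS (c * a) i IH) _; apply/funext => x; rewrite mulrDr mulrA.
Qed.

Lemma span_gen i : lin_span (e i).
Proof.
by apply: span_eq (spanS 1 i span0) _; apply/funext => x; rewrite mul1r addr0.
Qed.

End lin_span.

Section L2_approx.
Variable R : realType.
Local Notation mu := (@leb2 R).
Variables (M : set (R * R)) (I : Type) (e : I -> R * R -> R).
Hypothesis mM : measurable (M : set (borel_plane R)).
Hypothesis Le : forall i, L2 M (e i).

Definition L2_approx f := L2 M f /\
  forall eps : R, 0 < eps -> exists2 g, lin_span e g & nrm2 M (fun x => f x - g x) < eps.

Lemma span_L2 g : lin_span e g -> L2 M g.
Proof. by elim=> [|a i h _ Lh]; [exact: L2_0|apply: L2D => //; exact: L2Z]. Qed.

Lemma span_approx g : lin_span e g -> L2_approx g.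
Proof.
move=> sg; split; first exact: span_L2.
move=> eps e0; exists g => //; rewrite /nrm2 /L2dot.
under eq_Rintegral do rewrite subrr mul0r.
by rewrite Rintegral_cst// mul0r.
Qed.

Lemma approx_add f g : L2_approx f -> L2_approx g -> L2_approx (fun x => f x + g x).
Proof.
move=> [Lf Hf] [Lg Hg]; split; first exact: L2D.
move=> eps e0; have e4 : 0 < eps / 4 by rewrite divr_gt0.
have [p sp np] := Hf _ e4; have [q sq nq] := Hg _ e4.
exists (fun x => p x + q x); first exact: span_add.
have Lp := span_L2 sp; have Lq := span_L2 sq.
have := nrm2D_le mM (L2B mM Lf Lp) (L2B mM Lg Lq) => h.
apply: le_lt_trans (_ : nrm2 M (fun x => (f x - p x) + (g x - q x)) < _).
  by rewrite le_eqVlt; apply/orP; left; apply/eqP/L2dot_ext => x _; ring.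
by apply: le_lt_trans h _; lra.
Qed.

Lemma approx_scale (c : R) f : L2_approx f -> L2_approx (fun x => c * f x).
Proof.
move=> [Lf Hf]; split; first exact: L2Z.
move=> eps e0; have c1 : 0 < c ^+ 2 + 1 by rewrite ltr_wpDl ?sqr_ge0.
have e4 : 0 < eps / (c ^+ 2 + 1) by rewrite divr_gt0.
have [p sp] := Hf _ e4; rewrite ltr_pdivlMr// => np.
exists (fun x => c * p x); first exact: span_scale.
have -> : nrm2 M (fun x => c * f x - c * p x) = c ^+ 2 * nrm2 M (fun x => f x - p x).
  rewrite -nrm2Z//; last by apply: L2B => //; exact: span_L2.
  by apply: L2dot_ext => x _; rewrite mulrBr.
apply: le_lt_trans np; rewrite mulrC ler_wpM2l ?nrm2_ge0//; lra.
Qed.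

Lemma approx_ext f g : (forall x, M x -> f x = g x) -> L2_approx f -> L2_approx g.
Proof.
move=> fg [Lf Hf]; split; first exact: L2_ext Lf.
move=> eps e0; have [p sp np] := Hf _ e0; exists p => //.
by apply: le_lt_trans np; rewrite le_eqVlt; apply/orP; left; apply/eqP/L2dot_ext => x Mx; rewrite fg.
Qed.

Lemma approx_sum (J : Type) (r : seq J) (F : J -> R * R -> R) :
  (forall j, L2_approx (F j)) -> L2_approx (fun x => \sum_(j <- r) F j x).
Proof.
move=> aF; elim: r => [|j r IH].
  by apply: approx_ext (span_approx (span0 e)) => x _; rewrite big_nil.
by apply: approx_ext (approx_add (aF j) IH) => x _; rewrite big_cons.
Qed.

Lemma approx_lim (f_ : nat -> R * R -> R) f : L2 M f -> (forall n, L2_approx (f_ n)) ->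
  nrm2 M (fun x => f_ n x - f x) @[n --> \oo] --> (0 : R) -> L2_approx f.
Proof.
move=> Lf af cf; split => // eps e0; have e4 : 0 < eps / 4 by rewrite divr_gt0.
have [N _ HN] : \forall n \near \oo, nrm2 M (fun x => f_ n x - f x) < eps / 4.
  exact: cvgr_lt cf _ e4.
have [Ln Hn] := af N; have [p sp np] := Hn _ e4.
exists p => //; apply: le_lt_trans (nrm2B_le mM Lf Ln (span_L2 sp)) _.
by rewrite [X in 2 * X + _]nrm2BC; have := HN N (leqnn N); lra.
Qed.

End L2_approx.

(** * From indicators of quadrants to all of L^2 *)

Section density.
Variable R : realType.
Local Notation mu := (@leb2 R).
Variables (M : set (R * R)) (I : Type) (e : I -> R * R -> R) (w : R * R -> R).
Hypothesis mM : measurable (M : set (borel_plane R)).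
Hypothesis fM : (mu M < +oo)%E.
Hypothesis Le : forall i, L2 M (e i).
Hypothesis cw : continuous w.
Hypothesis w_gt0 : forall x, M x -> 0 < w x.
Hypothesis w_le1 : forall x, M x -> w x <= 1.

Let mw : measurable_fun (M : set (borel_plane R)) w.
Proof. exact: continuous_measurable2S. Qed.

(** The weight stays attached to the indicator because the system will consist of [w] times
    polynomials in the cosines; since [w] is positive on [M], arbitrary functions are reached by
    dividing by it. *)
Definition approx_set (E : set (R * R)) :=
  measurable (E : set (borel_plane R)) /\ L2_approx M e (fun x => w x * \1_E x).

Lemma w_indic_L2 (E : set (R * R)) : measurable (E : set (borel_plane R)) ->
  L2 M (fun x => w x * \1_E x).
Proof.
move=> mE; apply: (bounded_L2 (C := 1)) => //.
  by apply: measurable_funM => //; exact: measurable_funTS.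
move=> x Mx; rewrite indicE normrM (ger0_norm (ltW (w_gt0 Mx))).
by case: (x \in E); rewrite ?normr1 ?normr0 ?mulr1 ?mulr0//; exact: w_le1.
Qed.

(** Proper differences follow by linearity and increasing unions by bounded convergence. The map [h]
    and the set [H] are parameters so that Dynkin's theorem can be applied to one coordinate at a
    time and then to the plane. *)
Lemma approx_set_lambda (T : Type) (h : R * R -> T) (H : set (R * R)) :
  approx_set H -> lambda_system setT [set A | approx_set (h @^-1` A `&` H)].
Proof.
move=> aH; split => //=.
- by rewrite preimage_setT setTI.
- move=> A B BA [mA aA] [mB aB].
  have E : h @^-1` (A `\` B) `&` H = (h @^-1` A `&` H) `\` (h @^-1` B `&` H).
    apply/seteqP; split => x /=; first by move=> [[? ?] ?]; split => // -[].
    by move=> [[? ?] nb]; split => //; split => // ?; apply: nb.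
  split; first by rewrite E; exact: measurableD.
  have := approx_add mM Le aA (approx_scale mM Le (-1) aB).
  apply: approx_ext => x _; rewrite E !indicE.
  have [xB|xB] := boolP (x \in h @^-1` B `&` H).
    have xA : x \in h @^-1` A `&` H.
      by move: xB; rewrite !inE => -[/BA].
    by rewrite xA memNset ?mulr0 ?mulr1 ?mulN1r ?subrr// => -[_]; apply; move: xB; rewrite inE.
  rewrite !mulr0 addr0; congr (_ * (nat_of_bool _)%:R).
  apply/idP/idP; rewrite !inE => h1; last by case: h1.
  by split => // /mem_set; exact/negP.
- move=> F ndF aF.
  have E : h @^-1` (\bigcup_i F i) `&` H = \bigcup_i (h @^-1` F i `&` H).
    by rewrite preimage_bigcup setI_bigcupl.
  have mE : measurable (h @^-1` (\bigcup_i F i) `&` H : set (borel_plane R)).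
    by rewrite E; apply: bigcupT_measurable => n; have [] := aF n.
  split => //.
  apply: (approx_lim mM Le (w_indic_L2 mE) (fun n => (aF n).2)).
  apply: (@bounded_cvg_nrm2 R M mM fM
    (fun n x => w x * \1_(h @^-1` F n `&` H) x - w x * \1_(h @^-1` (\bigcup_i F i) `&` H) x) 2).
  + move=> n; apply: measurable_funB.
      by have [] := w_indic_L2 (aF n).1.
    by have [] := w_indic_L2 mE.
  + move=> n x Mx; have w0 := ltW (w_gt0 Mx); have w1 := w_le1 Mx.
    rewrite -mulrBr normrM (ger0_norm w0) -[leRHS]mul1r ler_pM//.
    rewrite !indicE (le_trans (ler_normB _ _))//.
    by rewrite -[leRHS](_ : 1 + 1 = 2)// lerD// normr_nat lern1 leq_b1.
  + move=> x Mx.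
    have [[n _ Fn]|nF] := pselect ((\bigcup_i (h @^-1` F i `&` H)) x).
      apply: cvg_near_cst; exists n => // m /= nm.
      rewrite !indicE mem_set ?mem_set ?subrr//; first by rewrite E; exists n.
      by case: Fn => Fn Hx; split => //; have /subsetPset := ndF _ _ nm; exact.
    apply: cvg_near_cst; apply: nearW => n.
    rewrite !indicE memNset ?memNset ?subrr// ?E// => Fn; apply: nF; exists n => //.
Qed.

Local Notation rays := (@RGenOInfty.G R).

Hypothesis approx_rays : forall s t : R,
  approx_set (fst @^-1` `]s, +oo[%classic `&` snd @^-1` `]t, +oo[%classic).
Hypothesis M_pos : M `<=` fst @^-1` `]0, +oo[%classic `&` snd @^-1` `]0, +oo[%classic.

Lemma rays_setI : setI_closed rays.
Proof.
move=> _ _ [x ->] [y ->]; exists (Num.max x y); apply/seteqP; split => z /=;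
  by rewrite !in_itv/= !andbT gt_max => /andP.
Qed.

Lemma rays_generate : (@ocitv R).-sigma.-measurable `<=` <<s rays >>.
Proof. by rewrite RGenOInfty.measurableE. Qed.

Lemma approx_set_ext (E F : set (R * R)) : measurable (F : set (borel_plane R)) ->
  (forall x, M x -> E x <-> F x) -> approx_set E -> approx_set F.
Proof.
move=> mF EF [_ aE]; split => //; apply: approx_ext aE => x Mx.
by rewrite !indicE; congr (_ * (nat_of_bool _)%:R); apply/idP/idP; rewrite !inE => /(EF _ Mx).
Qed.

Lemma mfst (A : set R) : measurable A -> measurable (fst @^-1` A : set (borel_plane R)).
Proof.
move=> mA; have := @measurable_fst _ _ (measurableTypeR R) (measurableTypeR R) measurableT A mA.
by rewrite setTI.
Qed.

Lemma msnd (A : set R) : measurable A -> measurable (snd @^-1` A : set (borel_plane R)).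
Proof.
move=> mA; have := @measurable_snd _ _ (measurableTypeR R) (measurableTypeR R) measurableT A mA.
by rewrite setTI.
Qed.

Lemma approx_set_ray_snd t : approx_set (snd @^-1` `]t, +oo[%classic).
Proof.
apply: approx_set_ext (approx_rays 0 t).
  by apply: msnd; exact: measurable_itv.
by move=> x /M_pos[h1 _]; split => [[]|].
Qed.

(** First of three uses of Dynkin's theorem: rays in the first coordinate, then rays in the second,
    then measurable rectangles. Rays from 0 contain the coordinates of all points of [M], which
    frees the other coordinate. *)
Lemma approx_set_left (A : set R) t : measurable A ->
  approx_set (fst @^-1` A `&` snd @^-1` `]t, +oo[%classic).
Proof.
move=> /rays_generate mA.
move: A mA; apply: (lambda_system_subset rays_setI (approx_set_lambda fst (approx_set_ray_snd t))) => //.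
by move=> _ [x ->] /=; exact: approx_rays.
Qed.

Lemma approx_set_fst (A : set R) : measurable A -> approx_set (fst @^-1` A).
Proof.
move=> mA; apply: approx_set_ext (approx_set_left 0 mA); first exact: mfst.
by move=> x /M_pos[_ h2]; split => [[]|].
Qed.

Lemma approx_set_X (A B : set R) : measurable A -> measurable B ->
  approx_set (snd @^-1` B `&` fst @^-1` A).
Proof.
move=> mA /rays_generate mB.
move: B mB; apply: (lambda_system_subset rays_setI (approx_set_lambda snd (approx_set_fst mA))) => //.
by move=> _ [x ->] /=; rewrite setIC; exact: approx_set_left.
Qed.

Lemma approx_set_measurable (E : set (R * R)) :
  measurable (E : set (borel_plane R)) -> approx_set E.
Proof.
have aT : approx_set setT.
  have := approx_set_fst (@measurableT _ (measurableTypeR R)).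
  by rewrite preimage_setT.
have -> : approx_set E = approx_set (id @^-1` E `&` setT).
  by rewrite setIT.
move: E; rewrite measurable_prod_measurableType.
apply: (lambda_system_subset _ (approx_set_lambda id aT)) => //.
  move=> _ _ [A mA [B mB <-]] [C mC [D mD <-]].
  exists (A `&` C); first exact: measurableI.
  by exists (B `&` D); [exact: measurableI|rewrite setXI].
move=> _ [A mA [B mB <-]] /=; rewrite setIT.
have -> : A `*` B = snd @^-1` B `&` fst @^-1` A.
  by apply/seteqP; split => x /= [].
exact: approx_set_X.
Qed.

Import HBNNSimple.

(** Simple functions increase to [f / w]; multiplied by [w] they stay between 0 and [f], so their
    distance to [f] is dominated by [f]. *)
Lemma approx_L2_ge0 (f : R * R -> R) : L2 M f -> (forall x, 0 <= f x) -> L2_approx M e f.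
Proof.
move=> Lf f0.
have mfw : measurable_fun (M : set (borel_plane R)) (fun x => (f x / w x)%:E).
  apply/measurable_EFinP; apply: measurable_funM; first by case: Lf.
  (* The reciprocal of [w] is written as a real power to obtain its measurability. *)
  apply: (@eq_measurable_fun _ _ _ _ M (fun x => w x `^ (-1))).
    by move=> x /set_mem Mx; rewrite powR_inv1// ltW// w_gt0.
  exact: (measurableT_comp (measurable_powR (-1)) mw).
pose g := nnsfun_approx mM mfw.
have fw0 x : M x -> (0 <= (f x / w x)%:E)%E.
  by move=> Mx; rewrite lee_fin divr_ge0// ltW// w_gt0.
have gle n x : M x -> g n x <= f x / w x.
  by move=> Mx; rewrite -lee_fin /g nnsfun_approxE; exact: le_approx.
have cg x : M x -> g n x @[n --> \oo] --> f x / w x.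
  by move=> Mx; apply: (@fine_cvg R _ _ _ (EFin \o g ^~ x)); exact: (cvg_nnsfun_approx mM mfw fw0 Mx).
have ag n : L2_approx M e (fun x => w x * g n x).
  have gE x : w x * g n x = \sum_(r <- finmap.enum_fset (fset_set (range (g n)))) r * (w x * \1_(g n @^-1` [set r]) x).
    rewrite fimfunE fsbig_finite//= mulr_sumr; apply: eq_bigr => r _; ring.
  apply: approx_ext (fun x _ => esym (gE x)) _.
  apply: approx_sum => // r; apply: approx_scale => //.
  by have [] // := @approx_set_measurable (g n @^-1` [set r]) _.
have Lwg n : L2 M (fun x => w x * g n x) by case: (ag n).
apply: (approx_lim mM Le Lf ag).
apply: (@dominated_cvg_nrm2 R M mM (fun n x => w x * g n x - f x) f) => //.
- by move=> n; apply: measurable_funB; [case: (Lwg n)|case: Lf].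
- move=> n x Mx; have w0 := w_gt0 Mx.
  have : w x * g n x <= f x by rewrite mulrC -ler_pdivlMr// gle.
  have : 0 <= w x * g n x by rewrite mulr_ge0// ltW.
  move=> h1 h2; rewrite ler_norml; apply/andP; split; lra.
- move=> x Mx; have w0 := w_gt0 Mx.
  rewrite -(subrr (f x)); apply: cvgB; last exact: cvg_cst.
  have -> : f x = w x * (f x / w x) by rewrite mulrC divfK// gt_eqF.
  by apply: cvgM; [exact: cvg_cst|exact: cg].
Qed.

(** Positive and negative parts, written as half of [|f| + f] and of [|f| - f]. *)
Lemma approx_L2 (f : R * R -> R) : L2 M f -> L2_approx M e f.
Proof.
move=> Lf; have mf : measurable_fun (M : set (borel_plane R)) f by case: Lf.
have Labs : L2 M (fun x => `|f x|).
  case: Lf => _ fi; split; first exact: measurableT_comp.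
  by under eq_integral do rewrite real_normK ?num_real//.
pose h s x := 2^-1 * (`|f x| + s * f x).
have ah s : (s = 1 \/ s = -1) -> L2_approx M e (h s).
  move=> hs; apply: approx_L2_ge0.
    by apply: L2Z => //; apply: L2D => //; exact: L2Z.
  move=> x; rewrite /h mulr_ge0//; have := ler_norm (f x); have := ler_norm (- f x).
  by rewrite normrN; case: hs => ->; lra.
have := approx_add mM Le (ah 1 (or_introl erefl))
  (approx_scale mM Le (-1) (ah (-1) (or_intror erefl))).
by apply: approx_ext => x _; rewrite /h; field.
Qed.

End density.

(** * Polynomials in the cosine that converge to step functions *)

Section step_polynomials.
Variable R : realType.
Implicit Types (x s q theta : R).

(** With [r] the square root of [q], Bernoulli's inequality bounds [n r ^+ n], and the remaining
    factor [r ^+ n] tends to 0. *)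
Lemma cvg_natr_expr q : 0 < q -> q < 1 -> n%:R * q ^+ n @[n --> \oo] --> (0 : R).
Proof.
move=> q0 q1; pose r := Num.sqrt q.
have r0 : 0 < r by rewrite sqrtr_gt0.
have r1 : r < 1 by rewrite -sqrtr1 ltr_sqrt.
have qE : q = r ^+ 2 by rewrite sqr_sqrtr// ltW.
have h0 : 0 < r^-1 - 1 by rewrite subr_gt0 invf_gt1.
have nr n : n%:R * r ^+ n <= (r^-1 - 1)^-1.
  have bern : 1 + n%:R * (r^-1 - 1) <= (r^-1) ^+ n.
    elim: n => [|n IH]; first by rewrite mul0r addr0 expr0.
    rewrite exprS; apply: le_trans (_ : r^-1 * (1 + n%:R * (r^-1 - 1)) <= _); last first.
      by rewrite ler_wpM2l// ltW// invr_gt0.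
    have : 0 <= n%:R * (r^-1 - 1) ^+ 2 by rewrite mulr_ge0// exprn_ge0// ltW.
    rewrite -natr1; set h := r^-1 - 1; have -> : r^-1 = h + 1 by rewrite subrK.
    by nra.
  rewrite -ler_pdivlMr ?exprn_gt0// -(@ler_pM2r _ (r^-1 - 1))//.
  rewrite mulrAC mulVf ?gt_eqF// mul1r -exprVn.
  by apply: le_trans bern; rewrite lerDr.
have cr : (r^-1 - 1)^-1 * r ^+ n @[n --> \oo] --> (0 : R).
  rewrite -[X in _ --> X](mulr0 (r^-1 - 1)^-1).
  by apply: cvgM; [exact: cvg_cst|apply: cvg_expr; rewrite ger0_norm// ltW].
apply: (@squeeze_cvgr _ _ _ _ (fun=> 0) (fun n => (r^-1 - 1)^-1 * r ^+ n)) cr => //.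
  apply: nearW => n; apply/andP; split; first by rewrite mulr_ge0// exprn_ge0// ltW.
  by rewrite qE -exprM mulnC exprM expr2 mulrA ler_wpM2r// exprn_ge0// ltW.
exact: cvg_cst.
Qed.

Lemma bernoulli_ge y n : 0 <= y <= 1 -> 1 - n%:R * y <= (1 - y) ^+ n :> R.
Proof.
move=> /andP[y0 y1]; elim: n => [|n IH]; first by rewrite mul0r subr0 expr0.
rewrite exprS; apply: le_trans (_ : (1 - y) * (1 - n%:R * y) <= _); last first.
  by rewrite ler_wpM2l// subr_ge0.
have : 0 <= n%:R * y ^+ 2 by rewrite mulr_ge0// exprn_ge0.
by rewrite -natr1; nra.
Qed.

(** From [1 + n y <= (1 + y) ^+ n] and [((1 + y) (1 - y)) ^+ n <= 1]. *)
Lemma bernoulli_le y n : 0 <= y <= 1 -> (1 - y) ^+ n * (n%:R * y) <= 1 :> R.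
Proof.
move=> /andP[y0 y1].
have h : (1 + y) ^+ n * (1 - y) ^+ n <= 1.
  rewrite -exprMn exprn_ile1//; [nra|nra].
have b : 1 + n%:R * y <= (1 + y) ^+ n.
  elim: n {h} => [|n IH]; first by rewrite mul0r addr0 expr0.
  rewrite exprS; apply: le_trans (_ : (1 + y) * (1 + n%:R * y) <= _); last first.
    by rewrite ler_wpM2l// addr_ge0.
  have : 0 <= n%:R * y ^+ 2 by rewrite mulr_ge0// exprn_ge0.
  by rewrite -natr1; nra.
apply: le_trans h; rewrite mulrC ler_wpM2r ?exprn_ge0 ?subr_ge0//.
by apply: le_trans b; rewrite lerDr.
Qed.

(* With [m] close to [n / theta^n], [(1 - u^n)^m] tends to 1 or to 0
   according to whether [u < theta] or not. *)
Let expo theta n : nat := (Num.truncn (n%:R * theta ^- n)).+1.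
Let step theta n (u : R) := (1 - u ^+ n) ^+ (expo theta n).

Lemma step_bounds theta n (u : R) : 0 <= u <= 1 -> 0 <= step theta n u <= 1.
Proof.
move=> /andP[u0 u1]; rewrite /step.
have h : 0 <= 1 - u ^+ n by rewrite subr_ge0 exprn_ile1.
by rewrite exprn_ge0//= exprn_ile1// lerBlDr lerDl exprn_ge0.
Qed.

(** For [u < theta] the exponent times [u ^+ n] is at most [n (u / theta) ^+ n + u ^+ n], which
    tends to 0, and Bernoulli's inequality keeps the step close to 1. *)
Lemma cvg_step theta (u : R) : 0 < theta < 1 -> 0 < u < 1 ->
  step theta n u @[n --> \oo] --> ((u < theta)%R%:R : R).
Proof.
move=> /andP[t0 t1] /andP[u0 u1].
have un n : 0 <= u ^+ n <= 1 by rewrite exprn_ge0 ?exprn_ile1// ltW.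
have [ut|tu] := ltP u theta.
  have q0 : 0 < u / theta by rewrite divr_gt0.
  have q1 : u / theta < 1 by rewrite ltr_pdivrMr// mul1r.
  have c1 := cvg_natr_expr q0 q1.
  have c2 : u ^+ n @[n --> \oo] --> (0 : R) by apply: cvg_expr; rewrite ger0_norm// ltW.
  have c3 : 1 - (n%:R * (u / theta) ^+ n + u ^+ n) @[n --> \oo] --> (1 : R).
    rewrite -[X in _ --> X](subr0 1); apply: cvgB; first exact: cvg_cst.
    by rewrite -[X in _ --> X](addr0 0); exact: cvgD.
  apply: (@squeeze_cvgr _ _ _ _ _ (fun=> 1)) c3 _; last exact: cvg_cst.
  apply: nearW => n; have /andP[_ ->] := @step_bounds theta n u (ltac:(by rewrite !ltW)).
  rewrite andbT /step; apply: le_trans (bernoulli_ge _ (un n)).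
  rewrite lerD2l lerN2.
  have -> : n%:R * (u / theta) ^+ n + u ^+ n = (n%:R * theta ^- n + 1) * u ^+ n.
    by rewrite expr_div_n; ring.
  have /andP[un0 _] := un n; rewrite ler_wpM2r//.
  rewrite /expo -natr1 lerD2r truncn_le.
  by rewrite mulr_ge0// invr_ge0 exprn_ge0// ltW.
(* For [theta <= u] the exponent times [u ^+ n] is at least [n], so the step is at most [n^-1]; this
   includes the case [u = theta]. *)
have c : (n%:R^-1 : R) @[n --> \oo] --> (0 : R).
  apply/gtr0_cvgV0; last exact: cvgr_idn.
  by exists 1%N => // n /= n1; rewrite ltr0n.
apply: (@squeeze_cvgr _ _ _ _ (fun=> 0) (fun n => n%:R^-1)) c => //; last exact: cvg_cst.
exists 1%N => // n /= n1.
have /andP[-> _] := @step_bounds theta n u (ltac:(by rewrite !ltW)).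
rewrite /=; have n0 : (0 : R) < n%:R by rewrite ltr0n.
rewrite -[leRHS]mul1r ler_pdivlMr//; apply: le_trans (bernoulli_le (expo theta n) (un n)).
rewrite /step ler_wpM2l//.
  by have /andP[_ h] := un n; rewrite exprn_ge0// subr_ge0.
have h1 : n%:R * theta ^- n <= (expo theta n)%:R :> R by rewrite ltW// truncnS_gt.
apply: le_trans (_ : n%:R * theta ^- n * u ^+ n <= _); last first.
  by rewrite ler_wpM2r//; have /andP[] := un n.
rewrite -mulrA ler_peMr// mulrC ler_pdivlMr ?exprn_gt0// mul1r.
by rewrite ler_pXn2r ?nnegrE// ltW.
Qed.

(** The function [(1 + cos x) / 2] decreases from 1 to 0 on the interval, so the ray [s < x] becomes
    [u x < u s]. For [s] outside the open interval a constant polynomial serves. *)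
Lemma ray_poly s : exists p : nat -> {poly R}, forall x, 0 < x < pi ->
  (forall n, 0 <= (p n).[cos x] <= 1) /\
  (p n).[cos x] @[n --> \oo] --> ((s < x)%R%:R : R).
Proof.
have [s0|s0] := leP s 0.
  exists (fun=> 1) => x /andP[x0 xpi]; split => [n|]; first by rewrite hornerC ler01 lexx.
  under eq_fun do rewrite hornerC.
  by rewrite (le_lt_trans s0 x0); exact: cvg_cst.
have [sp|sp] := leP pi s.
  exists (fun=> 0) => x /andP[x0 xpi]; split => [n|]; first by rewrite horner0 lexx ler01.
  under eq_fun do rewrite horner0.
  by rewrite ltNge (ltW (lt_le_trans xpi sp)); exact: cvg_cst.
pose u x := (1 + cos x) / 2.
pose theta := u s.
have cos_lt x : 0 < x < pi -> -1 < cos x < 1.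
  move=> /andP[x0 xp]; have h1 : cos pi < cos x.
    by rewrite ltr_cos ?in_itv/= ?lexx ?pi_ge0 ?(ltW x0) ?(ltW xp).
  have h2 : cos x < cos 0.
    by rewrite ltr_cos ?in_itv/= ?lexx ?pi_ge0 ?(ltW x0) ?(ltW xp).
  by move: h1 h2; rewrite cospi cos0 => -> ->.
have u_lt x : 0 < x < pi -> 0 < u x < 1.
  by move=> /cos_lt /andP[c1 c2]; rewrite /u; apply/andP; split; lra.
exists (fun n => (1 - (2^-1%:P * (1 + 'X)) ^+ n) ^+ (expo theta n)) => x x0p.
have E n : ((1 - (2^-1%:P * (1 + 'X)) ^+ n) ^+ (expo theta n)).[cos x] = step theta n (u x).
  by rewrite /step /u !(horner_exp, hornerD, hornerN, hornerM, hornerC, hornerX) [_ / 2]mulrC.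
have ux := u_lt _ x0p.
split => [n|].
  by rewrite E; apply: step_bounds; case/andP: ux => /ltW -> /ltW ->.
have -> : (s < x) = (u x < theta).
  have xI : x \in `[0, pi] by rewrite in_itv/=; case/andP: x0p => /ltW -> /ltW ->.
  have sI : s \in `[0, pi] by rewrite in_itv/= !ltW.
  by rewrite /theta /u ltr_pM2r ?invr_gt0// ltrD2l ltr_cos.
under eq_fun do rewrite E.
by apply: cvg_step => //; apply: u_lt; rewrite s0 sp.
Qed.

End step_polynomials.

(** * Transport of L^2 under linear maps *)

Section linear_change_L2.
Variable R : realType.
Local Notation mu := (@leb2 R).
Implicit Types f g : R * R -> R.
Variables a b c d p q : R.
Hypothesis det0 : a * d - b * c != 0.
Let L (z : R * R) : R * R := (a * z.1 + b * z.2 + p, c * z.1 + d * z.2 + q).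
Variables S S0 : set (R * R).
Hypothesis mS : measurable (S : set (borel_plane R)).
Hypothesis SL : forall z, S (L z) <-> S0 z.

Lemma measurable_linear_map :
  measurable_fun (setT : set (borel_plane R)) (L : borel_plane R -> borel_plane R).
Proof. by apply: measurable_fun_pair; exact: measurable_linear2. Qed.

Let preS : S0 = L @^-1` S.
Proof. by apply/seteqP; split => z /SL. Qed.

Lemma measurable_linear_preimage : measurable (S0 : set (borel_plane R)).
Proof. by rewrite preS -[X in measurable X]setTI; exact: measurable_linear_map. Qed.

Lemma measurable_fun_linear f : measurable_fun (S : set (borel_plane R)) f ->
  measurable_fun (S0 : set (borel_plane R)) (fun z => f (L z)).
Proof.
move=> mf; apply: (@measurable_comp _ _ _ _ _ _ (S : set (borel_plane R)) f S0 (L : borel_plane R -> borel_plane R)) => //.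
  by move=> _ [z /SL Sz <-].
by apply: measurable_funTS; exact: measurable_linear_map.
Qed.

Lemma integral_sq_linear f : measurable_fun (S : set (borel_plane R)) f ->
  (\int[mu]_(x in S) ((f x) ^+ 2)%:E =
   `|a * d - b * c|%:E * \int[mu]_(z in S0) ((f (L z)) ^+ 2)%:E)%E.
Proof.
move=> mf; rewrite integral_mkcond [in RHS]integral_mkcond.
rewrite -(ge0_integral_linear p q det0); last 2 first.
- apply: (measurable_restrictT _ mS).1; apply/measurable_EFinP; exact: measurable_funX.
- by move=> x; rewrite patchE; case: ifPn => // _; rewrite lee_fin sqr_ge0.
congr (_ * _)%E; apply: eq_integral => z _.
rewrite !patchE; congr (if _ then _ else _); apply/idP/idP; rewrite !inE => /SL; exact.
Qed.

Lemma L2_linear f : L2 S f -> L2 S0 (fun z => f (L z)).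
Proof.
move=> [mf f2]; split; first exact: measurable_fun_linear.
rewrite integral_sq_linear// in f2.
have d0 : 0 < `|a * d - b * c| by rewrite normr_gt0.
rewrite ltNge leye_eq; apply/eqP => E; move: f2; rewrite E gt0_muley ?lte_fin// ltxx.
Qed.

Lemma nrm2_linear f : L2 S f ->
  nrm2 S f = `|a * d - b * c| * nrm2 S0 (fun z => f (L z)).
Proof.
move=> Lf; have LfL := L2_linear Lf; have mS0 := measurable_linear_preimage.
apply: EFin_inj; rewrite EFinM.
have E M (h : R * R -> R) : measurable (M : set (borel_plane R)) -> L2 M h ->
    (nrm2 M h)%:E = (\int[mu]_(x in M) ((h x) ^+ 2)%:E)%E.
  move=> mM Lh; rewrite /nrm2 /L2dot /Rintegral fineK.
    by apply: eq_integral => x _; rewrite expr2.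
  by apply: integrable_fin_num => //; exact: L2_integrable_mul.
by rewrite !E// integral_sq_linear//; case: Lf.
Qed.

(** Polarization of the identity for norms, which itself involves nonnegative integrands only. *)
Lemma L2dot_linear f g : L2 S f -> L2 S g ->
  L2dot S f g = `|a * d - b * c| * L2dot S0 (fun z => f (L z)) (fun z => g (L z)).
Proof.
move=> Lf Lg; have mS0 := measurable_linear_preimage.
have h := nrm2D mS Lf Lg; have h0 := nrm2D mS0 (L2_linear Lf) (L2_linear Lg).
rewrite !nrm2_linear// in h; last exact: L2D.
have := h; rewrite h0; lra.
Qed.

End linear_change_L2.

(** * Density of the double sines in the square *)

Section sine_system.
Variable R : realType.
Local Notation mu := (@leb2 R).
Local Notation mu1 := (@lebesgue_measure R).

Definition Qpi : set (R * R) := box 0 pi 0 pi.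

Definition esin (i : nat * nat) (z : R * R) : R :=
  sin (i.1.+1%:R * z.1) * sin (i.2.+1%:R * z.2).

Lemma esin_elementary i : elementary (esin i).
Proof.
apply: elementaryM.
  apply: (elementary_comp (@smooth1_sin R)); apply: elementaryM; [exact: elementary_cst|exact: elementary_fst].
apply: (elementary_comp (@smooth1_sin R)); apply: elementaryM; [exact: elementary_cst|exact: elementary_snd].
Qed.

Lemma elementary_continuous (f : R * R -> R) : elementary f -> continuous f.
Proof. by move=> ef; apply: smooth_continuous; exact: elementary_smooth. Qed.

Lemma cos_mul_sin (m : nat) (x : R) : cos x * sin (m.+1%:R * x) =
  2^-1 * (sin (m.+2%:R * x) + sin (m%:R * x)).
Proof.
have -> : m.+2%:R * x = m.+1%:R * x + x by rewrite -[m.+2%:R]natr1; ring.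
have -> : m%:R * x = m.+1%:R * x - x by rewrite -[m.+1%:R]natr1; ring.
by rewrite sinD sinB; field.
Qed.

(** The product formula shifts the frequency up and down by 1, so the span is a module over the
    polynomials in [cos]. *)
Lemma span_cos_fst g : lin_span esin g -> lin_span esin (fun z => cos z.1 * g z).
Proof.
elim=> [|a [m n] h _ IH].
  by apply: span_eq (span0 esin) _; apply/funext => z; rewrite mulr0.
have s1 := span_scale (a / 2) (span_gen esin (m.+1, n)).
(* At the lowest frequency the downward shift produces [sin 0], so only one term remains. *)
case: m => [|m] in s1 *.
  apply: span_eq (span_add s1 IH) _; apply/funext => z.
  have := cos_mul_sin 0 z.1; rewrite mul0r sin0 addr0 => E.
  by rewrite mulrDr /esin /= [cos _ * (_ * _)]mulrCA [cos _ * (_ * _)]mulrA E; ring.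
have s2 := span_scale (a / 2) (span_gen esin (m, n)).
apply: span_eq (span_add (span_add s1 s2) IH) _; apply/funext => z.
have := cos_mul_sin m.+1 z.1 => E.
by rewrite mulrDr /esin /= [cos _ * (_ * _)]mulrCA [cos _ * (_ * _)]mulrA E; ring.
Qed.

Lemma span_cos_snd g : lin_span esin g -> lin_span esin (fun z => cos z.2 * g z).
Proof.
elim=> [|a [m n] h _ IH].
  by apply: span_eq (span0 esin) _; apply/funext => z; rewrite mulr0.
have s1 := span_scale (a / 2) (span_gen esin (m, n.+1)).
case: n => [|n] in s1 *.
  apply: span_eq (span_add s1 IH) _; apply/funext => z.
  have := cos_mul_sin 0 z.2; rewrite mul0r sin0 addr0 => E.
  rewrite mulrDr /esin /= [cos _ * (_ * _)]mulrCA [cos _ * (_ * _)]mulrCA E; ring.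
have s2 := span_scale (a / 2) (span_gen esin (m, n)).
apply: span_eq (span_add (span_add s1 s2) IH) _; apply/funext => z.
have := cos_mul_sin n.+1 z.2 => E.
by rewrite mulrDr /esin /= [cos _ * (_ * _)]mulrCA [cos _ * (_ * _)]mulrCA E; ring.
Qed.

Lemma span_horner (k : R * R -> R) : (forall g, lin_span esin g -> lin_span esin (fun z => k z * g z)) ->
  forall (p : {poly R}) g, lin_span esin g -> lin_span esin (fun z => p.[k z] * g z).
Proof.
move=> kg p; elim/poly_ind: p => [|p c IH] g sg.
  by apply: span_eq (span0 esin) _; apply/funext => z; rewrite horner0 mul0r.
apply: span_eq (span_add (IH _ (kg _ sg)) (span_scale c sg)) _.
by apply/funext => z; rewrite hornerMXaddC; ring.
Qed.

Lemma Qpi_measurable : measurable (Qpi : set (borel_plane R)).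
Proof. exact: measurable_box. Qed.

Lemma Qpi_fin : (mu Qpi < +oo)%E.
Proof. exact: leb2_box_lty. Qed.

Lemma esin_L2 M i : measurable (M : set (borel_plane R)) -> (mu M < +oo)%E -> L2 M (esin i).
Proof.
move=> mM fM; apply: (bounded_L2 (C := 1)) => //.
  by apply: continuous_measurable2S; apply: elementary_continuous; exact: esin_elementary.
by move=> x _; rewrite /esin normrM -[leRHS]mul1r ler_pM// ?sin_max.
Qed.

(** The weight is the lowest double sine. Multiplied by the step polynomials in both cosines it
    stays in the span, is bounded by 1 and converges pointwise to the weighted indicator of a
    quadrant. *)
Lemma sine_dense f : L2 Qpi f -> L2_approx Qpi esin f.
Proof.
have Le i := esin_L2 i Qpi_measurable Qpi_fin.
have wE : esin (0, 0)%N = (fun z => sin z.1 * sin z.2).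
  by apply/funext => z; rewrite /esin /= !mul1r.
have inQ x : Qpi x -> (0 < x.1 < pi) /\ (0 < x.2 < pi).
  by move=> [/=]; rewrite !in_itv.
have w0 x : Qpi x -> 0 < esin (0, 0)%N x.
  by move=> /inQ[h1 h2]; rewrite wE mulr_gt0// sin_gt0_pi.
have w1 x : Qpi x -> esin (0, 0)%N x <= 1.
  by move=> _; rewrite wE (le_trans (ler_norm _))// normrM -[leRHS]mul1r ler_pM// sin_max.
have cw : continuous (esin (0, 0)%N) by apply: elementary_continuous; exact: esin_elementary.
apply: (approx_L2 Qpi_measurable Qpi_fin Le cw w0 w1); last first.
  by move=> x /inQ[/andP[h1 _] /andP[h2 _]]; split; rewrite /= in_itv/= andbT.
move=> s t; split.
  have mr (u : R) : measurable (`]u, +oo[%classic : set (measurableTypeR R)).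
    exact: measurable_itv.
  by apply: measurableI; [exact: mfst (mr s)|exact: msnd (mr t)].
have [p Hp] := ray_poly s; have [q Hq] := ray_poly t.
pose F n z := (p n).[cos z.1] * ((q n).[cos z.2] * esin (0, 0)%N z).
have sF n : lin_span esin (F n).
  apply: span_horner; first exact: span_cos_fst.
  by apply: span_horner; [exact: span_cos_snd|exact: span_gen].
set E := _ `&` _.
have mE : measurable (E : set (borel_plane R)).
  have mr (u : R) : measurable (`]u, +oo[%classic : set (measurableTypeR R)).
    exact: measurable_itv.
  by apply: measurableI; [exact: mfst (mr s)|exact: msnd (mr t)].
have LE := w_indic_L2 Qpi_measurable Qpi_fin cw w0 w1 mE.
have LF n := span_L2 Qpi_measurable Le (sF n).
apply: (approx_lim Qpi_measurable Le LE (fun n => span_approx Qpi_measurable Le (sF n))).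
apply: (@bounded_cvg_nrm2 R Qpi Qpi_measurable Qpi_fin
    (fun n z => F n z - esin (0, 0)%N z * \1_E z) 2).
- by move=> n; apply: measurable_funB; [case: (LF n)|case: LE].
- move=> n z Qz; have [h1 h2] := inQ _ Qz.
  have [/(_ n) /andP[p0 p1] _] := Hp _ h1; have [/(_ n) /andP[q0 q1] _] := Hq _ h2.
  have e0 := ltW (w0 _ Qz); have e1 := w1 _ Qz.
  have b1 : `|F n z| <= 1.
    rewrite /F ger0_norm; last by apply: mulr_ge0 => //; apply: mulr_ge0.
    by apply: mulr_ile1 => //; [apply: mulr_ge0|apply: mulr_ile1].
  have b2 : `|esin (0, 0)%N z * \1_E z| <= 1.
    have i1 : \1_E z <= 1 :> R by rewrite indicE lern1 leq_b1.
    have i0 : 0 <= \1_E z :> R by rewrite indicE ler0n.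
    rewrite ger0_norm; last exact: mulr_ge0.
    exact: mulr_ile1.
  rewrite (le_trans (ler_normB _ _))//; lra.
- move=> z Qz; have [h1 h2] := inQ _ Qz.
  have [_ cp] := Hp _ h1; have [_ cq] := Hq _ h2.
  rewrite -(subrr (esin (0, 0)%N z * \1_E z)); apply: cvgB; last exact: cvg_cst.
  have -> : esin (0, 0)%N z * \1_E z = (s < z.1)%R%:R * ((t < z.2)%R%:R * esin (0, 0)%N z).
    rewrite mulrA -natrM mulnb mulrC; congr (_%:R * _); congr nat_of_bool.
    apply/idP/idP; rewrite !inE /E /= !in_itv/= !andbT; first by move=> [-> ->].
    by move=> /andP[].
  by apply: cvgM => //; apply: cvgM => //; exact: cvg_cst.
Qed.

End sine_system.

(** * Integrals of sines over an interval and a square *)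

Section line_integrals.
Variable R : realType.
Local Notation mu := (@leb2 R).
Local Notation mu1 := (@lebesgue_measure R).

Lemma sin_natr_pi n : sin (n%:R * pi) = 0 :> R.
Proof.
elim: n => [|n IH]; first by rewrite mul0r sin0.
by rewrite -natr1 mulrDl mul1r sinD IH mul0r sinpi mulr0 addr0.
Qed.

Lemma continuous_itv_integrable (a b : R) (f : R -> R) : continuous f ->
  mu1.-integrable `]a, b[ (EFin \o f).
Proof.
move=> cf; apply: (@integrableS _ _ _ mu1 `[a, b]) => //.
  exact: subset_itv_oo_cc.
apply: continuous_compact_integrable; first exact: segment_compact.
exact: continuous_subspaceT.
Qed.

Lemma Rintegral_FTC (a b : R) (F f : R -> R) : a < b ->
  (forall x : R, is_derive x (1 : R) F (f x)) -> continuous f ->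
  \int[mu1]_(x in `]a, b[) f x = F b - F a.
Proof.
move=> ab dF cf.
have icc : mu1.-integrable `[a, b] (EFin \o f).
  apply: continuous_compact_integrable; first exact: segment_compact.
  exact: continuous_subspaceT.
have ioc : mu1.-integrable `]a, b] (EFin \o f).
  apply: (integrableS _ _ _ icc) => //.
  by apply: subset_itvr; rewrite bnd_simp.
have ioo := continuous_itv_integrable a b cf.
rewrite (Rintegral_itv_bndo_bndc ioo) (Rintegral_itv_obnd_cbnd ioc).
have dFx x : derivable F x 1 by have [] := dF x.
have cF : continuous F by move=> x; apply: differentiable_continuous; exact/derivable1_diffP.
rewrite /Rintegral (@continuous_FTC2 _ f F)//.
- exact: continuous_subspaceT.
- by split; [move=> x _|apply: cvg_at_right_filter; exact: cF|apply: cvg_at_left_filter; exact: cF].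
- by move=> x _; rewrite derive1E; have [_ ->] := dF x.
Qed.

Lemma is_derive_sin_scale (m : R) (x : R) :
  is_derive x (1 : R) (fun x => sin (m * x)) (m * cos (m * x)).
Proof.
have h : is_derive x (1 : R) (fun x => m * x) m.
  by apply: is_derive_eq; rewrite /GRing.scale/= mulr1.
have := is_derive_comp1 h (is_derive_sin (m * x)); rewrite mulrC; apply.
Qed.

Lemma is_derive_cos_scale (m : R) (x : R) :
  is_derive x (1 : R) (fun x => cos (m * x)) (- (m * sin (m * x))).
Proof.
have h : is_derive x (1 : R) (fun x => m * x) m.
  by apply: is_derive_eq; rewrite /GRing.scale/= mulr1.
have := is_derive_comp1 h (is_derive_cos (m * x)); rewrite mulrC mulrN; apply.
Qed.

Lemma continuous_sin_scale (m : R) : continuous (fun x : R => sin (m * x)).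
Proof.
move=> x; apply: differentiable_continuous; apply/derivable1_diffP.
by have [] := is_derive_sin_scale m x.
Qed.

Lemma integral_sin_sin (m n : nat) :
  \int[mu1]_(x in `]0, pi[) (sin (m.+1%:R * x) * sin (n.+1%:R * x)) =
  (m == n)%:R * (pi / 2) :> R.
Proof.
pose p : R := m.+1%:R; pose q : R := n.+1%:R.
have cf : continuous (fun x : R => sin (p * x) * sin (q * x)).
  by move=> x; apply: cvgM; exact: continuous_sin_scale.
have p0 : p != 0 by rewrite /p pnatr_eq0.
have [mn|mn] := eqVneq m n.
  have pq : q = p by rewrite /q -mn.
  have dF x : is_derive x (1 : R)
      (fun x => x * 2^-1 - (2 * p)^-1 * (sin (p * x) * cos (p * x)))
      (sin (m.+1%:R * x) * sin (n.+1%:R * x)).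
    have ds := is_derive_sin_scale p x; have dc := is_derive_cos_scale p x.
    have -> : sin (m.+1%:R * x) * sin (n.+1%:R * x) = sin (p * x) ^+ 2 by rewrite -mn expr2.
    apply: is_derive_eq; rewrite /GRing.scale/=.
    have -> : sin (p * x) ^+ 2 = 2^-1 * (1 - cos (p * x) ^+ 2 + sin (p * x) ^+ 2).
      by rewrite -[X in X - _](cos2Dsin2 (p * x)); field.
    by field.
  rewrite (Rintegral_FTC (@pi_gt0 R) dF cf).
  by rewrite !sin_natr_pi mulr0 sin0 !mul0r !mulr0 !subr0 mul1r.
have mn0 : p ^+ 2 - q ^+ 2 != 0.
  rewrite subr_eq0 eqrXn2 ?ler0n// /p /q eqr_nat eqSS//.
have dF x : is_derive x (1 : R)
  (fun x => (p ^+ 2 - q ^+ 2)^-1 * (q * (sin (p * x) * cos (q * x)) -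
     p * (cos (p * x) * sin (q * x)))) (sin (p * x) * sin (q * x)).
  have ds := is_derive_sin_scale p x; have dc := is_derive_cos_scale p x.
  have ds' := is_derive_sin_scale q x; have dc' := is_derive_cos_scale q x.
  apply: is_derive_eq; rewrite /GRing.scale/=; field.
  by move: mn0; rewrite /p /q -!natr1 ![_ + 1]addrC.
rewrite (Rintegral_FTC (@pi_gt0 R) dF cf).
have sp : sin (p * pi) = 0 by exact: sin_natr_pi.
have sq : sin (q * pi) = 0 by exact: sin_natr_pi.
by rewrite sp sq !(mul0r, mulr0, sin0, subr0, subrr).
Qed.

Lemma Rintegral_box_prod (F G : R -> R) : continuous F -> continuous G ->
  \int[mu]_(z in @Qpi R) (F z.1 * G z.2) =
  (\int[mu1]_(x in `]0, pi[) F x) * (\int[mu1]_(y in `]0, pi[) G y).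
Proof.
move=> cF cG; pose I := `]0, pi[%classic : set R.
pose f := (fun z : R * R => F z.1 * G z.2) \_ (@Qpi R).
have cf : continuous (fun z : R * R => F z.1 * G z.2).
  move=> z; apply: cvgM.
    by apply: (@continuous_comp _ _ _ fst F); [exact: cvg_fst|exact: cF].
  by apply: (@continuous_comp _ _ _ snd G); [exact: cvg_snd|exact: cG].
have mQ := @Qpi_measurable R.
have iQ : mu.-integrable (@Qpi R) (EFin \o (fun z : R * R => F z.1 * G z.2)).
  apply: measurable_bounded_integrable => //; [exact: Qpi_fin|exact: continuous_measurable2S|].
  have cK : compact (`[0, pi] `*` `[0, pi] : set (R * R)).
    by apply: compact_setX; exact: segment_compact.
  have [C C0 HC] := continuous_compact_bounded cf cK.
  exists C; split; first exact: num_real.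
  move=> y Cy z [z1 z2]; apply: le_trans (ltW Cy); apply: HC.
  by split; apply: subset_itv_oo_cc.
have iF : mu.-integrable setT (EFin \o f).
  by move/(integrable_mkcond _ mQ) : iQ; rewrite -restrict_EFin.
have iFI := continuous_itv_integrable 0 pi cF.
have iGI := continuous_itv_integrable 0 pi cG.
rewrite Rintegral_mkcond {1}/Rintegral.
have -> : (\int[mu]_z (f z)%:E = \int[mu1]_x \int[mu1]_y (f (x, y))%:E)%E.
  by rewrite -(integral12_prod_meas1 iF).
have E1 x : (\int[mu1]_y (f (x, y))%:E =
    ((fun x => F x * \int[mu1]_(y in I) G y) \_ I x)%:E)%E.
  rewrite patchE; case: ifPn => [/set_mem xI|xI].
    transitivity (\int[mu1]_(y in I) (F x * G y)%:E)%E.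
      rewrite [RHS]integral_mkcond; apply: eq_integral => y _.
      rewrite /f !patchE; case: ifPn => [|].
        by rewrite inE => -[_ /= yI]; rewrite mem_set.
      move=> nQ; rewrite memNset// => yI; move/negP : nQ; apply.
      by rewrite inE.
    under eq_integral do rewrite EFinM.
    rewrite integralZl//; last exact: measurable_itv.
    rewrite EFinM /Rintegral fineK//.
    by apply: integrable_fin_num; [exact: measurable_itv|exact: iGI].
  rewrite integral0_eq// => y _; rewrite /f patchE ifF//.
  by apply/negP; rewrite inE => -[/= xI' _]; move/negP: xI; apply; rewrite inE.
under eq_integral do rewrite E1.
rewrite -[LHS]/(\int[mu1]_x ((fun x => F x * \int[mu1]_(y in I) G y) \_ I) x).
rewrite -Rintegral_mkcond; apply: RintegralZr; [exact: measurable_itv|exact: iFI].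
Qed.

End line_integrals.

(** * The triangle as half of the square *)

Section triangle.
Variable R : realType.
Local Notation mu := (@leb2 R).
Local Notation mu1 := (@lebesgue_measure R).

Lemma esin_ortho (i j : nat * nat) :
  L2dot (@Qpi R) (@esin R i) (@esin R j) = (i == j)%:R * (pi / 2) ^+ 2.
Proof.
case: i => [m n]; case: j => [k l].
have css p q : continuous (fun x : R => sin (p * x) * sin (q * x)).
  by move=> x; apply: cvgM; exact: continuous_sin_scale.
apply: etrans (etrans _ (Rintegral_box_prod (css m.+1%:R k.+1%:R) (css n.+1%:R l.+1%:R))) _.
  by apply: eq_Rintegral => z _; rewrite /esin /=; ring.
rewrite !integral_sin_sin xpair_eqE.
by case: eqP => _; case: eqP => _ /=; rewrite ?(mul0r, mulr0)// !mul1r expr2.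
Qed.

Lemma integral_sin : \int[mu1]_(x in `]0, pi[) sin x = 2 :> R.
Proof.
have dF (x : R) : is_derive x (1 : R) (fun x => - cos x) (sin x).
  by apply: is_derive_eq; rewrite opprK.
rewrite (Rintegral_FTC (@pi_gt0 R) dF (@continuous_sin R)) cos0 cospi; ring.
Qed.

Lemma integral_esin00 : \int[mu]_(z in @Qpi R) @esin R (0, 0)%N z = 4.
Proof.
have -> : \int[mu]_(z in @Qpi R) @esin R (0, 0)%N z = \int[mu]_(z in @Qpi R) (sin z.1 * sin z.2).
  by apply: eq_Rintegral => z _; rewrite /esin /= !mul1r.
rewrite (Rintegral_box_prod (@continuous_sin R) (@continuous_sin R)) integral_sin.
ring.
Qed.

(** The half of the square below the diagonal, with its right angle at [(pi, 0)]; the reflection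
    [swp] carries it to the other half. *)
Definition Tpi : set (R * R) := [set z | [/\ 0 < z.2, z.2 < z.1 & z.1 < pi]].

(* [(a, b)] stands for the pair of frequencies [(a + b + 2, a + 1)]. *)
Definition etri (i : nat * nat) (z : R * R) : R :=
  @esin R (i.1 + i.2.+1, i.1)%N z - @esin R (i.1, i.1 + i.2.+1)%N z.

Let swp (z : R * R) : R * R := (z.2, z.1).

Lemma etri_swap i z : etri i (swp z) = - etri i z.
Proof. by rewrite /etri /esin /=; ring. Qed.

Lemma etri_elementary i : elementary (etri i).
Proof.
have -> : etri i = (fun z => @esin R (i.1 + i.2.+1, i.1)%N z + (-1) * @esin R (i.1, i.1 + i.2.+1)%N z).
  by apply/funext => z; rewrite mulN1r.
apply: elementaryD; first exact: esin_elementary.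
by apply: elementaryM; [exact: elementary_cst|exact: esin_elementary].
Qed.

Lemma Tpi_open : open Tpi.
Proof.
have -> : Tpi = [set z : R * R | 0 < z.2] `&` [set z | 0 < z.1 - z.2] `&` [set z | 0 < pi - z.1].
  apply/seteqP; split => z /=; first by move=> [h1 h2 h3]; rewrite !subr_gt0.
  by rewrite !subr_gt0 => -[[]].
have op (f : R * R -> R) : continuous f -> open [set z | 0 < f z].
  move=> /continuousP cf; rewrite (_ : [set z | 0 < f z] = f @^-1` [set y | 0 < y])//.
  by apply: cf; exact: open_gt.
apply: openI; first apply: openI; apply: op => z.
- exact: cvg_snd.
- by apply: cvgB; [exact: cvg_fst|exact: cvg_snd].
- by apply: cvgB; [exact: cvg_cst|exact: cvg_fst].
Qed.

Lemma Tpi_measurable : measurable (Tpi : set (borel_plane R)).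
Proof. exact: (open_measurable2 Tpi_open). Qed.

Lemma Tpi_Qpi : Tpi `<=` @Qpi R.
Proof.
move=> z [h1 h2 h3]; split; rewrite /= in_itv/=; apply/andP; split => //;
  by [exact: lt_trans h2|exact: lt_trans h3].
Qed.

Lemma Tpi_fin : (mu Tpi < +oo)%E.
Proof.
apply: le_lt_trans (@Qpi_fin R); apply: le_measure; rewrite ?inE.
- exact: Tpi_measurable.
- exact: Qpi_measurable.
- exact: Tpi_Qpi.
Qed.

Lemma etri_L2 M i : measurable (M : set (borel_plane R)) -> (mu M < +oo)%E -> L2 M (etri i).
Proof. by move=> mM fM; apply: L2B => //; exact: esin_L2. Qed.

Let det_swap : (0 : R) * 0 - 1 * 1 != 0.
Proof. by rewrite mul0r mul1r sub0r oppr_eq0 oner_eq0. Qed.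

Let norm_det_swap : `|(0 : R) * 0 - 1 * 1| = 1.
Proof. by rewrite mul0r mul1r sub0r normrN normr1. Qed.

Let swpE z : swp z = (0 * z.1 + 1 * z.2 + 0, 1 * z.1 + 0 * z.2 + 0).
Proof. by rewrite /swp; congr pair; ring. Qed.

Let Tswp : set (R * R) := swp @^-1` Tpi.

Let Tswp_map z : Tpi (0 * z.1 + 1 * z.2 + 0, 1 * z.1 + 0 * z.2 + 0) <-> Tswp z.
Proof. by rewrite -swpE. Qed.

Let mTswp : measurable (Tswp : set (borel_plane R)).
Proof. exact: (measurable_linear_preimage Tpi_measurable Tswp_map). Qed.

Lemma nrm2_sub (M N : set (R * R)) f : measurable (M : set (borel_plane R)) ->
  measurable (N : set (borel_plane R)) -> M `<=` N -> L2 N f -> L2 M f /\ nrm2 M f <= nrm2 N f.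
Proof.
move=> mM mN MN LN; have mf : measurable_fun (N : set (borel_plane R)) f by case: LN.
have le : (\int[mu]_(x in M) ((f x) ^+ 2)%:E <= \int[mu]_(x in N) ((f x) ^+ 2)%:E)%E.
  apply: ge0_subset_integral => //.
    by apply/measurable_EFinP; exact: measurable_funX.
  by move=> x _; rewrite lee_fin sqr_ge0.
have LM : L2 M f.
  split; first exact: measurable_funS mf.
  by apply: le_lt_trans le _; case: LN.
split => //; rewrite -lee_fin.
have E K : measurable (K : set (borel_plane R)) -> L2 K f ->
    (nrm2 K f)%:E = (\int[mu]_(x in K) ((f x) ^+ 2)%:E)%E.
  move=> mK Lh; rewrite /nrm2 /L2dot /Rintegral fineK.
    by apply: eq_integral => x _; rewrite expr2.
  by apply: integrable_fin_num => //; exact: L2_integrable_mul.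
by rewrite !E.
Qed.

Lemma nrm2_setU (M N : set (R * R)) f : measurable (M : set (borel_plane R)) ->
  measurable (N : set (borel_plane R)) -> M `&` N = set0 -> L2 (M `|` N) f ->
  nrm2 (M `|` N) f = nrm2 M f + nrm2 N f.
Proof.
move=> mM mN MN LU; rewrite /nrm2 /L2dot Rintegral_setU//.
  apply: L2_integrable_mul => //; exact: measurableU.
by apply/disj_setPS; rewrite MN.
Qed.

Lemma L2dot_setU (M N : set (R * R)) f g : measurable (M : set (borel_plane R)) ->
  measurable (N : set (borel_plane R)) -> M `&` N = set0 -> L2 (M `|` N) f -> L2 (M `|` N) g ->
  L2dot (M `|` N) f g = L2dot M f g + L2dot N f g.
Proof.
move=> mM mN MN Lf Lg; rewrite /L2dot Rintegral_setU//.
  apply: L2_integrable_mul => //; exact: measurableU.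
by apply/disj_setPS; rewrite MN.
Qed.

(** The square is the triangle, its mirror image and the diagonal. The two halves contribute
    equally, and antisymmetry makes [f] vanish on the diagonal. *)
Lemma nrm2_antisym f : L2 (@Qpi R) f -> (forall z, f (swp z) = - f z) ->
  nrm2 (@Qpi R) f = 2 * nrm2 Tpi f.
Proof.
move=> Lf anti.
pose D := @Qpi R `&` [set z | z.1 = z.2].
have mD : measurable (D : set (borel_plane R)).
  apply: measurableI; first exact: Qpi_measurable.
  have -> : [set z : R * R | z.1 = z.2] = (fun z : R * R => z.1 - z.2) @^-1` [set 0].
    by apply/seteqP; split => z /=; [move=> ->; rewrite subrr|move/eqP; rewrite subr_eq0 => /eqP].
  apply: closed_measurable2; apply: closed_comp; last exact: closed_eq.
  by move=> z _; apply: cvgB; [exact: cvg_fst|exact: cvg_snd].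
have QE : @Qpi R = (Tpi `|` Tswp) `|` D.
  apply/seteqP; split => z.
    move=> Qz; have [] := Qz; rewrite /= !in_itv/= => /andP[a1 a2] /andP[b1 b2].
    by have [h|h|h] := ltgtP z.1 z.2; [left; right|left; left|right; split].
  move=> [[/Tpi_Qpi//|]|[]//].
  by move=> /Tpi_Qpi[/= h1 h2].
have mT := Tpi_measurable; have mU := measurableU _ _ mT mTswp.
have subU : Tpi `|` Tswp `<=` @Qpi R by rewrite QE; left.
have [LU _] := nrm2_sub mU (@Qpi_measurable R) subU Lf.
have subT : Tpi `<=` @Qpi R by exact: Tpi_Qpi.
have subTs : Tswp `<=` @Qpi R by rewrite QE; left; right.
have [LT _] := nrm2_sub mT (@Qpi_measurable R) subT Lf.
rewrite {1}QE nrm2_setU//; last 2 first.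
- apply/seteqP; split => z //= [[[h1 h2 h3]|[h1 h2 h3]] [_ /= h4]].
    by move: h2; rewrite h4 ltxx.
  by move: h2; rewrite /= h4 ltxx.
- by rewrite -QE.
rewrite nrm2_setU//; last first.
  apply/seteqP; split => z //= [[h1 h2 h3] [h4 h5 h6]].
  by have := lt_trans h2 h5; rewrite ltxx.
have -> : nrm2 D f = 0.
  rewrite /nrm2 /L2dot.
  rewrite (_ : Rintegral _ _ _ = \int[mu]_(x in D) 0).
    by rewrite Rintegral_cst// mul0r.
  apply: eq_Rintegral => z /set_mem [_ /= zz].
  have E : swp z = z by rewrite /swp; case: z zz => u v /= ->.
  have h := anti z; rewrite E in h.
  suff -> : f z = 0 by rewrite mulr0.
  lra.
rewrite addr0.
have -> : nrm2 Tswp f = nrm2 Tpi f.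
  rewrite (nrm2_linear det_swap Tpi_measurable Tswp_map LT) norm_det_swap mul1r.
  by apply: eq_Rintegral => z _; rewrite -swpE anti mulrNN.
ring.
Qed.

Lemma L2dot_antisym f g : L2 (@Qpi R) f -> L2 (@Qpi R) g ->
  (forall z, f (swp z) = - f z) -> (forall z, g (swp z) = - g z) ->
  L2dot (@Qpi R) f g = 2 * L2dot Tpi f g.
Proof.
move=> Lf Lg af ag; have mT := Tpi_measurable; have mQ := @Qpi_measurable R.
have [LfT _] := nrm2_sub mT mQ Tpi_Qpi Lf.
have [LgT _] := nrm2_sub mT mQ Tpi_Qpi Lg.
have h := nrm2D mQ Lf Lg; have hT := nrm2D mT LfT LgT.
have afg z : f (swp z) + g (swp z) = - (f z + g z) by rewrite af ag opprD.
have hS := nrm2_antisym (L2D mQ Lf Lg) afg.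
have := h; rewrite hS hT (nrm2_antisym Lf af) (nrm2_antisym Lg ag); lra.
Qed.

(** Expansion gives four products of double sines. Mixed ones vanish, because the first frequency
    exceeds the second. For equal indices the other two add up to twice [(pi / 2) ^+ 2], which the
    passage from square to triangle halves. *)
Lemma etri_ortho i j : L2dot Tpi (etri i) (etri j) = (i == j)%:R * (pi / 2) ^+ 2.
Proof.
have mQ := @Qpi_measurable R; have fQ := @Qpi_fin R.
have Le k : L2 (@Qpi R) (@esin R k) by exact: esin_L2.
have := L2dot_antisym (etri_L2 i mQ fQ) (etri_L2 j mQ fQ) (etri_swap i) (etri_swap j).
have B k1 k2 k3 k4 : L2dot (@Qpi R) (fun z => @esin R k1 z - @esin R k2 z)
    (fun z => @esin R k3 z - @esin R k4 z) =
    L2dot (@Qpi R) (@esin R k1) (@esin R k3) - L2dot (@Qpi R) (@esin R k1) (@esin R k4) -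
    (L2dot (@Qpi R) (@esin R k2) (@esin R k3) - L2dot (@Qpi R) (@esin R k2) (@esin R k4)).
  by rewrite L2dotBl// ?L2dotBr//; exact: L2B.
have -> : L2dot (@Qpi R) (etri i) (etri j) = _ := B _ _ _ _.
rewrite !esin_ortho.
case: i => [a b]; case: j => [c d] /=; rewrite !xpair_eqE /=.
have h1 : (a + b.+1 == c + d.+1)%N && (a == c) = (a == c) && (b == d).
  by apply/idP/idP => /andP[/eqP h /eqP h']; apply/andP; split; apply/eqP; lia.
have h4 : (a == c) && (a + b.+1 == c + d.+1)%N = (a == c) && (b == d).
  by apply/idP/idP => /andP[/eqP h /eqP h']; apply/andP; split; apply/eqP; lia.
have h2 : (a + b.+1 == c)%N && (a == c + d.+1)%N = false.
  by apply/negP => /andP[/eqP h /eqP h']; lia.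
have h3 : (a == c + d.+1)%N && (a + b.+1 == c)%N = false.
  by apply/negP => /andP[/eqP h /eqP h']; lia.
rewrite h1 h2 h3 h4 /= !mul0r; lra.
Qed.

(** Antisymmetrizing a double sine with the factor 1/2 gives plus or minus one half of some [etri],
    or 0 if its two frequencies agree. *)
Lemma lin_span_antisym g : lin_span (@esin R) g ->
  lin_span etri (fun z => 2^-1 * (g z - g (swp z))).
Proof.
elim=> [|a [k l] h _ IH].
  by apply: span_eq (span0 etri) _; apply/funext => z; rewrite subrr mulr0.
have E z : @esin R (k, l) (swp z) = @esin R (l, k) z by rewrite /esin /=; ring.
have [kl|kl|kl] := ltngtP k l.
- apply: span_eq (spanS (- a / 2) (k, (l - k.+1)%N) IH) _; apply/funext => z.
  rewrite E /etri /=; have -> : (k + (l - k.+1).+1)%N = l by lia.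
  ring.
- apply: span_eq (spanS (a / 2) (l, (k - l.+1)%N) IH) _; apply/funext => z.
  rewrite E /etri /=; have -> : (l + (k - l.+1).+1)%N = k by lia.
  ring.
- apply: span_eq IH _; apply/funext => z; rewrite E kl; ring.
Qed.

(** The antisymmetric extension [F] of [f] is approximated on the square by some [G], which is then
    antisymmetrized; on the triangle this operation reproduces [f] from [F]. *)
Lemma tri_dense f : L2 Tpi f -> L2_approx Tpi etri f.
Proof.
move=> Lf; have mT := Tpi_measurable; have mQ := @Qpi_measurable R.
split => // eps eps0.
pose f0 := f \_ Tpi.
have Lf0 : L2 (@Qpi R) f0.
  have mf : measurable_fun (Tpi : set (borel_plane R)) f by case: Lf.
  split.
    by apply: measurable_funTS; apply: (measurable_restrictT _ _).1.
  apply: le_lt_trans (_ : (\int[mu]_(x in Tpi) ((f x) ^+ 2)%:E < +oo)%E); last by case: Lf.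
  rewrite [leRHS]integral_mkcond.
  have -> : (fun x => ((f x) ^+ 2)%:E) \_ Tpi = (fun x => ((f0 x) ^+ 2)%:E).
    apply/funext => x; rewrite /f0 !patchE; case: ifPn => // _.
    by rewrite expr0n.
  apply: ge0_subset_integral => //.
    apply/measurable_EFinP; apply: measurable_funX.
    by apply: (measurable_restrictT _ _).1.
  by move=> x _; rewrite lee_fin sqr_ge0.
pose F z := f0 z - f0 (swp z).
have Qswp z : @Qpi R (0 * z.1 + 1 * z.2 + 0, 1 * z.1 + 0 * z.2 + 0) <-> @Qpi R z.
  by rewrite -swpE; split => -[].
have Lswp h : L2 (@Qpi R) h -> L2 (@Qpi R) (fun z => h (swp z)).
  move=> Lh; apply: L2_ext (L2_linear det_swap mQ Qswp Lh) => z _.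
  by rewrite -swpE.
have LF : L2 (@Qpi R) F by apply: L2B => //; exact: Lswp.
have [_ HF] := sine_dense LF.
have [G sG nG] := HF _ eps0.
exists (fun z => 2^-1 * (G z - G (swp z))); first exact: lin_span_antisym.
have LG : L2 (@Qpi R) G.
  by apply: span_L2 sG => // i; apply: esin_L2 => //; exact: Qpi_fin.
pose h z := F z - G z.
have Lh : L2 (@Qpi R) h by exact: L2B.
have Lhs := Lswp _ Lh.
have [LhT leh] := nrm2_sub mT mQ Tpi_Qpi Lh.
have [LhsT lehs] := nrm2_sub mT mQ Tpi_Qpi Lhs.
have nhs : nrm2 (@Qpi R) (fun z => h (swp z)) = nrm2 (@Qpi R) h.
  rewrite (nrm2_linear det_swap mQ Qswp Lh) norm_det_swap mul1r.
  by apply: eq_Rintegral => z _; rewrite -swpE.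
have P z : Tpi z -> f z - 2^-1 * (G z - G (swp z)) = 2^-1 * (h z + - h (swp z)).
  move=> Tz; have f0z : f0 z = f z by rewrite /f0 patchE mem_set.
  have f0s : f0 (swp z) = 0.
    rewrite /f0 patchE memNset// => -[h1 h2 h3]; case: Tz => h4 h5 h6.
    by have := lt_trans h2 h5; rewrite ltxx.
  have ss : swp (swp z) = z by case: (z).
  by rewrite /h /F f0z f0s ss f0z; field.
have -> : nrm2 Tpi (fun z => f z - 2^-1 * (G z - G (swp z))) =
    nrm2 Tpi (fun z => 2^-1 * (h z + - h (swp z))).
  by apply: L2dot_ext => z Tz; exact: P.
rewrite nrm2Z//; last by apply: L2D => //; exact: L2N.
have := nrm2D_le mT LhT (L2N mT LhsT).
have -> : nrm2 Tpi (fun z => - h (swp z)) = nrm2 Tpi (fun z => h (swp z)).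
  by apply: eq_Rintegral => z _; rewrite mulrNN.
rewrite nhs in lehs; move: nG; rewrite -/h => nG.
(* The factor 1/4 cancels the 2 + 2 of the parallelogram bound, so the error on the triangle is at
   most that on the square. *)
have -> : (2^-1 : R) ^+ 2 = 4^-1 by field.
lra.
Qed.

End triangle.

(** * Fourier series *)

Lemma cvgn_L2dot (R : realType) (M : set (R * R)) :
  measurable (M : set (borel_plane R)) ->
  forall (f_ : nat -> R * R -> R) f g, (forall n, L2 M (f_ n)) -> L2 M f -> L2 M g ->
  nrm2 M (fun x => f_ n x - f x) @[n --> \oo] --> (0 : R) ->
  L2dot M (f_ n) g @[n --> \oo] --> L2dot M f g.
Proof. by move=> mM f_ f g Lf_ Lf Lg; apply: cvg_L2dot => //; exact: nearW. Qed.

Section orthonormal.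
Variable R : realType.
Local Notation mu := (@leb2 R).
Variable M : set (R * R).
Hypothesis mM : measurable (M : set (borel_plane R)).
Variable phi : nat -> R * R -> R.
Hypothesis Lphi : forall j, L2 M (phi j).
Hypothesis ortho : forall i j, L2dot M (phi i) (phi j) = (i == j)%:R.
Hypothesis dense : forall f, L2 M f -> L2_approx M phi f.
Implicit Types f g h : R * R -> R.

Definition psum f n (x : R * R) := \sum_(j < n) L2dot M f (phi j) * phi j x.

Lemma psum_L2 f n : L2 M (psum f n).
Proof. by apply: L2_sum => // j; exact: L2Z. Qed.

Lemma psum_dot f n h : L2 M h ->
  L2dot M (psum f n) h = \sum_(j < n) L2dot M f (phi j) * L2dot M h (phi j).
Proof.
move=> Lh; rewrite /psum L2dot_suml//; last by move=> j; exact: L2Z.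
by apply: eq_bigr => j _; rewrite L2dotZl// [L2dot M (phi j) h]L2dotC.
Qed.

Lemma psum_coef f n (j : nat) : (j < n)%N ->
  L2dot M (psum f n) (phi j) = L2dot M f (phi j).
Proof.
move=> jn; rewrite psum_dot// (bigD1 (Ordinal jn))//= ortho eqxx mulr1 big1 ?addr0// => i ij.
rewrite ortho (_ : (j == i :> nat) = false) ?mulr0//.
by apply: contraNF ij => /eqP ji; apply/eqP/val_inj.
Qed.

Lemma nrm2_psum f n : L2 M f ->
  nrm2 M (fun x => f x - psum f n x) = nrm2 M f - \sum_(j < n) L2dot M f (phi j) ^+ 2.
Proof.
move=> Lf; rewrite nrm2B//; last exact: psum_L2.
have -> : nrm2 M (psum f n) = \sum_(j < n) L2dot M f (phi j) ^+ 2.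
  rewrite /nrm2 psum_dot; last exact: psum_L2.
  by apply: eq_bigr => j _; rewrite psum_coef// expr2.
rewrite L2dotC psum_dot//.
under [X in 2 * X]eq_bigr do rewrite -expr2.
ring.
Qed.

Lemma bessel f n : L2 M f -> \sum_(j < n) L2dot M f (phi j) ^+ 2 <= nrm2 M f.
Proof. by move=> Lf; rewrite -subr_ge0 -nrm2_psum// nrm2_ge0. Qed.

(** Says that [g] lies in the span of the first [n] functions, by duality and thus without
    coordinates. *)
Let supp n g := forall h, L2 M h -> (forall j, (j < n)%N -> L2dot M h (phi j) = 0) ->
  L2dot M h g = 0.

Let supp_span g : lin_span phi g -> exists N, forall n, (N <= n)%N -> supp n g.
Proof.
elim=> [|a i f sf [N HN]].
  exists 0%N => n _ h Lh _; rewrite /L2dot.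
  by under eq_Rintegral do rewrite mulr0; rewrite Rintegral_cst// mul0r.
have Lf : L2 M f by exact: span_L2 sf.
exists (maxn N i.+1) => n; rewrite geq_max => /andP[Nn ni] h Lh h0.
rewrite L2dotDr//; last exact: L2Z.
by rewrite L2dotZr// h0// mulr0 add0r; exact: HN h0.
Qed.

(* Partial sums of the Fourier series are best approximations. *)
Lemma psum_cvg f : L2 M f -> nrm2 M (fun x => psum f n x - f x) @[n --> \oo] --> (0 : R).
Proof.
move=> Lf; apply/cvgrPdist_lt => e e0.
have [_ /(_ e e0)[g sg ng]] := dense Lf.
have [N HN] := supp_span sg.
have Lg : L2 M g by exact: span_L2 sg.
exists N => // n /= Nn.
rewrite sub0r normrN ger0_norm ?nrm2_ge0// nrm2BC; apply: le_lt_trans ng.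
have Ls := psum_L2 f n; have La := L2B mM Lf Ls; have Lb := L2B mM Ls Lg.
have La0 j : (j < n)%N -> L2dot M (fun x => f x - psum f n x) (phi j) = 0.
  by move=> jn; rewrite L2dotBl// psum_coef// subrr.
have ab0 : L2dot M (fun x => f x - psum f n x) (fun x => psum f n x - g x) = 0.
  rewrite L2dotBr// (HN n Nn _ La La0) subr0 L2dotC psum_dot// big1// => j _.
  by rewrite La0 ?mulr0.
have := nrm2D mM La Lb; rewrite ab0 mulr0 addr0 => h.
apply: le_trans (_ : nrm2 M (fun x => (f x - psum f n x) + (psum f n x - g x)) <= _).
  by rewrite h lerDl nrm2_ge0.
by rewrite le_eqVlt; apply/orP; left; apply/eqP/L2dot_ext => x _; rewrite subrKA.
Qed.

Lemma orthonormal_basis_of_dense : orthonormal_basis M phi.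
Proof.
split => // f Lf.
exact: (cvg_L2dist2 mM (nearW _ (psum_L2 f)) Lf).2 (psum_cvg Lf).
Qed.

Lemma parseval f h : L2 M f -> L2 M h ->
  \sum_(j < n) L2dot M f (phi j) * L2dot M h (phi j) @[n --> \oo] --> L2dot M f h.
Proof.
move=> Lf Lh; have h1 := cvgn_L2dot mM (psum_L2 f) Lf Lh (psum_cvg Lf).
have -> : (fun n => \sum_(j < n) L2dot M f (phi j) * L2dot M h (phi j)) =
    (fun n => L2dot M (psum f n) h) by apply/funext => n; rewrite psum_dot.
exact: h1.
Qed.

Lemma parseval_le f (X : R) : L2 M f ->
  (forall n, \sum_(j < n) L2dot M f (phi j) ^+ 2 <= X) -> nrm2 M f <= X.
Proof.
move=> Lf H; have h := parseval Lf Lf.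
apply: (ler_cvg_to h (cvg_cst X)).
by apply: nearW => n; under eq_bigr do rewrite -expr2; exact: H.
Qed.

End orthonormal.

(** * Absolutely summable series of uniformly bounded functions *)

Section uniform_series.
Variable R : realType.
Local Notation mu := (@leb2 R).
Variable M : set (R * R).
Hypothesis mM : measurable (M : set (borel_plane R)).
Hypothesis fM : (mu M < +oo)%E.
Variables (a : nat -> R) (f : nat -> R * R -> R) (B : R).
Hypothesis B0 : 0 <= B.
Hypothesis mf : forall j, measurable_fun (M : set (borel_plane R)) (f j).
Hypothesis fB : forall j x, `|f j x| <= B.
Hypothesis a_summable : cvgn (series (fun j => `|a j|)).

Definition fsum n (x : R * R) := \sum_(0 <= j < n) a j * f j x.
Definition flim (x : R * R) : R := limn (fsum ^~ x).

Let term_bound j x : `|a j * f j x| <= B * `|a j|.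
Proof. by rewrite normrM mulrC ler_wpM2r. Qed.

Lemma fsum_cvg x : cvgn (fsum ^~ x).
Proof.
have : cvgn (series (fun j => `|a j * f j x|)).
  apply: (@series_le_cvg _ _ (fun j => B * `|a j|)) => //.
    by move=> j; rewrite mulr_ge0.
  have -> : series (fun j => B * `|a j|) = (fun n => B * series (fun j => `|a j|) n).
    by apply/funext => n; rewrite /series/= mulr_sumr.
  by apply: is_cvgM => //; exact: is_cvg_cst.
by move/normed_cvg.
Qed.

(** The tail of the coefficient series bounds the error uniformly in [x]. This yields a limit
    defined at every point, which is measurable, bounded and also the limit in L^2. *)
Lemma flim_bound n x : `|fsum n x - flim x| <=
  B * (limn (series (fun j => `|a j|)) - series (fun j => `|a j|) n).
Proof.
have h1 : (fun m => `|fsum n x - fsum m x|) m @[m --> \oo] --> `|fsum n x - flim x|.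
  by apply: cvg_norm; apply: cvgB; [exact: cvg_cst|exact: fsum_cvg].
apply: (ler_cvg_to h1 (cvg_cst _)); exists n => // m /= nm.
have -> : fsum n x - fsum m x = - \sum_(n <= j < m) a j * f j x.
  by rewrite /fsum (big_cat_nat (leq0n n) nm)//=; ring.
rewrite normrN (le_trans (ler_norm_sum _ _ _))//.
apply: le_trans (_ : \sum_(n <= j < m) B * `|a j| <= _); first by apply: ler_sum.
rewrite -mulr_sumr ler_wpM2l//.
have : series (fun j => `|a j|) m <= limn (series (fun j => `|a j|)).
  by apply: nondecreasing_cvgn_le => //; apply: nondecreasing_series.
have -> : series (fun j => `|a j|) m =
    series (fun j => `|a j|) n + \sum_(n <= j < m) `|a j|.
  by rewrite /series/= (big_cat_nat (leq0n n) nm).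
set l := limn _; lra.
Qed.

Lemma flim_measurable : measurable_fun (M : set (borel_plane R)) flim.
Proof.
apply: (@measurable_fun_cvg _ _ _ M fsum) => //; last by move=> x _; exact: fsum_cvg.
by move=> n; apply: measurable_sum => j; apply: measurable_funM; [exact: measurable_cst|exact: mf].
Qed.

Lemma fsum_L2 n : L2 M (fsum n).
Proof.
apply: (bounded_L2 (C := \sum_(0 <= j < n) B * `|a j|)) => //.
  by apply: measurable_sum => j; apply: measurable_funM; [exact: measurable_cst|exact: mf].
by move=> x _; rewrite (le_trans (ler_norm_sum _ _ _))// ler_sum.
Qed.

Lemma flim_L2 : L2 M flim.
Proof.
apply: (bounded_L2 (C := B * limn (series (fun j => `|a j|)))) => //; first exact: flim_measurable.
move=> x _; have := flim_bound 0 x.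
by rewrite /fsum /series /= !big_geq// sub0r normrN subr0.
Qed.

Lemma fsum_cvg_nrm2 : nrm2 M (fun x => fsum n x - flim x) @[n --> \oo] --> (0 : R).
Proof.
apply: (@bounded_cvg_nrm2 R M mM fM (fun n x => fsum n x - flim x)
   (B * limn (series (fun j => `|a j|)))).
- by move=> n; apply: measurable_funB; [case: (fsum_L2 n)|exact: flim_measurable].
- move=> n x _; apply: le_trans (flim_bound n x) _; rewrite ler_wpM2l// lerBlDr lerDl.
  by rewrite /series/= sumr_ge0.
- move=> x _; rewrite -(subrr (flim x)); apply: cvgB; last exact: cvg_cst.
  exact: fsum_cvg.
Qed.

End uniform_series.

(** * The heat equation *)

Section real_lemmas.
Variable R : realType.

Lemma inv_square_summable : cvgn (series (fun j => (j.+1%:R ^+ 2)^-1 : R)).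
Proof.
apply: nondecreasing_is_cvgn.
  by apply: nondecreasing_series => n _; rewrite invr_ge0 exprn_ge0.
exists 2 => _ [n _ <-]; rewrite /series/=.
(* The telescoping majorant for inverse squares. *)
have : \sum_(0 <= j < n.+1) (j.+1%:R ^+ 2)^-1 <= 2 - n.+1%:R^-1 :> R.
  elim: n => [|n IH]; first by rewrite big_nat1 expr1n invr1; lra.
  rewrite big_nat_recr//=; apply: le_trans (lerD IH (lexx _)) _.
  have x0 : (0 : R) < n.+1%:R by rewrite ltr0n.
  rewrite -[n.+2%:R]natr1; set x := n.+1%:R in x0 *.
  have x1 : 0 < x + 1 by rewrite addr_gt0.
  have -> : 2 - x^-1 = 2 - (x + 1)^-1 - (x * (x + 1))^-1.
    by field; rewrite !gt_eqF.
  rewrite -addrA gerDl addrC subr_le0 lef_pV2 ?posrE ?exprn_gt0 ?mulr_gt0//.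
  by rewrite expr2 ler_wpM2r ?lerDl// ltW.
rewrite big_nat_recr//= => h.
apply: le_trans (le_trans _ h) _; first by rewrite lerDl invr_ge0 exprn_ge0.
by rewrite gerDl oppr_le0 invr_ge0.
Qed.

(** From [1 - x <= expR (- x)] follows [expR x - 1 <= x * expR x], so the remainder lies between 0
    and [x * (expR x - 1)], which is estimated according to the sign of [x]. *)
Lemma expR_taylor1 (x : R) : `|expR x - 1 - x| <= x ^+ 2 * expR `|x|.
Proof.
have h0 := expR_ge1Dx x; have h1 := expR_ge1Dx (- x).
have e0 := expR_gt0 x.
have h2 : expR x - 1 <= x * expR x.
  have : (1 - x) * expR x <= expR (- x) * expR x by rewrite ler_wpM2r// ltW.
  by rewrite -expRD addNr expR0 mulrBl mul1r; lra.
have h3 : expR x - 1 - x <= x * (expR x - 1) by lra.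
rewrite ger0_norm; last by lra.
apply: le_trans h3 _; have [x0|x0] := leP 0 x.
  by rewrite ger0_norm// expr2 -mulrA ler_wpM2l//; lra.
have : 1 <= expR `|x| by rewrite -expR0 ler_expR.
have : x * (expR x - 1) <= x ^+ 2 by rewrite expr2; nra.
have := sqr_ge0 x; nra.
Qed.

(** Since [1 - expR (- x)] lies between 0 and 1, its square is at most itself, hence at most [x]. *)
Lemma one_sub_expRN_sqr (x : R) : 0 <= x -> (1 - expR (- x)) ^+ 2 <= x.
Proof.
move=> x0; have h := expR_ge1Dx (- x); have e0 := expR_gt0 (- x).
have e1 : expR (- x) <= 1 by rewrite -expR0 ler_expR; lra.
by rewrite expr2; nra.
Qed.

End real_lemmas.

(** * The series solution and the coefficients of every solution *)

Section heat.
Variable R : realType.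
Local Notation mu := (@leb2 R).
Variable M : set (R * R).
Hypothesis mM : measurable (M : set (borel_plane R)).
Hypothesis fM : (mu M < +oo)%E.
Variables (phi : nat -> R * R -> R) (g : nat -> bool -> R * R -> R) (lam : nat -> R).
Variables (B K : R).
Hypothesis B0 : 0 <= B.
Hypothesis Hgrad : forall j, H10_grad M (phi j) (g j).
Hypothesis Hweak : forall j psi, test_function M psi ->
  L2dot M (phi j) (laplacian psi) = L2dot M (fun x => - (lam j * phi j x)) psi.
Hypothesis ortho : forall i j, L2dot M (phi i) (phi j) = (i == j)%:R.
Hypothesis dense : forall f, L2 M f -> L2_approx M phi f.
Hypothesis phiB : forall j x, `|phi j x| <= B.
Hypothesis gB : forall j b x, `|g j b x| <= B * lam j.
Hypothesis lam_gt0 : forall j, 0 < lam j.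
Hypothesis growth : forall j, j.+1%:R <= K * lam j ^+ 2.

Let Lphi j : L2 M (phi j). Proof. by case: (Hgrad j). Qed.

Lemma eigen_dirichlet j :
  dirichlet_laplacian M (phi j) (fun x => - (lam j * phi j x)).
Proof.
split; [exact: H10_gradW (Hgrad j)|by apply: L2N => //; exact: L2Z|].
by move=> psi; exact: Hweak.
Qed.

Let L1 : L2 M (fun=> 1). Proof. exact: L2_cst. Qed.
Definition coef j := L2dot M (fun=> 1) (phi j).
Let damp t j := expR (- (lam j * t)) * coef j.

Let coef_bound j : `|coef j| <= nrm2 M (fun=> 1) + 1.
Proof.
have := L2dot_CS mM L1 (Lphi j).
rewrite [nrm2 M (phi j)]ortho eqxx mulr1 -/(coef j) => h.
have := nrm2_ge0 M (fun=> 1 : R); set a := nrm2 M _ in h *.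
rewrite -[coef j ^+ 2]real_normK ?num_real// in h.
have := normr_ge0 (coef j); nra.
Qed.

(** The exponential absorbs [lam ^+ (k + 4)]; the four powers beyond the required [k] leave
    [lam ^- 4], which by [growth] is at most a multiple of the inverse square of [j.+1]. *)
Lemma damp_summable t k : 0 < t -> cvgn (series (fun j => `|damp t j * lam j ^+ k|)).
Proof.
move=> t0; pose N := (k + 4)%N; pose A : R := N%:R ^+ N / t ^+ N.
pose C := (nrm2 M (fun=> 1) + 1) * A * K ^+ 2.
have A0 : 0 <= A by rewrite divr_ge0 ?exprn_ge0// ltW.
apply: (@series_le_cvg _ _ (fun j => C * (j.+1%:R ^+ 2)^-1)) => // [n|n|].
- apply: mulr_ge0; last by rewrite invr_ge0 exprn_ge0.
  apply: mulr_ge0; last exact: sqr_ge0.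
  by apply: mulr_ge0 => //; rewrite addr_ge0// nrm2_ge0.
- have l0 := lam_gt0 n; rewrite /damp !normrM.
  rewrite (ger0_norm (expR_ge0 _)) (ger0_norm (exprn_ge0 _ (ltW l0))).
  have h1 : lam n ^+ k * expR (- (lam n * t)) <= A * (lam n ^+ 4)^-1.
    have := @exprn_le_expR R N (lam n * t) (mulr_ge0 (ltW l0) (ltW t0)).
    rewrite exprMn => h.
    rewrite expRN ler_pdivrMr ?expR_gt0// mulrAC ler_pdivlMr ?exprn_gt0// -exprD.
    by rewrite /A mulrAC ler_pdivlMr ?exprn_gt0.
  have h2 : (lam n ^+ 4)^-1 <= K ^+ 2 * (n.+1%:R ^+ 2)^-1.
    rewrite ler_pdivlMr ?exprn_gt0 ?ltr0n// mulrC ler_pdivrMr ?exprn_gt0//.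
    rewrite -[4%N]/(2 * 2)%N exprM -exprMn ler_pXn2r ?nnegrE//.
    by apply: le_trans (growth n).
  apply: le_trans (_ : (nrm2 M (fun=> 1) + 1) * (lam n ^+ k * expR (- (lam n * t))) <= _).
    have -> : expR (- (lam n * t)) * `|coef n| * lam n ^+ k =
      `|coef n| * (lam n ^+ k * expR (- (lam n * t))) by ring.
    by rewrite ler_wpM2r// mulr_ge0 ?expR_ge0// exprn_ge0// ltW.
  have -> : C * (n.+1%:R ^+ 2)^-1 =
    (nrm2 M (fun=> 1) + 1) * (A * (K ^+ 2 * (n.+1%:R ^+ 2)^-1)) by rewrite /C; ring.
  apply: ler_wpM2l; first by rewrite addr_ge0// nrm2_ge0.
  by apply: le_trans h1 _; apply: ler_wpM2l.
have -> : series (fun j => C * (j.+1%:R ^+ 2)^-1) = (fun n => C * series (fun j => (j.+1%:R ^+ 2)^-1) n).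
  by apply/funext => n; rewrite /series/= mulr_sumr.
by apply: is_cvgM; [exact: is_cvg_cst|exact: inv_square_summable].
Qed.

Let mphi j : measurable_fun (M : set (borel_plane R)) (phi j).
Proof. by case: (Lphi j). Qed.

Lemma flim_coef (a : nat -> R) j : cvgn (series (fun j => `|a j|)) ->
  L2dot M (flim a phi) (phi j) = a j.
Proof.
move=> sa.
have h := cvgn_L2dot mM (fsum_L2 mM fM _ mphi phiB) (flim_L2 mM fM B0 mphi phiB sa) (Lphi j)
  (fsum_cvg_nrm2 mM fM B0 mphi phiB sa).
apply: (cvgn_unique h); apply: cvg_near_cst.
exists j.+1 => // n /= jn.
rewrite /fsum L2dot_suml//; last by move=> i; exact: L2Z.
rewrite big_mkord (bigD1 (Ordinal jn))//= L2dotZl// ortho eqxx mulr1 big1 ?addr0// => i ij.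
rewrite L2dotZl// ortho (_ : (i == j :> nat) = false) ?mulr0//.
by apply: contraNF ij => /eqP ji; apply/eqP/val_inj.
Qed.

(** The candidate solution, its time derivative and its gradient. In [gsol] each [g j b] is divided
    by [lam j] and its coefficient multiplied by it, so that all three are summable combinations of
    functions bounded by [B]. *)
Let sol t := flim (damp t) phi.
Let dsol t := flim (fun j => - (damp t j * lam j)) phi.
Let gsol t b := flim (fun j => damp t j * lam j) (fun j x => (lam j)^-1 * g j b x).

Let s0 t : 0 < t -> cvgn (series (fun j => `|damp t j|)).
Proof.
move=> t0; have -> : (fun j => `|damp t j|) = (fun j => `|damp t j * lam j ^+ 0|).
  by apply/funext => j; rewrite expr0 mulr1.
exact: damp_summable.
Qed.

Let s1 t : 0 < t -> cvgn (series (fun j => `|damp t j * lam j|)).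
Proof.
exact: (@damp_summable t 1%N).
Qed.

Let s1N t : 0 < t -> cvgn (series (fun j => `|- (damp t j * lam j)|)).
Proof.
move=> t0; have -> : (fun j => `|- (damp t j * lam j)|) = (fun j => `|damp t j * lam j|).
  by apply/funext => j; rewrite normrN.
exact: s1.
Qed.

Let gn_bound j b x : `|(lam j)^-1 * g j b x| <= B.
Proof.
have l0 := lam_gt0 j.
by rewrite normrM normfV (gtr0_norm l0) mulrC ler_pdivrMr.
Qed.

Let mgn b j : measurable_fun (M : set (borel_plane R)) (fun x => (lam j)^-1 * g j b x).
Proof.
apply: measurable_funM; first exact: measurable_cst.
by case: (Hgrad j) => _ /(_ b)[].
Qed.

Lemma sol_H10 t : 0 < t -> H10_grad M (sol t) (gsol t).
Proof.
move=> t0; apply: H10_grad_lim => //.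
- exact: (flim_L2 mM fM B0 mphi phiB (s0 t0)).
- by move=> b; exact: (flim_L2 mM fM B0 (mgn b) (fun j x => gn_bound j b x) (s1 t0)).
move=> e e0.
have c1 := fsum_cvg_nrm2 mM fM B0 mphi phiB (s0 t0).
have c2 b := fsum_cvg_nrm2 mM fM B0 (mgn b) (fun j x => gn_bound j b x) (s1 t0).
have [N [h1 h2]] := cvg0_bool_lt c1 c2 e0.
exists (fsum (damp t) phi N), (fun b => fsum (fun j => damp t j * lam j) (fun j x => (lam j)^-1 * g j b x) N).
split => //.
have := H10_grad_sum mM fM (index_iota 0 N) (fun j => H10_grad_scale mM fM (damp t j) (Hgrad j)).
congr (H10_grad _ _ _); apply/funext => b; apply/funext => x.
rewrite /fsum; apply: eq_bigr => j _.
by rewrite -mulrA mulVKf// gt_eqF.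
Qed.

Lemma sol_dirichlet t : 0 < t -> dirichlet_laplacian M (sol t) (dsol t).
Proof.
move=> t0; split.
- exact: H10_gradW (sol_H10 t0).
- exact: (flim_L2 mM fM B0 mphi phiB (s1N t0)).
move=> psi tpsi.
have Lpsi := test_function_L2 mM fM tpsi.
have Llap := test_function_L2 mM fM (test_function_laplacian tpsi).
have h1 := cvgn_L2dot mM (fsum_L2 mM fM _ mphi phiB) (flim_L2 mM fM B0 mphi phiB (s0 t0)) Llap
  (fsum_cvg_nrm2 mM fM B0 mphi phiB (s0 t0)).
have h2 := cvgn_L2dot mM (fsum_L2 mM fM _ mphi phiB) (flim_L2 mM fM B0 mphi phiB (s1N t0)) Lpsi
  (fsum_cvg_nrm2 mM fM B0 mphi phiB (s1N t0)).
apply: (cvgn_unique h1).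
have E n : L2dot M (fsum (damp t) phi n) (laplacian psi) =
    L2dot M (fsum (fun j => - (damp t j * lam j)) phi n) psi.
  rewrite /fsum L2dot_suml//; last by move=> j; exact: L2Z.
  rewrite L2dot_suml//; last by move=> j; exact: L2Z.
  apply: eq_bigr => j _; rewrite L2dotZl// L2dotZl// Hweak// L2dotNl//; last exact: L2Z.
  by rewrite L2dotZl//; ring.
by rewrite (funext E).
Qed.

Let Lsol t : 0 < t -> L2 M (sol t).
Proof. by move=> t0; case: (sol_H10 t0). Qed.

Let Ldsol t : 0 < t -> L2 M (dsol t).
Proof. by move=> t0; case: (sol_dirichlet t0). Qed.

(** Reduces L^2 estimates for the heat series to scalar estimates, one per mode: Parseval for [f]
    against Bessel for the constant 1. *)
Lemma nrm2_le_coef (K' : R) f : L2 M f ->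
  (forall j, L2dot M f (phi j) ^+ 2 <= K' * coef j ^+ 2) -> 0 <= K' ->
  nrm2 M f <= K' * nrm2 M (fun=> 1).
Proof.
move=> Lf H K0; apply: (parseval_le mM Lphi ortho dense Lf) => n.
apply: (@le_trans _ _ (\sum_(j < n) K' * coef j ^+ 2)); first by apply: ler_sum.
by rewrite -mulr_sumr ler_wpM2l//; exact: (bessel mM Lphi ortho).
Qed.

Lemma sol_derivative t : 0 < t ->
  L2dist2 M (fun x => (sol (t + h) x - sol t x) / h) (dsol t) @[h --> 0^'] --> 0%E.
Proof.
(* The number [16 / t ^+ 2] bounds [lam j ^+ 2 * expR (- (lam j * (t / 2)))]; it is squared because
   squared norms are compared. *)
move=> t0; pose C : R := (16 / t ^+ 2) ^+ 2.
have Lq h : 0 < t + h -> L2 M (fun x => (sol (t + h) x - sol t x) / h).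
  move=> th; have := L2Z mM h^-1 (L2B mM (Lsol th) (Lsol t0)).
  by apply: L2_ext => x _; rewrite mulrC.
have t2 : 0 < t / 2 by rewrite divr_gt0.
have key h : h != 0 -> `|h| < t / 2 ->
    nrm2 M (fun x => (sol (t + h) x - sol t x) / h - dsol t x) <= C * h ^+ 2 * nrm2 M (fun=> 1).
  move=> hn0 ht.
  have th : 0 < t + h by move: ht; rewrite ltr_norml => /andP[]; lra.
  apply: nrm2_le_coef.
  - by apply: L2B => //; [exact: Lq|exact: Ldsol].
  - move=> j; have l0 := lam_gt0 j.
    have -> : L2dot M (fun x => (sol (t + h) x - sol t x) / h - dsol t x) (phi j) =
       coef j * (expR (- (lam j * t)) * ((expR (- (lam j * h)) - 1 - - (lam j * h)) / h)).
      rewrite L2dotBl//; last 2 first.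
      - exact: Lq.
      - exact: Ldsol.
      rewrite flim_coef; last exact: s1N.
      have -> : L2dot M (fun x => (sol (t + h) x - sol t x) / h) (phi j) =
          h^-1 * (damp (t + h) j - damp t j).
        rewrite -(flim_coef j (s0 th)) -(flim_coef j (s0 t0)) -L2dotBl//; last 2 first.
        - exact: Lsol.
        - exact: Lsol.
        rewrite -L2dotZl//; last by apply: L2B => //; exact: Lsol.
        by apply: L2dot_ext => // x _; rewrite mulrC.
      rewrite /damp.
      have -> : expR (- (lam j * (t + h))) = expR (- (lam j * t)) * expR (- (lam j * h)).
        by rewrite -expRD; congr expR; ring.
      by field.
    rewrite exprMn mulrC ler_wpM2r ?sqr_ge0//.
    set X := _ * (_ / h).
    have C0 : 0 <= 16 / t ^+ 2 * `|h| by rewrite mulr_ge0// divr_ge0// sqr_ge0.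
    suff hX : `|X| <= 16 / t ^+ 2 * `|h|.
      rewrite -[X ^+ 2]real_normK ?num_real// -[h ^+ 2]real_normK ?num_real//.
      by rewrite /C -exprMn ler_pXn2r ?nnegrE.
    have tay := expR_taylor1 (- (lam j * h)).
    rewrite /X normrM normrM normfV (ger0_norm (expR_ge0 _)).
    have h0 : 0 < `|h| by rewrite normr_gt0.
    rewrite mulrA ler_pdivrMr//.
    apply: le_trans (ler_wpM2l (expR_ge0 _) tay) _.
    rewrite sqrrN normrN normrM (gtr0_norm l0) exprMn.
    have -> : 16 / t ^+ 2 * `|h| * `|h| = h ^+ 2 * (16 / t ^+ 2).
      by rewrite -[h ^+ 2]real_normK ?num_real// expr2; ring.
    (* The restriction [|h| < t / 2] leaves half of the damping after absorbing the exponential of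
       the Taylor remainder. *)
    have e2 : expR (- (lam j * t)) * expR (lam j * `|h|) <= expR (- (lam j * (t / 2))).
      rewrite -expRD ler_expR -subr_ge0.
      have -> : - (lam j * (t / 2)) - (- (lam j * t) + lam j * `|h|) = lam j * (t / 2 - `|h|).
        by field.
      by rewrite mulr_ge0 ?subr_ge0// ltW.
    have e3 : lam j ^+ 2 * expR (- (lam j * (t / 2))) <= 16 / t ^+ 2.
      have := @exprn_le_expR R 2 (lam j * (t / 2)) (mulr_ge0 (ltW l0) (ltW t2)).
      rewrite expRN ler_pdivrMr ?expR_gt0// exprMn expr_div_n => h4.
      rewrite mulrAC ler_pdivlMr ?exprn_gt0//.
      have -> : (16 : R) = 2 ^+ 2 * 2 ^+ 2 by ring.
      move: h4; rewrite mulrA ler_pdivrMr ?exprn_gt0//; lra.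
    rewrite (_ : expR _ * _ = h ^+ 2 * (lam j ^+ 2 * (expR (- (lam j * t)) * expR (lam j * `|h|)))); last by ring.
    rewrite ler_wpM2l ?sqr_ge0//; apply: le_trans e3.
    by rewrite ler_wpM2l ?sqr_ge0.
  - by rewrite mulr_ge0 ?sqr_ge0.
apply/(cvg_L2dist2 mM).
- have : \forall h \near (0 : R)^', `|h| < t / 2 by exact: dnbhs0_lt.
  apply: filterS => h ht; apply: Lq; move: ht; rewrite ltr_norml => /andP[]; lra.
- exact: Ldsol.
have c0 : C * h ^+ 2 * nrm2 M (fun=> 1) @[h --> (0 : R)^'] --> (0 : R).
  have hc : C * h ^+ 2 * nrm2 M (fun=> 1) @[h --> (0 : R)] --> (C * 0 ^+ 2 * nrm2 M (fun=> 1) : R).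
    apply: cvgM; last exact: cvg_cst.
    apply: cvgM; first exact: cvg_cst.
    by under eq_fun do rewrite expr2; rewrite expr2; apply: cvgM; exact: cvg_id.
  rewrite expr0n/= mulr0 mul0r in hc.
  by apply: (cvg_trans _ hc); apply: cvg_app; exact: nbhs_dnbhs.
apply: (@squeeze_cvgr _ _ _ _ (fun=> 0) (fun h => C * h ^+ 2 * nrm2 M (fun=> 1))) c0 => //; last exact: cvg_cst.
have H1 : \forall h \near (0 : R)^', `|h| < t / 2 by exact: dnbhs0_lt.
have H2 : \forall h \near (0 : R)^', h != 0 by exact: nbhs_dnbhs_neq.
by apply: filterS2 H1 H2 => h h1 h2; rewrite nrm2_ge0 key.
Qed.

(** The modes below [N] contribute at most [t * S], and the others at most the tail of the squared
    coefficients of 1, which completeness makes small uniformly in [t]. *)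
Lemma sol_initial : L2dist2 M (sol t) (fun=> 1) @[t --> 0^'+] --> 0%E.
Proof.
apply: (cvg_L2dist2 mM _ L1).2.
  by apply: filterS (nbhs_right_gt (0 : R)) => t t0; exact: Lsol.
apply/cvgrPdist_lt => e e0.
have cp := psum_cvg mM Lphi ortho dense L1.
have e2 : 0 < e / 2 by rewrite divr_gt0.
have [N _ HN] : \forall n \near \oo, nrm2 M (fun x => psum M phi (fun=> 1) n x - 1) < e / 2.
  exact: cvgr_lt cp _ e2.
have {HN} : nrm2 M (fun=> 1) - \sum_(j < N) coef j ^+ 2 < e / 2.
  by rewrite -(nrm2_psum mM Lphi ortho N L1) nrm2BC; exact: (HN N (leqnn N)).
pose S := \sum_(j < N) lam j * coef j ^+ 2.
have S0 : 0 <= S by apply: sumr_ge0 => j _; rewrite mulr_ge0 ?sqr_ge0// ltW.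
move=> tailN.
have d0 : 0 < e / 2 / (S + 1) by rewrite divr_gt0// ltr_wpDl.
have H1 : \forall t \near (0 : R)^'+, t < e / 2 / (S + 1) by exact: nbhs_right_lt.
apply: filterS2 H1 (nbhs_right_gt (0 : R)) => t; rewrite ltr_pdivlMr ?ltr_wpDl// => td t0.
rewrite sub0r normrN ger0_norm ?nrm2_ge0//.
have Ld : L2 M (fun x => sol t x - 1) by apply: L2B => //; exact: Lsol.
have ce j : L2dot M (fun x => sol t x - 1) (phi j) ^+ 2 = (1 - expR (- (lam j * t))) ^+ 2 * coef j ^+ 2.
  rewrite L2dotBl//; last exact: Lsol.
  by rewrite (flim_coef j (s0 t0)) /damp -/(coef j); ring.
apply: le_lt_trans (_ : t * S + (nrm2 M (fun=> 1) - \sum_(j < N) coef j ^+ 2) < e); last first.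
  by move: td; rewrite mulrDr mulr1; lra.
apply: (parseval_le mM Lphi ortho dense Ld) => n.
pose F j := (1 - expR (- (lam j * t))) ^+ 2 * coef j ^+ 2.
have F0 j : 0 <= F j by rewrite mulr_ge0 ?sqr_ge0.
under eq_bigr do rewrite ce.
rewrite -(big_mkord xpredT F) -(big_mkord xpredT (fun j => coef j ^+ 2)).
pose m := maxn n N.
apply: (@le_trans _ _ (\sum_(0 <= j < m) F j)).
  by rewrite (big_cat_nat (leq0n n) (leq_maxl n N))//= lerDl sumr_ge0.
have Nm : (N <= m)%N by exact: leq_maxr.
rewrite (big_cat_nat (leq0n N) Nm)/=; apply: lerD.
  rewrite mulr_sumr big_mkord; apply: ler_sum => j _; rewrite /F [t * (lam j * _)]mulrA.
  apply: ler_wpM2r; first exact: sqr_ge0.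
  by rewrite [t * _]mulrC; apply: one_sub_expRN_sqr; rewrite mulr_ge0// ltW.
have b := bessel mM Lphi ortho m L1.
rewrite -(big_mkord xpredT (fun j => L2dot M (fun=> 1) (phi j) ^+ 2)) in b.
rewrite (big_cat_nat (leq0n N) Nm)/= in b.
rewrite lerBrDl; apply: le_trans b; rewrite lerD2l; apply: ler_sum => j _.
rewrite /F -[leRHS]mul1r; apply: ler_wpM2r; first exact: sqr_ge0.
have x0 : 0 <= lam j * t by rewrite mulr_ge0// ltW.
have ee := expR_gt0 (- (lam j * t)).
have e1 : expR (- (lam j * t)) <= 1 by rewrite -expR0 ler_expR oppr_le0.
by rewrite expr2; nra.
Qed.

(** Existence is what makes the choice in [heat_content] an actual solution. *)
Lemma sol_heat : heat_solution M sol.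
Proof.
split; last exact: sol_initial.
by move=> t t0; exists (dsol t); [exact: sol_dirichlet|exact: sol_derivative].
Qed.

(** Symmetry of the Dirichlet Laplacian turns the pairing of the time derivative with [phi j] into
    [- lam j] times the pairing of the solution itself. *)
Lemma heat_solution_coef u t j : heat_solution M u -> 0 < t ->
  L2dot M (u t) (phi j) = expR (- (lam j * t)) * coef j.
Proof.
move=> [Hu Hu0] t0; pose a (s : R) := L2dot M (u s) (phi j).
have Lu (s : R) : 0 < s -> L2 M (u s) by move=> s0'; have [v [[]]] := Hu _ s0'.
have da (s : R) : 0 < s -> is_derive s (1 : R) a (- (lam j * a s)).
  move=> sp; have [v Dv cv] := Hu _ sp.
  have [_ Lv _] := Dv.
  have vE : L2dot M v (phi j) = - (lam j * a s).
    rewrite (dirichlet_laplacian_sym mM fM Dv (eigen_dirichlet j)) L2dotC.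
    rewrite (L2dotNl mM (L2Z mM (lam j) (Lphi j)) (Lu _ sp)).
    by rewrite (L2dotZl mM _ (Lphi j) (Lu _ sp)) L2dotC.
  have near_pos : \forall h \near (0 : R)^', 0 < s + h.
    have : \forall h \near (0 : R)^', `|h| < s by exact: dnbhs0_lt.
    by apply: filterS => h; rewrite ltr_norml => /andP[]; lra.
  have Lq h : 0 < s + h -> L2 M (fun x => (u (s + h) x - u s x) / h).
    move=> sh; have := L2Z mM h^-1 (L2B mM (Lu _ sh) (Lu _ sp)).
    by apply: L2_ext => x _; rewrite mulrC.
  have near_L2 : \forall h \near (0 : R)^', L2 M (fun x => (u (s + h) x - u s x) / h).
    by apply: filterS near_pos => h; exact: Lq.
  have c1 := (cvg_L2dist2 mM near_L2 Lv).1 cv.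
  have c2 : L2dot M (fun x => (u (s + h) x - u s x) / h) (phi j) @[h --> (0 : R)^'] -->
      L2dot M v (phi j).
    by apply: (cvg_L2dot mM near_L2 Lv (Lphi j)); exact: c1.
  have c3 : (fun h : R => h^-1 *: (a (h *: 1 + s) - a s)) h @[h --> (0 : R)^'] --> (- (lam j * a s) : R).
    rewrite -vE; apply: cvg_trans c2; apply: near_eq_cvg.
    apply: filterS near_pos => h sh.
    have -> : h *: (1 : R) + s = s + h by rewrite /GRing.scale/= mulr1 addrC.
    rewrite /GRing.scale/= /a -(L2dotBl mM (Lu _ sh) (Lu _ sp) (Lphi j)).
    rewrite -(L2dotZl mM _ (L2B mM (Lu _ sh) (Lu _ sp)) (Lphi j)).
    by apply: L2dot_ext => // x _; rewrite mulrC.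
  by split; [apply/cvg_ex; eexists; exact: c3|exact: (cvg_lim _ c3)].
(* Integrating factor: this function has zero derivative for positive times. *)
pose E (s : R) := expR (lam j * s) * a s.
have dE (s : R) : 0 < s -> is_derive s (1 : R) E 0.
  move=> sp; have h1 := da s sp.
  have h2 : is_derive s (1 : R) (fun s => expR (lam j * s)) (expR (lam j * s) * lam j).
    apply: (@is_derive_comp1 R (fun s => lam j * s)).
    by apply: is_derive_eq; rewrite /GRing.scale/= mulr1.
  have h3 := is_deriveM h2 h1; apply: (is_derive_eq h3).
  by rewrite /GRing.scale/=; ring.
have Ec s : 0 < s -> s < t -> E s = E t.
  move=> sp st.
  have [||c _] := @MVT R E (fun=> 0) s t st.
  - by move=> x; rewrite in_itv/= => /andP[sx _]; apply: dE; exact: lt_trans sx.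
  - apply: derivable_within_continuous => x; rewrite in_itv/= => /andP[sx _].
    by have [] := dE x (lt_le_trans sp sx).
  - by rewrite mul0r => /eqP; rewrite subr_eq0 => /eqP ->.
have near_L2 : \forall s \near (0 : R)^'+, L2 M (u s).
  by apply: filterS (nbhs_right_gt (0 : R)) => s; exact: Lu.
have c1 : L2dot M (u s) (phi j) @[s --> (0 : R)^'+] --> L2dot M (fun=> 1) (phi j).
  by apply: (cvg_L2dot mM near_L2 L1 (Lphi j)); exact: (cvg_L2dist2 mM near_L2 L1).1 Hu0.
(* The initial condition is only a one-sided limit, so [E], which equals [E t] before [t], is
   identified through its limit at 0. *)
have c2 : E s @[s --> (0 : R)^'+] --> (expR (lam j * 0) * coef j : R).
  apply: cvgM => //.
  apply: cvg_at_right_filter; apply: continuous_cvg; first exact: continuous_expR.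
  by apply: cvgM; [exact: cvg_cst|exact: cvg_id].
have c3 : E s @[s --> (0 : R)^'+] --> (E t : R).
  apply: cvg_near_cst; apply: filterS2 (nbhs_right_gt (0 : R)) (nbhs_right_lt t0) => s.
  exact: Ec.
have EE : E t = expR (lam j * 0) * coef j by exact: (cvg_unique (@Rhausdorff R) c3 c2).
rewrite -/(a t); move: EE; rewrite /E mulr0 expR0 mul1r => <-.
by rewrite mulrA -expRD addNr expR0 mul1r.
Qed.

Lemma heat_content_cvg t : 0 < t ->
  \sum_(j < n) expR (- (lam j * t)) * coef j ^+ 2 @[n --> \oo] --> heat_content M t.
Proof.
move=> t0; rewrite /heat_content.
(* Without a solution [xget] would return the zero default. *)
have Hu : heat_solution M (xget (fun _ _ => 0) (heat_solution M)).
  by apply: xgetPex; exists sol; exact: sol_heat.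
set u := xget _ _ in Hu *.
have Lu : L2 M (u t) by have [/(_ _ t0)[v [[]]]] := Hu.
have -> : \int[mu]_(x in M) u t x = L2dot M (u t) (fun=> 1).
  by apply: eq_Rintegral => x _; rewrite mulr1.
have h := parseval mM Lphi ortho dense Lu L1.
have E n : \sum_(j < n) expR (- (lam j * t)) * coef j ^+ 2 =
    \sum_(j < n) L2dot M (u t) (phi j) * L2dot M (fun=> 1) (phi j).
  by apply: eq_bigr => j _; rewrite (heat_solution_coef j Hu t0) expr2 mulrA.
by rewrite (funext E).
Qed.

(** All terms of the series are nonnegative. Beyond the first each carries at most
    [expR (- (L * t))], and Bessel bounds the sum of the squared coefficients by the area. *)
Lemma heat_content_leading (L : R) (t : R) : 0 < t ->
  (forall j, (0 < j)%N -> L <= lam j) ->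
  0 <= heat_content M t - expR (- (lam 0%N * t)) * coef 0%N ^+ 2 <=
    nrm2 M (fun=> 1) * expR (- (L * t)).
Proof.
move=> t0 hL; have h := heat_content_cvg t0.
pose a j := expR (- (lam j * t)) * coef j ^+ 2.
have a0 j : 0 <= a j by rewrite mulr_ge0 ?sqr_ge0 ?expR_ge0.
have e0 : 0 <= expR (- (L * t)) by exact: expR_ge0.
have tail n : 0 <= \sum_(j < n.+1) a j - a 0%N <= nrm2 M (fun=> 1) * expR (- (L * t)).
  rewrite big_ord_recl/= [a 0%N + _]addrC addrK sumr_ge0//=.
  have b := bessel mM Lphi ortho n.+1 L1.
  apply: le_trans (ler_wpM2r e0 b).
  rewrite big_ord_recl/= mulrDl mulr_suml; apply: ler_wpDl; first by rewrite mulr_ge0 ?sqr_ge0.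
  apply: ler_sum => j _; rewrite /a mulrC; apply: ler_wpM2l; first exact: sqr_ge0.
  by rewrite ler_expR lerN2; apply: ler_wpM2r; [exact: ltW|exact: hL].
have c : (\sum_(j < n.+1) a j - a 0%N) @[n --> \oo] --> (heat_content M t - a 0%N : R).
  apply: cvgB; last exact: cvg_cst.
  by move: h; rewrite -(cvg_shiftS (fun n => \sum_(j < n) a j)).
have cc : cvgn (fun n => \sum_(j < n.+1) a j - a 0%N) by apply/cvg_ex; eexists; exact: c.
rewrite -/(a 0%N) -(cvg_lim (@Rhausdorff R) c); apply/andP; split.
  by apply: limr_ge => //; apply: nearW => n; have /andP[] := tail n.
by apply: limr_le => //; apply: nearW => n; have /andP[] := tail n.
Qed.

Lemma dirichlet_eigenvalues_of_basis : nondecreasing_seq lam ->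
  dirichlet_eigenvalues M lam.
Proof.
move=> mono; split => //; exists phi; last exact: eigen_dirichlet.
exact: (orthonormal_basis_of_dense mM Lphi ortho dense).
Qed.

End heat.

(** * Eigenfunctions of rectangles and triangles *)

Section elementary_theory.
Variable R : realType.
Implicit Types f g : R * R -> R.

Lemma elementaryZ c f : elementary f -> elementary (fun x => c * f x).
Proof. exact/elementaryM/elementary_cst. Qed.

Lemma elementaryB f g : elementary f -> elementary g -> elementary (fun x => f x - g x).
Proof.
move=> ef eg; have := elementaryD ef (elementaryZ (-1) eg).
by congr elementary; apply/funext => x; rewrite mulN1r.
Qed.

Lemma elementary_pair f g1 g2 : elementary f -> elementary g1 -> elementary g2 ->
  elementary (fun x => f (g1 x, g2 x)).
Proof.
move=> ef e1 e2; elim: ef => {f} [c||| f g _ IHf _ IHg | f g _ IHf _ IHg | h f sh _ IHf] /=.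
- exact: elementary_cst.
- exact: e1.
- exact: e2.
- exact: elementaryD.
- exact: elementaryM.
- exact: elementary_comp.
Qed.

Lemma elementary_affine (a b c : R) : elementary (fun x => a * x.1 + b * x.2 + c).
Proof.
apply: elementaryD; last exact: elementary_cst.
by apply: elementaryD; apply: elementaryZ; [exact: elementary_fst|exact: elementary_snd].
Qed.

Lemma elementary_horner (p : {poly R}) f : elementary f -> elementary (fun x => p.[f x]).
Proof.
move=> ef; elim/poly_ind: p => [|p c IH].
  have -> : (fun x => (0 : {poly R}).[f x]) = (fun=> 0) by apply/funext => x; rewrite horner0.
  exact: elementary_cst.
have -> : (fun x => (p * 'X + c%:P).[f x]) = (fun x => p.[f x] * f x + c).
  by apply/funext => x; rewrite !hornerE.
by apply: elementaryD; [exact: elementaryM|exact: elementary_cst].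
Qed.

(** Divisibility of [p(a) - p(b)] by [a - b], with a quotient that stays elementary. It extracts the
    factor vanishing on the diagonal from the triangle functions. *)
Lemma elementary_divided_difference (p : {poly R}) f g : elementary f -> elementary g ->
  exists2 V, elementary V & forall x, p.[f x] - p.[g x] = (f x - g x) * V x.
Proof.
move=> ef eg; elim/poly_ind: p => [|p c [V eV IH]].
  exists (fun=> 0); first exact: elementary_cst.
  by move=> x; rewrite !horner0 subrr mulr0.
exists (fun x => f x * V x + p.[g x]).
  by apply: elementaryD; [exact: elementaryM|exact: elementary_horner].
move=> x; rewrite !hornerE.
have -> : p.[f x] * f x + c - (p.[g x] * g x + c) =
  f x * (p.[f x] - p.[g x]) + p.[g x] * (f x - g x) by ring.
by rewrite IH; ring.
Qed.

(** These are the Chebyshev polynomials of the second kind; the recursion has two terms, hence the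
    paired induction. *)
Lemma sin_natmul_poly n : exists p : {poly R}, forall x, sin (n.+1%:R * x) = sin x * p.[cos x].
Proof.
suff [] : (exists p : {poly R}, forall x, sin (n.+1%:R * x) = sin x * p.[cos x]) /\
  (exists p : {poly R}, forall x, sin (n%:R * x) = sin x * p.[cos x]) by [].
elim: n => [|n [[p Hp] [q Hq]]].
  split; first by exists 1 => x; rewrite hornerC mulr1 mul1r.
  by exists 0 => x; rewrite horner0 mulr0 mul0r sin0.
split; last by exists p.
exists (2%:P * 'X * p - q) => x; rewrite !hornerE.
have h : sin (n.+2%:R * x) = 2 * (cos x * sin (n.+1%:R * x)) - sin (n%:R * x).
  by rewrite cos_mul_sin; field.
by rewrite h Hp Hq; ring.
Qed.

End elementary_theory.

(** * The two model domains with side [pi] *)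

Section sine_models.
Variable R : realType.
Local Notation mu := (@leb2 R).

(* [d] plays the role of a boundary-defining function, through which every
   element of the system factors. *)
Record sine_model (S0 : set (R * R)) (e : nat * nat -> R * R -> R) : Prop := SineModel {
  model_open : open S0;
  model_Qpi : S0 `<=` @Qpi R;
  model_factor : exists C d, [/\ compact C, S0 `<=` C, elementary d &
    [/\ forall z, S0 z -> 0 < d z, forall z, C z -> ~ S0 z -> d z = 0 &
      forall i, exists2 U, elementary U & e i = (fun z => d z * U z)]];
  model_ortho : forall i j, L2dot S0 (e i) (e j) = (i == j)%:R * (pi / 2) ^+ 2;
  model_dense : forall f, L2 S0 f -> L2_approx S0 e f
}.

Let sin_fst : elementary (fun z : R * R => sin z.1).
Proof. by apply: (elementary_comp (@smooth1_sin R)); exact: elementary_fst. Qed.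
Let sin_snd : elementary (fun z : R * R => sin z.2).
Proof. by apply: (elementary_comp (@smooth1_sin R)); exact: elementary_snd. Qed.
Let cos_fst : elementary (fun z : R * R => cos z.1).
Proof. by apply: (elementary_comp (@smooth1_cos R)); exact: elementary_fst. Qed.
Let cos_snd : elementary (fun z : R * R => cos z.2).
Proof. by apply: (elementary_comp (@smooth1_cos R)); exact: elementary_snd. Qed.

Let Cbox : set (R * R) := `[0, pi]%classic `*` `[0, pi]%classic.
Let compact_Cbox : compact Cbox.
Proof. by apply: compact_setX; exact: segment_compact. Qed.

Let inQ z : @Qpi R z -> (0 < z.1 < pi) /\ (0 < z.2 < pi).
Proof. by move=> [/=]; rewrite !in_itv. Qed.

Lemma Qpi_open : open (@Qpi R).
Proof.
rewrite openE => z [z1 z2]; exists (`]0, pi[%classic, `]0, pi[%classic) => //=.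
by split; apply: open_nbhs_nbhs; split => //; exact: interval_open.
Qed.

Lemma esin_model : sine_model (@Qpi R) (@esin R).
Proof.
split.
- exact: Qpi_open.
- by [].
- exists Cbox, (fun z => sin z.1 * sin z.2); split => //.
  + move=> z /inQ[/andP[a b] /andP[c d]]; split => /=; rewrite in_itv/= !ltW//.
  + exact: elementaryM.
  split.
  + by move=> z /inQ[h1 h2]; rewrite mulr_gt0// sin_gt0_pi.
  + move=> z [/=]; rewrite !in_itv/= => /andP[a b] /andP[c d] nQ.
    have [z10|z10] := eqVneq z.1 0; first by rewrite z10 sin0 mul0r.
    have [z1p|z1p] := eqVneq z.1 pi; first by rewrite z1p sinpi mul0r.
    have [z20|z20] := eqVneq z.2 0; first by rewrite z20 sin0 mulr0.
    have [z2p|z2p] := eqVneq z.2 pi; first by rewrite z2p sinpi mulr0.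
    by exfalso; apply: nQ; split; rewrite /= in_itv/= !lt_neqAle [0 == _]eq_sym
      ?a ?b ?c ?d ?z10 ?z20 ?z1p ?z2p.
  + move=> [m n]; have [p Hp] := sin_natmul_poly R m; have [q Hq] := sin_natmul_poly R n.
    exists (fun z => p.[cos z.1] * q.[cos z.2]).
      by apply: elementaryM; apply: elementary_horner.
    by apply/funext => z; rewrite /esin/= Hp Hq; ring.
- exact: esin_ortho.
- exact: sine_dense.
Qed.

Lemma etri_model : sine_model (@Tpi R) (@etri R).
Proof.
split.
- exact: Tpi_open.
- exact: Tpi_Qpi.
- pose C := Cbox `&` [set z | 0 <= z.1 - z.2].
  (* The three factors vanish on the sides [x = pi], [y = 0] and [x = y]; the last is positive
     inside because [cos] decreases. *)
  exists C, (fun z => sin z.1 * sin z.2 * (cos z.2 - cos z.1)); split => //.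
  + apply: compact_closedI => //.
    have -> : [set z : R * R | 0 <= z.1 - z.2] = (fun z : R * R => z.1 - z.2) @^-1` [set y | 0 <= y] by [].
    apply: closed_comp; last exact: closed_ge.
    by move=> z _; apply: elementary_continuous; apply: elementaryB; [exact: elementary_fst|exact: elementary_snd].
  + move=> z Tz; have /inQ[/andP[a b] /andP[c d]] := Tpi_Qpi Tz.
    by case: Tz => _ h _; split; [split; rewrite /= in_itv/= !ltW|rewrite /= subr_ge0 ltW].
  + by apply: elementaryM; [exact: elementaryM|exact: elementaryB].
  split.
  + move=> z Tz; have /inQ[a b] := Tpi_Qpi Tz.
    case: Tz => _ h _; rewrite !mulr_gt0 ?sin_gt0_pi// subr_gt0.
    by case/andP: a => a1 a2; case/andP: b => b1 b2; rewrite ltr_cos ?in_itv/= ?(ltW a1) ?(ltW b1) ?ltW.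
  + move=> z [[/=]]; rewrite !in_itv/= subr_ge0 => /andP[a b] /andP[c d] h nQ.
    have [z1p|z1p] := eqVneq z.1 pi; first by rewrite z1p sinpi !mul0r.
    have [z20|z20] := eqVneq z.2 0; first by rewrite z20 sin0 mulr0 mul0r.
    have [z12|z12] := eqVneq z.2 z.1; first by rewrite z12 subrr mulr0.
    exfalso; apply: nQ; split; rewrite lt_neqAle ?b ?c ?h ?z1p ?z12//.
    by rewrite eq_sym z20.
  + move=> [a b]; pose m := (a + b.+1)%N.
    have [p Hp] := sin_natmul_poly R m; have [q Hq] := sin_natmul_poly R a.
    have [V eV HV] := elementary_divided_difference p cos_fst cos_snd.
    have [W eW HW] := elementary_divided_difference q cos_fst cos_snd.
    (* Adding and subtracting [p q] at [cos z.2] writes the antisymmetric combination with the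
       differences [p.[cos z.1] - p.[cos z.2]] and the same for [q]. The signs account for [d]
       containing [cos z.2 - cos z.1]. *)
    exists (fun z => W z * p.[cos z.2] - V z * q.[cos z.2]).
      by apply: elementaryB; apply: elementaryM => //; apply: elementary_horner.
    apply/funext => z; rewrite /etri /esin/= -/m !Hp !Hq.
    have -> : sin z.1 * p.[cos z.1] * (sin z.2 * q.[cos z.2]) -
      sin z.1 * q.[cos z.1] * (sin z.2 * p.[cos z.2]) = sin z.1 * sin z.2 *
      ((p.[cos z.1] - p.[cos z.2]) * q.[cos z.2] - (q.[cos z.1] - q.[cos z.2]) * p.[cos z.2]) by ring.
    by rewrite HV HW; ring.
- exact: etri_ortho.
- exact: tri_dense.
Qed.

End sine_models.

(** * Eigenfunctions of one component under a rigid motion and scaling *)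

Section local_system.
Variable R : realType.
Local Notation mu := (@leb2 R).

(** Eigenfunctions of the component [S], extended by 0: the boundary condition and the equation are
    stated on [M], orthonormality and density on [S]. The gradient bound is relative to the
    eigenvalue, as needed to normalize the gradient series. *)
Record local_system (M S : set (R * R)) (I : eqType) (phi : I -> R * R -> R)
    (g : I -> bool -> R * R -> R) (lam : I -> R) (B : R) : Prop := LocalSystem {
  local_grad : forall i, H10_grad M (phi i) (g i);
  local_weak : forall i psi, test_function M psi ->
    L2dot M (phi i) (laplacian psi) = L2dot M (fun x => - (lam i * phi i x)) psi;
  local_out : forall i x, ~ S x -> phi i x = 0;
  local_ortho : forall i j, L2dot S (phi i) (phi j) = (i == j)%:R;
  local_dense : forall f, L2 S f -> L2_approx S phi f;
  local_bound : forall i x, `|phi i x| <= B;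
  local_grad_bound : forall i b x, `|g i b x| <= B * lam i
}.

Variables (S0 : set (R * R)) (e : nat * nat -> R * R -> R).
Hypothesis model : sine_model S0 e.
Variables (p v w : R * R) (alpha beta : R).
Hypothesis frame : orthonormal_frame v w.
Hypotheses (alpha0 : 0 < alpha) (beta0 : 0 < beta).

Let v2 : v.1 ^+ 2 + v.2 ^+ 2 = 1. Proof. by case: frame; rewrite /dot2 !expr2. Qed.
Let w2 : w.1 ^+ 2 + w.2 ^+ 2 = 1. Proof. by case: frame; rewrite /dot2 !expr2. Qed.
Let vw : v.1 * w.1 + v.2 * w.2 = 0. Proof. by case: frame. Qed.
(** The determinant of the frame, which is 1 or -1 since reflected frames are allowed; [w] is [d]
    times [v] turned by a right angle. *)
Let d := v.1 * w.2 - v.2 * w.1.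
Let d2 : d ^+ 2 = 1.
Proof.
have -> : d ^+ 2 = (v.1 ^+ 2 + v.2 ^+ 2) * (w.1 ^+ 2 + w.2 ^+ 2) - (v.1 * w.1 + v.2 * w.2) ^+ 2.
  by rewrite /d; ring.
by rewrite v2 w2 vw; ring.
Qed.
Let w1E : w.1 = - (d * v.2).
Proof.
have : d * v.2 + w.1 * (v.1 ^+ 2 + v.2 ^+ 2) - v.1 * (v.1 * w.1 + v.2 * w.2) = 0 by rewrite /d; ring.
by rewrite v2 vw mulr0 mulr1 subr0 => /eqP; rewrite addrC addr_eq0 => /eqP.
Qed.
Let w2E : w.2 = d * v.1.
Proof.
have : d * v.1 - w.2 * (v.1 ^+ 2 + v.2 ^+ 2) + v.2 * (v.1 * w.1 + v.2 * w.2) = 0 by rewrite /d; ring.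
by rewrite v2 vw mulr0 mulr1 addr0 => /eqP; rewrite subr_eq0 => /eqP.
Qed.

Definition frame_map (z : R * R) : R * R :=
  (alpha * v.1 * z.1 + beta * w.1 * z.2 + p.1, alpha * v.2 * z.1 + beta * w.2 * z.2 + p.2).

Definition frame_coord1 (x : R * R) : R :=
  v.1 / alpha * x.1 + v.2 / alpha * x.2 + - dot2 p v / alpha.
Definition frame_coord2 (x : R * R) : R :=
  w.1 / beta * x.1 + w.2 / beta * x.2 + - dot2 p w / beta.
Definition frame_inv (x : R * R) : R * R := (frame_coord1 x, frame_coord2 x).

Lemma frame_mapE z : frame_map z = p + (alpha * z.1) *: v + (beta * z.2) *: w.
Proof.
by apply/pair_equal_spec; split; rewrite /= /GRing.scale/=; ring.
Qed.

Lemma frame_mapK : cancel frame_map frame_inv.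
Proof.
have [an bn] : alpha != 0 /\ beta != 0 by rewrite !gt_eqF.
move=> [z1 z2]; apply/pair_equal_spec; split; rewrite /frame_coord1 /frame_coord2 /dot2 /=.
  have -> : v.1 / alpha * (alpha * v.1 * z1 + beta * w.1 * z2 + p.1) +
    v.2 / alpha * (alpha * v.2 * z1 + beta * w.2 * z2 + p.2) + - (p.1 * v.1 + p.2 * v.2) / alpha =
    (v.1 ^+ 2 + v.2 ^+ 2) * z1 + beta / alpha * (v.1 * w.1 + v.2 * w.2) * z2 by field.
  by rewrite v2 vw mulr0 mul0r mul1r addr0.
have -> : w.1 / beta * (alpha * v.1 * z1 + beta * w.1 * z2 + p.1) +
  w.2 / beta * (alpha * v.2 * z1 + beta * w.2 * z2 + p.2) + - (p.1 * w.1 + p.2 * w.2) / beta =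
  alpha / beta * (v.1 * w.1 + v.2 * w.2) * z1 + (w.1 ^+ 2 + w.2 ^+ 2) * z2 by field.
by rewrite w2 vw mulr0 mul0r mul1r add0r.
Qed.

Lemma frame_invK : cancel frame_inv frame_map.
Proof.
have [an bn] : alpha != 0 /\ beta != 0 by rewrite !gt_eqF.
move=> [x1 x2]; apply/pair_equal_spec; split;
  rewrite /= /frame_coord1 /frame_coord2 /dot2 /= w1E w2E.
  transitivity ((v.1 ^+ 2 + d ^+ 2 * v.2 ^+ 2) * (x1 - p.1) + v.1 * v.2 * (1 - d ^+ 2) * (x2 - p.2) + p.1).
    by field; rewrite an bn.
  by rewrite d2 mul1r v2; ring.
transitivity ((v.2 ^+ 2 + d ^+ 2 * v.1 ^+ 2) * (x2 - p.2) + v.1 * v.2 * (1 - d ^+ 2) * (x1 - p.1) + p.2).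
  by field; rewrite an bn.
by rewrite d2 mul1r [v.2 ^+ 2 + _]addrC v2; ring.
Qed.

Lemma frame_det : `|alpha * v.1 * (beta * w.2) - beta * w.1 * (alpha * v.2)| = alpha * beta.
Proof.
have -> : alpha * v.1 * (beta * w.2) - beta * w.1 * (alpha * v.2) = alpha * beta * d.
  by rewrite /d; ring.
have d1 : `|d| = 1.
  apply/eqP; rewrite -(@eqrXn2 _ 2)// ?normr_ge0// expr1n.
  by rewrite real_normK ?num_real// d2.
by rewrite normrM d1 mulr1 gtr0_norm// mulr_gt0.
Qed.

Lemma elementary_frame_inv f : elementary f -> elementary (fun x => f (frame_inv x)).
Proof. by move=> ef; apply: elementary_pair => //; exact: elementary_affine. Qed.

Lemma frame_map_continuous : continuous frame_map.
Proof.
move=> z; apply: (@cvg_pair _ _ _ _ (nbhs (frame_map z).1) (nbhs (frame_map z).2)).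
  exact: (elementary_continuous (elementary_affine _ _ _)).
exact: (elementary_continuous (elementary_affine _ _ _)).
Qed.

Variables (M S T : set (R * R)).
Hypotheses (oS : open S) (oT : open T) (dST : S `&` T = set0) (MST : M = S `|` T).
Hypothesis fM : (mu M < +oo)%E.
Hypothesis SE : forall z, S (frame_map z) <-> S0 z.

Let mM : measurable (M : set (borel_plane R)).
Proof. by apply: open_measurable2; rewrite MST; exact: openU. Qed.
Let mS : measurable (S : set (borel_plane R)). Proof. exact: open_measurable2. Qed.
Let mS0 : measurable (S0 : set (borel_plane R)).
Proof. by apply: open_measurable2; exact: model_open model. Qed.
Let SM : S `<=` M. Proof. by rewrite MST; exact: subsetUl. Qed.

Let SE' x : S x <-> S0 (frame_inv x).
Proof. by rewrite -SE frame_invK. Qed.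

Let det0 : alpha * v.1 * (beta * w.2) - beta * w.1 * (alpha * v.2) != 0.
Proof. by rewrite -normr_gt0 frame_det mulr_gt0. Qed.

(** Normalizes the transported functions: on the model the squared norm is [(pi / 2) ^+ 2], and the
    Jacobian contributes [alpha * beta]. *)
Definition frame_cst : R := 2 / (pi * Num.sqrt (alpha * beta)).

Lemma frame_cst_gt0 : 0 < frame_cst.
Proof. by rewrite divr_gt0// mulr_gt0 ?pi_gt0// sqrtr_gt0 mulr_gt0. Qed.

Lemma frame_cst_sqr : frame_cst ^+ 2 = 4 / (pi ^+ 2 * (alpha * beta)).
Proof.
rewrite /frame_cst expr_div_n exprMn sqr_sqrtr; last by rewrite ltW ?mulr_gt0.
by congr (_ / _); ring.
Qed.

Definition frame_fun i x := frame_cst * e i (frame_inv x).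

Let ee i : elementary (e i).
Proof.
have [C [d' [_ _ ed [_ _ /(_ i)[U eU ->]]]]] := model_factor model.
exact: elementaryM.
Qed.

Lemma frame_fun_elementary i : elementary (frame_fun i).
Proof. by apply: elementaryZ; exact: elementary_frame_inv. Qed.

Variables (lam : nat * nat -> R) (B : R).
Hypothesis eig : forall i x,
  laplacian (fun x => e i (frame_inv x)) x = - (lam i * e i (frame_inv x)).
Hypothesis eB : forall i z, `|e i z| <= B.
Hypothesis eDB : forall i b x, `|'D_(evec R b) (fun x => e i (frame_inv x)) x| <= B * lam i.

Let phi i := frame_fun i \_ S.
Let g i b := ('D_(evec R b) (frame_fun i)) \_ S.

(** Both factors of the model function are transported by the inverse frame map, and the image of
    [C] is the compact set on which the transported [d'] vanishes off [S]. *)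
Let phi_grad i : H10_grad M (phi i) (g i).
Proof.
have [C [d' [cC SC ed [dpos d0 /(_ i)[U eU eE]]]]] := model_factor model.
have fE : frame_fun i = (fun x => d' (frame_inv x) * (frame_cst * U (frame_inv x))).
  by apply/funext => x; rewrite /frame_fun eE /= mulrCA.
rewrite /phi /g fE.
apply: (@H10_grad_cutoff R M S (frame_map @` C)) => //.
- apply: continuous_compact => //; apply: continuous_subspaceT; exact: frame_map_continuous.
- by move=> x /SE' Sx; exists (frame_inv x); [exact: SC|exact: frame_invK].
- by move=> x /SE' /dpos.
- by move=> _ [z Cz <-] nS; rewrite frame_mapK d0// => /SE.
- exact: elementary_frame_inv.
- by apply: elementaryZ; exact: elementary_frame_inv.
Qed.

Let phi_weak i psi : test_function M psi ->
    L2dot M (phi i) (laplacian psi) = L2dot M (fun x => - (lam i * phi i x)) psi.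
Proof.
apply: (@weak_eigenfunction R M S T oS oT dST MST (frame_fun i) (lam i)).
  by apply: elementary_smooth; exact: frame_fun_elementary.
move=> x; have se b : smooth ('D_(evec R b) (fun x => e i (frame_inv x))).
  by apply: smooth_derive; apply: elementary_smooth; exact: elementary_frame_inv.
have DD b : 'D_(evec R b) ('D_(evec R b) (frame_fun i)) x =
    frame_cst * 'D_(evec R b) ('D_(evec R b) (fun x => e i (frame_inv x))) x.
  have -> : 'D_(evec R b) (frame_fun i) =
      (fun x => frame_cst * 'D_(evec R b) (fun x => e i (frame_inv x)) x).
    apply/funext => y; apply: smooth_deriveZ.
    by apply: elementary_smooth; exact: elementary_frame_inv.
  exact: smooth_deriveZ.
apply: etrans (congr2 +%R (DD true) (DD false)) _.
apply: etrans (esym (mulrDr _ _ _)) _.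
by apply: etrans (congr1 ( *%R frame_cst) (eig i x)) _; rewrite /frame_fun; ring.
Qed.

Let phi_map i z : S0 z -> phi i (frame_map z) = frame_cst * e i z.
Proof. by move=> /SE Sz; rewrite /phi restrict_in// /frame_fun frame_mapK. Qed.

Let LM i : L2 M (phi i). Proof. by case: (phi_grad i). Qed.
Let LS i : L2 S (phi i). Proof. by have [] := nrm2_sub mS mM SM (LM i). Qed.

Let S0fin : (mu S0 < +oo)%E.
Proof.
apply: le_lt_trans (@Qpi_fin R); apply: le_measure; rewrite ?inE//.
- exact: Qpi_measurable.
- exact: model_Qpi model.
Qed.

Let Le i : L2 S0 (e i).
Proof.
apply: (bounded_L2 (C := B)) => //.
by apply: continuous_measurable2S; apply: elementary_continuous.
Qed.

Let pi0 : (pi : R) != 0. Proof. by rewrite gt_eqF ?pi_gt0. Qed.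

Let phi_ortho i j : L2dot S (phi i) (phi j) = (i == j)%:R.
Proof.
rewrite (@L2dot_linear R _ _ _ _ p.1 p.2 det0 S S0)// frame_det.
have -> : L2dot S0 (fun z => phi i (frame_map z)) (fun z => phi j (frame_map z)) =
    frame_cst ^+ 2 * L2dot S0 (e i) (e j).
  transitivity (L2dot S0 (fun z => frame_cst * e i z) (fun z => frame_cst * e j z)).
    by apply: L2dot_ext => // z S0z; rewrite phi_map.
  by rewrite L2dotZl ?L2dotZr//; [ring|exact: L2Z].
rewrite (model_ortho model) frame_cst_sqr.
by move: (pi : R) pi0 => P P0; field; rewrite P0 !gt_eqF.
Qed.

Let phi_dense f : L2 S f -> L2_approx S phi f.
Proof.
move=> Lf; split => // eps eps0.
have ab0 : 0 < alpha * beta by rewrite mulr_gt0.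
have Lf0 : L2 S0 (fun z => f (frame_map z)) by exact: (@L2_linear R _ _ _ _ p.1 p.2 det0 S S0).
have [_ /(_ (eps / (alpha * beta)))[|h sh hh]] := model_dense model Lf0.
  by rewrite divr_gt0.
have [k sk kE] : exists2 k, lin_span phi k & forall z, S0 z -> k (frame_map z) = h z.
  elim: sh {hh} => [|a i h' _ [k sk kE]]; first by exists (fun=> 0); [exact: span0|].
  exists (fun x => (a / frame_cst) * phi i x + k x); first exact: spanS.
  move=> z S0z; rewrite kE// phi_map//.
  by rewrite mulrA divfK// gt_eqF// frame_cst_gt0.
exists k => //; have Lk := span_L2 mS LS sk.
rewrite (@nrm2_linear R _ _ _ _ p.1 p.2 det0 S S0)//; last exact: L2B.
rewrite frame_det mulrC -ltr_pdivlMr//; apply: le_lt_trans hh.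
rewrite le_eqVlt; apply/orP; left; apply/eqP; apply: L2dot_ext => // z S0z;
  by rewrite -(kE z S0z).
Qed.

Lemma frame_local_system :
  local_system M S phi g lam (frame_cst * B).
Proof.
have c0 := ltW frame_cst_gt0.
split.
- exact: phi_grad.
- exact: phi_weak.
- by move=> i x; exact: restrict_out.
- exact: phi_ortho.
- exact: phi_dense.
- move=> i x; have [Sx|Sx] := pselect (S x).
    by rewrite /phi restrict_in// normrM ger0_norm// ler_wpM2l.
  rewrite /phi restrict_out// normr0 mulr_ge0//.
  exact: le_trans (eB i x).
- move=> i b x; have [Sx|Sx] := pselect (S x).
    rewrite /g restrict_in//.
    have -> : 'D_(evec R b) (frame_fun i) x = frame_cst * 'D_(evec R b) (fun x => e i (frame_inv x)) x.
      by apply: smooth_deriveZ; apply: elementary_smooth; exact: elementary_frame_inv.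
    by rewrite normrM ger0_norm// -mulrA ler_wpM2l.
  rewrite /g restrict_out// normr0 -mulrA mulr_ge0//.
  exact: le_trans (eDB i b x).
Qed.

(** The Jacobian enters squared through the integral and inversely through [frame_cst ^+ 2]. *)
Lemma frame_coef i : L2dot M (fun=> 1) (phi i) ^+ 2 =
  4 * (alpha * beta) / pi ^+ 2 * (\int[mu]_(z in S0) e i z) ^+ 2.
Proof.
have mT : measurable (T : set (borel_plane R)) by exact: open_measurable2.
have L1 : L2 M (fun=> 1) by exact: L2_cst.
rewrite MST (L2dot_setU mS mT dST); rewrite -?MST//.
have -> : L2dot T (fun=> 1) (phi i) = 0.
  rewrite -(L2dotC T) -[RHS](mul0r 1) /L2dot.
  rewrite (@eq_Rintegral _ _ _ mu T (fun=> 0)) ?Rintegral_cst ?mul0r// => x /set_mem Tx.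
  rewrite /phi restrict_out ?mul0r// => Sx.
  by have : (S `&` T) x by []; rewrite dST.
rewrite addr0.
have L1S : L2 S (fun=> 1) by have [] := nrm2_sub mS mM SM L1.
rewrite (@L2dot_linear R _ _ _ _ p.1 p.2 det0 S S0)// frame_det.
have -> : L2dot S0 (fun=> 1) (fun z => phi i (frame_map z)) = frame_cst * \int[mu]_(z in S0) e i z.
  transitivity (L2dot S0 (fun z => frame_cst * e i z) (fun=> 1)).
    by rewrite L2dotC; apply: L2dot_ext => // z S0z; rewrite phi_map.
  rewrite L2dotZl//; last exact: L2_cst.
  by congr (_ * _); apply: eq_Rintegral => z _; rewrite mulr1.
rewrite exprMn [(frame_cst * _) ^+ 2]exprMn frame_cst_sqr; move: (pi : R) pi0 => P P0; field.
by rewrite P0 !gt_eqF.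
Qed.

End local_system.

(** * Derivatives of product waves in a rotated frame *)

Section waves.
Variable R : realType.
Local Notation mu := (@leb2 R).
Variables (p v w : R * R) (alpha beta : R).
Hypothesis frame : orthonormal_frame v w.
Hypotheses (alpha0 : 0 < alpha) (beta0 : 0 < beta).
Local Notation l1 := (frame_coord1 p v alpha).
Local Notation l2 := (frame_coord2 p w beta).

Let comp (b : bool) (x : R * R) : R := if b then x.1 else x.2.

Lemma derive_affine b (a1 a2 c : R) x :
  'D_(evec R b) (fun y : R * R => a1 * y.1 + a2 * y.2 + c) x = if b then a1 else a2.
Proof.
have s1 := elementary_smooth (elementary_fst R).
have s2 := elementary_smooth (elementary_snd R).
have s1' := smoothM (smooth_cst a1) s1; have s2' := smoothM (smooth_cst a2) s2.
apply: etrans (smooth_deriveD _ _ (smoothD s1' s2') (smooth_cst c)) _.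
rewrite derive_cst addr0; apply: etrans (smooth_deriveD _ _ s1' s2') _.
apply: etrans (congr2 +%R (smooth_deriveZ a1 _ _ s1) (smooth_deriveZ a2 _ _ s2)) _.
by rewrite derive_fst derive_snd; case: b => /=; ring.
Qed.

(** Both profiles are parameters, so that partial derivatives of waves are again combinations of
    waves. *)
Definition wave (h k : R -> R) (m n : R) (x : R * R) : R := h (m * l1 x) * k (n * l2 x).

Let smooth_scaled (h : R -> R) m l : smooth1 h -> elementary l ->
  smooth (fun x => h (m * l x)).
Proof.
by move=> sh el; apply: elementary_smooth; apply: elementary_comp => //; exact: elementaryZ.
Qed.

Let el1 : elementary l1. Proof. exact: elementary_affine. Qed.
Let el2 : elementary l2. Proof. exact: elementary_affine. Qed.

Lemma smooth_wave h k m n : smooth1 h -> smooth1 k -> smooth (wave h k m n).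
Proof. by move=> sh sk; apply: smoothM; exact: smooth_scaled. Qed.

Lemma derive_wave b h k m n x : smooth1 h -> smooth1 k ->
  'D_(evec R b) (wave h k m n) x =
  m * (comp b v / alpha) * wave (derive1 h) k m n x + n * (comp b w / beta) * wave h (derive1 k) m n x.
Proof.
move=> sh sk.
have ds (f : R -> R) (c : R) l a : smooth1 f -> elementary l -> 'D_(evec R b) l x = a ->
    'D_(evec R b) (fun y => f (c * l y)) x = derive1 f (c * l x) * (c * a).
  move=> sf el <-; have sl := elementary_smooth el.
  apply: etrans (smooth_derive_comp1 _ _ sf (smoothM (smooth_cst c) sl)) _.
  by congr (_ * _); exact: smooth_deriveZ.
apply: etrans (smooth_deriveM _ _ (smooth_scaled m sh el1) (smooth_scaled n sk el2)) _.
rewrite (ds h m l1 (comp b v / alpha) sh el1); last first.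
  by apply: etrans (derive_affine _ _ _ _ _) _; case: (b).
rewrite (ds k n l2 (comp b w / beta) sk el2); last first.
  by apply: etrans (derive_affine _ _ _ _ _) _; case: (b).
by rewrite /wave; ring.
Qed.

Lemma derive1_sinE : derive1 (@sin R) = @cos R.
Proof. by apply/funext => x; rewrite derive1E; have [_ ->] := is_derive_sin x. Qed.

Lemma derive1_cosE : derive1 (@cos R) = (fun x => - sin x).
Proof. by apply/funext => x; rewrite derive1E; have [_ ->] := is_derive_cos x. Qed.

Let vE : v.1 ^+ 2 + v.2 ^+ 2 = 1. Proof. by case: frame; rewrite /dot2 !expr2. Qed.
Let wE : w.1 ^+ 2 + w.2 ^+ 2 = 1. Proof. by case: frame; rewrite /dot2 !expr2. Qed.
Let vwE : v.1 * w.1 + v.2 * w.2 = 0. Proof. by case: frame. Qed.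

Local Notation Wss := (wave (@sin R) (@sin R)).

Lemma derive_sine_wave b m n : 'D_(evec R b) (Wss m n) =
  (fun x => m * (comp b v / alpha) * wave (@cos R) (@sin R) m n x +
            n * (comp b w / beta) * wave (@sin R) (@cos R) m n x).
Proof.
by apply/funext => x; rewrite (derive_wave _ _ _ _ (@smooth1_sin R) (@smooth1_sin R)) derive1_sinE.
Qed.

Lemma derive2_sine_wave b m n x : 'D_(evec R b) ('D_(evec R b) (Wss m n)) x =
  - ((m / alpha) ^+ 2 * comp b v ^+ 2 + (n / beta) ^+ 2 * comp b w ^+ 2) * Wss m n x +
  2 * (m / alpha) * (n / beta) * (comp b v * comp b w) * wave (@cos R) (@cos R) m n x.
Proof.
rewrite derive_sine_wave.
have scs := smooth_wave m n (@smooth1_cos R) (@smooth1_sin R).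
have ssc := smooth_wave m n (@smooth1_sin R) (@smooth1_cos R).
apply: etrans (smooth_deriveD _ _ (smoothM (smooth_cst _) scs) (smoothM (smooth_cst _) ssc)) _.
apply: etrans (congr2 +%R (smooth_deriveZ _ _ _ scs) (smooth_deriveZ _ _ _ ssc)) _.
rewrite (derive_wave _ _ _ _ (@smooth1_cos R) (@smooth1_sin R)).
rewrite (derive_wave _ _ _ _ (@smooth1_sin R) (@smooth1_cos R)).
by rewrite derive1_sinE derive1_cosE /wave; ring.
Qed.

(** Each second derivative has a mixed term in the two cosines; in the sum it carries the inner
    product of [v] and [w], which is 0. *)
Lemma laplacian_sine_wave m n x :
  laplacian (Wss m n) x = - (((m / alpha) ^+ 2 + (n / beta) ^+ 2) * Wss m n x).
Proof.
apply: etrans (congr2 +%R (derive2_sine_wave true m n x) (derive2_sine_wave false m n x)) _.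
rewrite /comp.
transitivity (- ((m / alpha) ^+ 2 * (v.1 ^+ 2 + v.2 ^+ 2) + (n / beta) ^+ 2 * (w.1 ^+ 2 + w.2 ^+ 2)) * Wss m n x
  + 2 * (m / alpha) * (n / beta) * (v.1 * w.1 + v.2 * w.2) * wave (@cos R) (@cos R) m n x); first by ring.
by rewrite vE wE vwE; ring.
Qed.

Let comp_le b (u : R * R) : u.1 ^+ 2 + u.2 ^+ 2 = 1 -> `|comp b u| <= 1.
Proof.
move=> u1; rewrite -(@ler_pXn2r _ 2)// ?nnegrE// expr1n real_normK ?num_real// -u1.
by case: b; rewrite /comp ?lerDl ?lerDr sqr_ge0.
Qed.

(** Since the frequencies are at least 1, [k / c] is at most [c * (k / c) ^+ 2]: a gradient of the
    order of the frequency is bounded by a multiple of the eigenvalue. *)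
Lemma derive_sine_wave_bound b (m n : nat) x :
  `|'D_(evec R b) (Wss m.+1%:R n.+1%:R) x| <=
  (alpha + beta) * ((m.+1%:R / alpha) ^+ 2 + (n.+1%:R / beta) ^+ 2).
Proof.
rewrite (derive_wave _ _ _ _ (@smooth1_sin R) (@smooth1_sin R)) derive1_sinE.
have key (c : R) (k : nat) (u : R * R) (W : R) : 0 < c -> u.1 ^+ 2 + u.2 ^+ 2 = 1 -> `|W| <= 1 ->
    `|k.+1%:R * (comp b u / c) * W| <= c * (k.+1%:R / c) ^+ 2.
  move=> c0 u1 W1; rewrite !normrM normfV (gtr0_norm c0) normr_nat.
  have k1 : 1 <= k.+1%:R :> R by rewrite ler1n.
  have -> : c * (k.+1%:R / c) ^+ 2 = k.+1%:R * (k.+1%:R / c) * 1 by field; rewrite gt_eqF.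
  rewrite ler_pM// ?mulr_ge0 ?invr_ge0 ?(ltW c0)// ler_pM2l ?ltr0n//.
  by rewrite ler_pM2r ?invr_gt0//; apply: le_trans k1; exact: comp_le.
have W1 (h k : R -> R) : (forall y, `|h y| <= 1) -> (forall y, `|k y| <= 1) ->
    `|wave h k m.+1%:R n.+1%:R x| <= 1.
  by move=> h1 k1; rewrite /wave normrM -[leRHS]mul1r ler_pM.
apply: le_trans (ler_normD _ _) _.
apply: le_trans (lerD (key _ _ _ _ alpha0 vE (W1 _ _ (@cos_max R) (@sin_max R)))
  (key _ _ _ _ beta0 wE (W1 _ _ (@sin_max R) (@cos_max R)))) _.
have a1 := sqr_ge0 (m.+1%:R / alpha); have a2 := sqr_ge0 (n.+1%:R / beta).
rewrite mulrDl !mulrDr.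
have := mulr_ge0 (ltW alpha0) a2; have := mulr_ge0 (ltW beta0) a1; lra.
Qed.

End waves.

(** * The integral of the triangle's ground state *)

Section triangle_integral.
Variable R : realType.
Local Notation mu := (@leb2 R).
Local Notation mu1 := (@lebesgue_measure R).

Lemma Rintegral_Tpi (f : R * R -> R) (H : R -> R) : continuous f ->
  (forall x, 0 < x < pi -> \int[mu1]_(y in `]0, x[) f (x, y) = H x) ->
  \int[mu]_(z in @Tpi R) f z = \int[mu1]_(x in `]0, pi[) H x.
Proof.
move=> cf HE; pose F := f \_ (@Tpi R).
have mT := @Tpi_measurable R.
have iT : mu.-integrable (@Tpi R) (EFin \o f).
  apply: measurable_bounded_integrable => //; [exact: Tpi_fin|exact: continuous_measurable2S|].
  have cK : compact (`[0, pi] `*` `[0, pi] : set (R * R)).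
    by apply: compact_setX; exact: segment_compact.
  have [C C0 HC] := continuous_compact_bounded cf cK.
  exists C; split; first exact: num_real.
  move=> y Cy z /Tpi_Qpi[z1 z2]; apply: le_trans (ltW Cy); apply: HC.
  by split; apply: subset_itv_oo_cc.
have iF : mu.-integrable setT (EFin \o F).
  by move/(integrable_mkcond _ mT) : iT; rewrite -restrict_EFin.
rewrite Rintegral_mkcond {1}/Rintegral.
have -> : (\int[mu]_z (F z)%:E = \int[mu1]_x \int[mu1]_y (F (x, y))%:E)%E.
  by rewrite -(integral12_prod_meas1 iF).
have E1 x : (\int[mu1]_y (F (x, y))%:E = ((H \_ `]0, pi[%classic) x)%:E)%E.
  rewrite patchE; case: ifPn => [/set_mem xI|xI].
    move: xI; rewrite /= in_itv/= => xI; have [x0 xpi] := andP xI.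
    have cfx : continuous (fun y => f (x, y)).
      move=> y; apply: (@continuous_comp _ _ _ (fun y : R => (x, y)) f); last exact: cf.
      by apply: (@cvg_pair _ _ _ _ (nbhs x) (nbhs y)) => //; exact: cvg_cst.
    transitivity (\int[mu1]_(y in `]0%R, x[) (f (x, y))%:E)%E.
      rewrite [RHS]integral_mkcond; apply: eq_integral => y _.
      rewrite /F !patchE; case: ifPn => [|].
        by rewrite inE => -[/= h1 h2 h3]; rewrite mem_set//= in_itv/= h1.
      move=> nQ; rewrite memNset// => /=; rewrite in_itv/= => /andP[y0 yx].
      by move/negP : nQ; apply; rewrite inE.
    rewrite -HE// /Rintegral fineK//.
    apply: integrable_fin_num; [exact: measurable_itv|].
    exact: (continuous_itv_integrable 0 x cfx).
  rewrite integral0_eq// => y _; rewrite /F patchE ifF//.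
  apply/negP; rewrite inE => Tz; move/negP: xI; apply; rewrite inE.
  by have [] := Tpi_Qpi Tz.
under eq_integral do rewrite E1.
by rewrite -[LHS]/(\int[mu1]_x ((H \_ `]0, pi[%classic) x)) -Rintegral_mkcond.
Qed.

(** The function is [2 sin x sin y (cos x - cos y)], negative where [y < x], whence the sign; the
    heat content sees only the square. *)
Lemma integral_etri00 : \int[mu]_(z in @Tpi R) @etri R (0, 0)%N z = - (8 / 3).
Proof.
have sin2 (x : R) : sin (2 * x) = 2 * (sin x * cos x).
  have -> : 2 * x = x + x by ring.
  by rewrite sinD; ring.
have eE : @etri R (0, 0)%N = (fun z => 2 * (sin z.1 * cos z.1) * sin z.2 - sin z.1 * (2 * (sin z.2 * cos z.2))).
  by apply/funext => z; rewrite /etri /esin/= !mul1r !sin2.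
rewrite (@Rintegral_Tpi _ (fun x => 2 * (sin x * cos x) - sin x - sin x * cos x ^+ 2)); last 2 first.
- exact: elementary_continuous (etri_elementary _ _).
- move=> x /andP[x0 xpi].
  have -> : \int[mu1]_(y in `]0, x[) @etri R (0, 0)%N (x, y) =
      \int[mu1]_(y in `]0, x[) (2 * (sin x * cos x) * sin y - sin x * (2 * (sin y * cos y))).
    by apply: eq_Rintegral => y _; rewrite eE.
  have dF (y : R) : is_derive y (1 : R)
      (fun y => - (2 * (sin x * cos x)) * cos y - sin x * (sin y * sin y))
      (2 * (sin x * cos x) * sin y - sin x * (2 * (sin y * cos y))).
    by apply: is_derive_eq; rewrite /GRing.scale/=; ring.
  have cf : continuous (fun y : R => 2 * (sin x * cos x) * sin y - sin x * (2 * (sin y * cos y))).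
    move=> y; apply: cvgB; apply: cvgM; try exact: cvg_cst; first exact: continuous_sin.
    by apply: cvgM; [exact: cvg_cst|apply: cvgM; [exact: continuous_sin|exact: continuous_cos]].
  rewrite (Rintegral_FTC x0 dF cf) cos0 sin0.
  have : sin x * (cos x ^+ 2 + sin x ^+ 2) = sin x by rewrite cos2Dsin2 mulr1.
  rewrite !expr2 !mulrDr; move: (sin x) (cos x) => a b h.
  have -> : a * (a * a) = a - a * (b * b) by rewrite -[X in _ = X - _]h; ring.
  by ring.
have dF (x : R) : is_derive x (1 : R)
    (fun x => sin x * sin x + cos x + 3^-1 * (cos x * cos x * cos x))
    (2 * (sin x * cos x) - sin x - sin x * cos x ^+ 2).
  by apply: is_derive_eq; rewrite /GRing.scale/=; field.
have cf : continuous (fun x : R => 2 * (sin x * cos x) - sin x - sin x * cos x ^+ 2).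
  move=> x; apply: cvgB; first apply: cvgB.
  - by apply: cvgM; [exact: cvg_cst|apply: cvgM; [exact: continuous_sin|exact: continuous_cos]].
  - exact: continuous_sin.
  - apply: cvgM; first exact: continuous_sin.
    by apply: cvgM; exact: continuous_cos.
rewrite (Rintegral_FTC (@pi_gt0 R) dF cf) cospi cos0 sinpi sin0.
by field.
Qed.

End triangle_integral.

(** * Arbitrarily placed rectangles and triangles *)

Section shapes.
Variable R : realType.
Local Notation mu := (@leb2 R).

Lemma compact_lty (K : set (R * R)) : compact K -> (mu K < +oo)%E.
Proof.
move=> cK.
have [C1 _ H1] := continuous_compact_bounded (elementary_continuous (elementary_fst R)) cK.
have [C2 _ H2] := continuous_compact_bounded (elementary_continuous (elementary_snd R)) cK.
apply: le_lt_trans (leb2_box_lty (- (C1 + 1)) (C1 + 1) (- (C2 + 1)) (C2 + 1)).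
apply: le_measure; rewrite ?inE; [exact: compact_measurable2|exact: measurable_box|].
move=> x Kx; have := H1 x Kx; have := H2 x Kx; rewrite !ler_norml => /andP[a b] /andP[c e].
by split; rewrite /= in_itv/=; apply/andP; split; lra.
Qed.

Section frame_region.
Variables (S0 : set (R * R)) (e : nat * nat -> R * R -> R).
Hypothesis model : sine_model S0 e.
Variables (p v w : R * R) (alpha beta : R).
Hypothesis frame : orthonormal_frame v w.
Hypotheses (alpha0 : 0 < alpha) (beta0 : 0 < beta).
Variable S : set (R * R).
Hypothesis SE : forall z, S (frame_map p v w alpha beta z) <-> S0 z.

Let S_pre : S = frame_inv p v w alpha beta @^-1` S0.
Proof.
by apply/seteqP; split => x; rewrite /= -SE (frame_invK p frame alpha0 beta0).
Qed.

Lemma frame_region_open : open S.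
Proof.
have cf : continuous (frame_inv p v w alpha beta).
  move=> x; pose y := frame_inv p v w alpha beta x.
  by apply: (@cvg_pair _ _ _ _ (nbhs y.1) (nbhs y.2));
    exact: (elementary_continuous (elementary_affine _ _ _)).
by rewrite S_pre; apply: open_comp => [x _|]; [exact: cf|exact: model_open model].
Qed.

Lemma frame_region_lty : (mu S < +oo)%E.
Proof.
have [C [d [cC SC _ _]]] := model_factor model.
have cK : compact (frame_map p v w alpha beta @` C).
  by apply: continuous_compact => //; apply: continuous_subspaceT; exact: frame_map_continuous.
apply: le_lt_trans (compact_lty cK); apply: le_measure; rewrite ?inE.
- by apply: open_measurable2; exact: frame_region_open.
- exact: compact_measurable2.
rewrite S_pre => x Sx; exists (frame_inv p v w alpha beta x); first exact: SC.
exact: frame_invK.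
Qed.

End frame_region.

Lemma esin_le1 i z : `|@esin R i z| <= 1.
Proof. by rewrite /esin normrM -[leRHS]mul1r ler_pM// ?sin_max. Qed.

Lemma etri_le2 i z : `|@etri R i z| <= 2.
Proof.
by apply: le_trans (ler_normB _ _) _; apply: le_trans (lerD (esin_le1 _ _) (esin_le1 _ _)) _; lra.
Qed.

Definition rectangle_eigenvalue (a b : R) (i : nat * nat) : R :=
  pi ^+ 2 * ((i.1.+1%:R / a) ^+ 2 + (i.2.+1%:R / b) ^+ 2).

(* The frequencies of [etri i] are [i.1 + i.2 + 2] and [i.1 + 1]. *)
Definition triangle_eigenvalue (a : R) (i : nat * nat) : R :=
  pi ^+ 2 * (((i.1 + i.2).+2%:R / a) ^+ 2 + (i.1.+1%:R / a) ^+ 2).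

(** Scaling the sides to [pi] gives [alpha * beta = a * b / pi ^+ 2], and 64 is 4 times the square
    of the integral 4. The complement [T] is arbitrary so that the region can be a component of
    either union. *)
Lemma rectangle_region (a b : R) (S : set (R * R)) : 0 < a -> 0 < b ->
  open_rectangle a b S -> [/\ open S, (mu S < +oo)%E &
    forall M T, open T -> S `&` T = set0 -> M = S `|` T -> (mu M < +oo)%E ->
    exists phi g B, local_system M S phi g (rectangle_eigenvalue a b) B /\
      L2dot M (fun=> 1) (phi (0, 0)%N) ^+ 2 = 64 * (a * b) / pi ^+ 4].
Proof.
move=> a0 b0 [p [v [w [frame SE]]]].
have pi_gt0 := @pi_gt0 R; have pi0 : (pi : R) != 0 by rewrite gt_eqF.
pose alpha := a / pi; pose beta := b / pi.
have alpha0 : 0 < alpha by rewrite divr_gt0.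
have beta0 : 0 < beta by rewrite divr_gt0.
have aE : alpha * pi = a by rewrite divfK.
have bE : beta * pi = b by rewrite divfK.
have {}SE z : S (frame_map p v w alpha beta z) <-> (@Qpi R) z.
  rewrite SE frame_mapE; split.
    move=> [s [t [s0 t0]]].
    have -> : p + s *: v + t *: w = frame_map p v w alpha beta (s / alpha, t / beta).
      by rewrite frame_mapE /= (mulrC alpha) (mulrC beta) !divfK ?gt_eqF.
    rewrite -frame_mapE => /(can_inj (frame_mapK p frame alpha0 beta0)) ->.
    move: s0 t0 => /andP[s0 sa] /andP[t0 tb].
    split; rewrite /= in_itv/= divr_gt0//= ltr_pdivrMr// mulrC; [by rewrite aE|by rewrite bE].
  move=> [/=]; rewrite !in_itv/= => /andP[x0 x1] /andP[y0 y1].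
  exists (alpha * z.1), (beta * z.2); split => //.
    by rewrite mulr_gt0//= -aE ltr_pM2l.
  by rewrite mulr_gt0//= -bE ltr_pM2l.
have oS := frame_region_open (@esin_model R) frame alpha0 beta0 SE.
have fS := frame_region_lty (@esin_model R) frame alpha0 beta0 SE.
split => // M T oT dST MST fM.
have lamE i : rectangle_eigenvalue a b i =
    (i.1.+1%:R / alpha) ^+ 2 + (i.2.+1%:R / beta) ^+ 2.
  rewrite /rectangle_eigenvalue /alpha /beta; move: (pi : R) pi0 => P P0.
  by field; rewrite P0 !gt_eqF.
eexists; eexists; eexists; split.
  apply: (@frame_local_system R _ _ (@esin_model R) p v w alpha beta frame alpha0 beta0
    M S T oS oT dST MST fM SE (rectangle_eigenvalue a b) (1 + (alpha + beta))).
  - move=> i x; rewrite lamE; exact: (laplacian_sine_wave p alpha beta frame i.1.+1%:R i.2.+1%:R x).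
  - by move=> i z; apply: le_trans (esin_le1 i z) _; rewrite lerDl ltW// addr_gt0.
  - move=> i c x; rewrite lamE.
    apply: le_trans (derive_sine_wave_bound p frame alpha0 beta0 c i.1 i.2 x) _.
    by rewrite ler_wpM2r ?addr_ge0 ?sqr_ge0// lerDr.
rewrite (frame_coef (@esin_model R) frame alpha0 beta0 oS oT dST MST fM SE esin_le1).
rewrite integral_esin00 /alpha /beta; move: (pi : R) pi0 => P P0.
by field; rewrite P0.
Qed.

(** The constant is [4 * a ^+ 2 / pi ^+ 4] times the square of 8/3. *)
Lemma triangle_region (a : R) (S : set (R * R)) : 0 < a ->
  open_right_isosceles_triangle a S -> [/\ open S, (mu S < +oo)%E &
    forall M T, open T -> S `&` T = set0 -> M = S `|` T -> (mu M < +oo)%E ->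
    exists phi g B, local_system M S phi g (triangle_eigenvalue a) B /\
      L2dot M (fun=> 1) (phi (0, 0)%N) ^+ 2 = 256 * a ^+ 2 / (9 * pi ^+ 4)].
Proof.
move=> a0 [p0 [v0 [w [frame0 SE]]]].
have pi_gt0 := @pi_gt0 R; have pi0 : (pi : R) != 0 by rewrite gt_eqF.
(* The model has its right angle at [(pi, 0)], so the origin is moved to the far end of the leg
   along [v0] and that axis is reversed. *)
pose alpha := a / pi; pose p := p0 + a *: v0; pose v := - v0.
have alpha0 : 0 < alpha by rewrite divr_gt0.
have aE : alpha * pi = a by rewrite divfK.
have frame : orthonormal_frame v w.
  move: frame0 => [h1 h2 h3]; split => //; rewrite /dot2 /v /=.
    by rewrite !mulrNN; exact: h1.
  by rewrite !mulNr -opprD; move: h3; rewrite /dot2 => ->; rewrite oppr0.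
have fE s t : p0 + s *: v0 + t *: w = frame_map p v w alpha alpha ((a - s) / alpha, t / alpha).
  rewrite frame_mapE /= [alpha * _]mulrC [alpha * (t / _)]mulrC !divfK ?gt_eqF// /p /v.
  by apply/pair_equal_spec; split; rewrite /= /GRing.scale/=; ring.
have {}SE z : S (frame_map p v w alpha alpha z) <-> (@Tpi R) z.
  rewrite SE; split.
    move=> [s [t [s0 t0 st]]]; rewrite fE => /(can_inj (frame_mapK p frame alpha0 alpha0)) ->.
    split => /=; first by rewrite divr_gt0.
      by rewrite ltr_pM2r ?invr_gt0//; lra.
    by rewrite ltr_pdivrMr// mulrC aE; lra.
  move=> [z2 z21 z1]; exists (a - alpha * z.1), (alpha * z.2); split.
  - by rewrite subr_gt0 -[X in _ < X]aE ltr_pM2l.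
  - by rewrite mulr_gt0.
  - by have : alpha * z.2 < alpha * z.1; [rewrite ltr_pM2l|lra].
  - rewrite fE; congr (frame_map _ _ _ _ _ _); rewrite opprB addrC subrK.
    by rewrite ![alpha * _]mulrC !mulfK ?gt_eqF//; case: z {z2 z21 z1}.
have oS := frame_region_open (@etri_model R) frame alpha0 alpha0 SE.
have fS := frame_region_lty (@etri_model R) frame alpha0 alpha0 SE.
split => // M T oT dST MST fM.
pose m (i : nat * nat) : R := (i.1 + i.2.+1)%N.+1%:R; pose n (i : nat * nat) : R := i.1.+1%:R.
pose W := wave p v w alpha alpha (@sin R) (@sin R).
have lamE i : triangle_eigenvalue a i = (m i / alpha) ^+ 2 + (n i / alpha) ^+ 2.
  rewrite /triangle_eigenvalue /m /n addnS /alpha; move: (pi : R) pi0 => P P0.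
  by field; rewrite P0 !gt_eqF.
have lamE' i : triangle_eigenvalue a i = (n i / alpha) ^+ 2 + (m i / alpha) ^+ 2.
  by rewrite lamE addrC.
have eE i : (fun x => etri i (frame_inv p v w alpha alpha x)) =
    (fun x => W (m i) (n i) x + (-1) * W (n i) (m i) x).
  by apply/funext => x; rewrite mulN1r.
have sW i j : smooth (W i j).
  exact: (smooth_wave p v w alpha alpha i j (@smooth1_sin R) (@smooth1_sin R)).
have DW i c x : 'D_(evec R c) (fun x => W (m i) (n i) x + (-1) * W (n i) (m i) x) x =
    'D_(evec R c) (W (m i) (n i)) x + (-1) * 'D_(evec R c) (W (n i) (m i)) x.
  apply: etrans (smooth_deriveD _ _ (sW _ _) (smoothM (smooth_cst (-1)) (sW _ _))) _.
  by congr (_ + _); exact: smooth_deriveZ.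
have DDW i c x : 'D_(evec R c) ('D_(evec R c) (fun x => W (m i) (n i) x + (-1) * W (n i) (m i) x)) x =
    'D_(evec R c) ('D_(evec R c) (W (m i) (n i))) x +
    (-1) * 'D_(evec R c) ('D_(evec R c) (W (n i) (m i))) x.
  have -> : 'D_(evec R c) (fun x => W (m i) (n i) x + (-1) * W (n i) (m i) x) =
    (fun x => 'D_(evec R c) (W (m i) (n i)) x + (-1) * 'D_(evec R c) (W (n i) (m i)) x).
    by apply/funext => y; exact: DW.
  have sd j k := smooth_derive c (sW j k).
  apply: etrans (smooth_deriveD _ _ (sd _ _) (smoothM (smooth_cst (-1)) (sd _ _))) _.
  by congr (_ + _); exact: smooth_deriveZ.
have lap i x : laplacian (fun x => W (m i) (n i) x + (-1) * W (n i) (m i) x) x =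
    - (triangle_eigenvalue a i * (W (m i) (n i) x + (-1) * W (n i) (m i) x)).
  apply: etrans (congr2 +%R (DDW i true x) (DDW i false x)) _.
  have l1 := laplacian_sine_wave p alpha alpha frame (m i) (n i) x.
  have l2 := laplacian_sine_wave p alpha alpha frame (n i) (m i) x.
  rewrite -lamE in l1; rewrite -lamE' in l2.
  have E (a1 a2 b1 b2 : R) : a1 + (-1) * b1 + (a2 + (-1) * b2) = (a1 + a2) + (-1) * (b1 + b2).
    by ring.
  apply: etrans (E _ _ _ _) _.
  apply: etrans (congr2 (fun x y => x + (-1) * y) l1 l2) _.
  by rewrite /W; ring.
eexists; eexists; eexists; split.
  apply: (@frame_local_system R _ _ (@etri_model R) p v w alpha alpha frame alpha0 alpha0
    M S T oS oT dST MST fM SE (triangle_eigenvalue a) (2 * (1 + (alpha + alpha)))).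
  - move=> i x; apply: etrans (etrans _ (lap i x)) _; first by rewrite eE.
    by have /= -> := congr1 (fun f => f x) (eE i).
  - by move=> i z; apply: le_trans (etri_le2 i z) _; lra.
  - move=> i c x; rewrite eE.
    rewrite [X in `|X|](DW i c x) mulN1r; apply: le_trans (ler_normB _ _) _.
    have b1 := derive_sine_wave_bound p frame alpha0 alpha0 c (i.1 + i.2.+1) i.1 x.
    have b2 := derive_sine_wave_bound p frame alpha0 alpha0 c i.1 (i.1 + i.2.+1) x.
    rewrite -[X in _ <= _ * X]lamE in b1; rewrite -[X in _ <= _ * X]lamE' in b2.
    apply: le_trans (lerD b1 b2) _.
    have : 0 <= triangle_eigenvalue a i by rewrite lamE addr_ge0 ?sqr_ge0.
    by move: (triangle_eigenvalue a i) => l l0; lra.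
rewrite (frame_coef (@etri_model R) frame alpha0 alpha0 oS oT dST MST fM SE etri_le2).
rewrite integral_etri00 /alpha; move: (pi : R) pi0 => P P0.
by field; rewrite P0.
Qed.

End shapes.

(** * Disjoint unions *)

Section union.
Variable R : realType.
Local Notation mu := (@leb2 R).
Variables M S T : set (R * R).
Hypotheses (oS : open S) (oT : open T) (dST : S `&` T = set0) (MST : M = S `|` T).
Hypothesis fM : (mu M < +oo)%E.
Variables (I J : eqType) (phiS : I -> R * R -> R) (phiT : J -> R * R -> R).
Variables (gS : I -> bool -> R * R -> R) (gT : J -> bool -> R * R -> R).
Variables (lamS : I -> R) (lamT : J -> R) (BS BT : R).
Hypothesis sysS : local_system M S phiS gS lamS BS.
Hypothesis sysT : local_system M T phiT gT lamT BT.

Definition union_fun (k : I + J) : R * R -> R :=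
  match k with inl i => phiS i | inr j => phiT j end.
Definition union_lam (k : I + J) : R :=
  match k with inl i => lamS i | inr j => lamT j end.
Let G (k : I + J) : bool -> R * R -> R :=
  match k with inl i => gS i | inr j => gT j end.

Let mM : measurable (M : set (borel_plane R)).
Proof. by apply: open_measurable2; rewrite MST; exact: openU. Qed.
Let mS : measurable (S : set (borel_plane R)). Proof. exact: open_measurable2. Qed.
Let mT : measurable (T : set (borel_plane R)). Proof. exact: open_measurable2. Qed.
Let SM : S `<=` M. Proof. by rewrite MST; exact: subsetUl. Qed.
Let TM : T `<=` M. Proof. by rewrite MST; exact: subsetUr. Qed.
Let notT x : S x -> ~ T x. Proof. by move=> Sx Tx; have : (S `&` T) x by []; rewrite dST. Qed.
Let notS x : T x -> ~ S x. Proof. by move=> Tx Sx; exact: notT Sx Tx. Qed.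

Let ugrad k : H10_grad M (union_fun k) (G k).
Proof. by case: k => [i|j]; [exact: local_grad sysS i|exact: local_grad sysT j]. Qed.

Let uL2 k : L2 M (union_fun k). Proof. by case: (ugrad k). Qed.

Let dot0 (N : set (R * R)) f h : (forall x, N x -> f x = 0) -> L2dot N f h = 0.
Proof.
by move=> f0; rewrite /L2dot /Rintegral integral0_eq// => x Nx; rewrite f0// mul0r.
Qed.

Let S0 i x : T x -> phiS i x = 0. Proof. by move=> /notS; exact: local_out sysS i x. Qed.
Let T0 j x : S x -> phiT j x = 0. Proof. by move=> /notT; exact: local_out sysT j x. Qed.

Let uortho k l : L2dot M (union_fun k) (union_fun l) = (k == l)%:R.
Proof.
rewrite MST (L2dot_setU mS mT dST); rewrite -?MST//.
case: k l => [i|i] [j|j] /=.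
- by rewrite (local_ortho sysS) [X in _ + X]dot0 ?addr0// => x; exact: S0.
- rewrite [X in _ + X]dot0 => [|x]; last exact: S0.
  by rewrite L2dotC dot0 ?addr0// => x; exact: T0.
- rewrite dot0 => [|x]; last exact: T0.
  by rewrite L2dotC dot0 ?addr0// => x; exact: S0.
- by rewrite (local_ortho sysT) [X in X + _]dot0 ?add0r// => x; exact: T0.
Qed.

Let span_inl p : lin_span phiS p -> lin_span union_fun p /\ forall x, T x -> p x = 0.
Proof.
elim=> [|a i h _ [IH h0]]; first by split; [exact: span0|].
split; first exact: (spanS a (inl i : I + J) IH).
by move=> x Tx; rewrite S0// h0// mulr0 addr0.
Qed.

Let span_inr p : lin_span phiT p -> lin_span union_fun p /\ forall x, S x -> p x = 0.
Proof.
elim=> [|a i h _ [IH h0]]; first by split; [exact: span0|].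
split; first exact: (spanS a (inr i : I + J) IH).
by move=> x Sx; rewrite T0// h0// mulr0 addr0.
Qed.

(** Approximants on [S] and on [T] each vanish on the other component, so their sum approximates on
    the union and the errors add. *)
Let udense f : L2 M f -> L2_approx M union_fun f.
Proof.
move=> Lf; split => // eps eps0; have e2 : 0 < eps / 2 by rewrite divr_gt0.
have [LfS _] := nrm2_sub mS mM SM Lf; have [LfT _] := nrm2_sub mT mM TM Lf.
have [_ /(_ _ e2)[p sp hp]] := local_dense sysS LfS.
have [_ /(_ _ e2)[q sq hq]] := local_dense sysT LfT.
have [up p0] := span_inl sp; have [uq q0] := span_inr sq.
exists (fun x => p x + q x); first exact: span_add.
have Lpq : L2 M (fun x => f x - (p x + q x)).
  by apply: L2B => //; apply: L2D => //; exact: (span_L2 mM uL2).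
have := nrm2_setU mS mT dST; rewrite -MST => /(_ _ Lpq) ->.
rewrite (splitr eps); apply: ltrD.
  apply: le_lt_trans hp; rewrite le_eqVlt; apply/orP; left; apply/eqP.
  by apply: L2dot_ext => // x Sx; rewrite q0// addr0.
apply: le_lt_trans hq; rewrite le_eqVlt; apply/orP; left; apply/eqP.
by apply: L2dot_ext => // x Tx; rewrite p0// add0r.
Qed.

Variables (s : nat -> I + J) (K : R).
Hypothesis s_inj : injective s.
Hypothesis s_surj : forall k, exists n, s n = k.
Hypothesis mono : nondecreasing_seq (fun n => union_lam (s n)).
Hypothesis pos : forall k, 0 < union_lam k.
Hypothesis growth : forall n, n.+1%:R <= K * union_lam (s n) ^+ 2.

Let phi n := union_fun (s n).
Let lam n := union_lam (s n).

Let ndense f : L2 M f -> L2_approx M phi f.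
Proof.
move=> Lf; have [_ H] := udense Lf; split => // eps eps0.
have [p sp hp] := H _ eps0; exists p => //.
elim: sp {hp} => [|a k h _ IH]; first exact: span0.
by have [n <-] := s_surj k; exact: (spanS a n IH).
Qed.

Let northo i j : L2dot M (phi i) (phi j) = (i == j)%:R.
Proof. by rewrite /phi uortho (inj_eq s_inj). Qed.

Let nweak j psi : test_function M psi ->
  L2dot M (phi j) (laplacian psi) = L2dot M (fun x => - (lam j * phi j x)) psi.
Proof.
by rewrite /phi /lam; case: (s j) => [i|i]; [exact: local_weak sysS i psi|exact: local_weak sysT i psi].
Qed.

Let B := `|BS| + `|BT|.

Let nB j x : `|phi j x| <= B.
Proof.
rewrite /phi /B; case: (s j) => [i|i] /=.
  by apply: le_trans (local_bound sysS i x) _; rewrite (le_trans (ler_norm _))// lerDl.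
by apply: le_trans (local_bound sysT i x) _; rewrite (le_trans (ler_norm _))// lerDr.
Qed.

Let ngB j b x : `|G (s j) b x| <= B * lam j.
Proof.
have := pos (s j); rewrite /lam /B; case: (s j) => [i|i] /= l0.
  apply: le_trans (local_grad_bound sysS i b x) _; rewrite ler_pM2r//.
  by rewrite (le_trans (ler_norm _))// lerDl.
apply: le_trans (local_grad_bound sysT i b x) _; rewrite ler_pM2r//.
by rewrite (le_trans (ler_norm _))// lerDr.
Qed.

Let B0 : 0 <= B. Proof. by rewrite addr_ge0. Qed.

Lemma union_dirichlet_eigenvalues : dirichlet_eigenvalues M (fun n => union_lam (s n)).
Proof.
exact: (@dirichlet_eigenvalues_of_basis R M mM fM phi (fun j => G (s j)) lam
  (fun j => ugrad (s j)) nweak northo ndense mono).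
Qed.

Lemma union_heat_content (L t : R) : 0 < t ->
  (forall n, (0 < n)%N -> L <= union_lam (s n)) ->
  0 <= heat_content M t - expR (- (union_lam (s 0%N) * t)) * L2dot M (fun=> 1) (union_fun (s 0%N)) ^+ 2 <=
    nrm2 M (fun=> 1) * expR (- (L * t)).
Proof.
move=> t0 HL.
exact: (@heat_content_leading R M mM fM phi (fun j => G (s j)) lam B K B0
  (fun j => ugrad (s j)) nweak northo ndense nB ngB (fun j => pos (s j)) growth L t t0 HL).
Qed.

End union.

(** * Arithmetic of the frequencies *)

Section sorted_enumeration.
Local Open Scope nat_scope.
Variables (I : eqType) (k : I -> nat) (cand : nat -> seq I) (f : nat -> I).
Hypothesis f_inj : injective f.
Hypothesis cand_le : forall i n, k i <= n -> i \in cand n.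
Hypothesis cand_uniq : forall n, uniq (cand n).

Let level n := [seq i <- cand n | k i == n].
(** Indices of value less than [n], in blocks of increasing value. Each list is a prefix of the
    next, so a position once filled never changes. *)
Fixpoint below n := if n is m.+1 then below m ++ level m else [::].

Let mem_level i n : (i \in level n) = (k i == n).
Proof. by rewrite mem_filter; case: eqP => //= <-; exact: cand_le. Qed.

Lemma mem_below i n : (i \in below n) = (k i < n).
Proof. by elim: n => //= n IH; rewrite mem_cat IH mem_level [RHS]ltnS [RHS]leq_eqVlt orbC. Qed.

Lemma below_uniq n : uniq (below n).
Proof.
elim: n => //= n IH; rewrite cat_uniq IH filter_uniq// andbT.
by apply/hasPn => i; rewrite mem_level => /eqP ki; rewrite mem_below ki ltnn.
Qed.

Lemma below_prefix m n : m <= n -> prefix (below m) (below n).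
Proof.
elim: n => [|n IH]; first by rewrite leqn0 => /eqP ->.
rewrite leq_eqVlt ltnS => /predU1P[->|/IH /prefixP[s sE]]; first exact: prefix_refl.
by apply/prefixP; exists (s ++ level n); rewrite /= sE catA.
Qed.

Lemma below_size n : size (below n.+1) <= size (cand n).
Proof.
apply: uniq_leq_size; first exact: below_uniq.
by move=> i; rewrite mem_below ltnS; exact: cand_le.
Qed.

(** The injection [f] supplies arbitrarily many indices, so every position is eventually filled. *)
Lemma below_unbounded n : exists m, n < size (below m).
Proof.
pose s := map f (iota 0 n.+1); exists (\max_(i <- s) k i).+1.
rewrite -[n.+1](size_iota 0 n.+1) -(size_map f); apply: uniq_leq_size.
  by rewrite map_inj_uniq// iota_uniq.
by move=> i si; rewrite mem_below ltnS; exact: leq_bigmax_seq.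
Qed.

(** The last clause turns a count of the candidates into growth of the sorted values: everything
    listed up to position [n] has value at most [k (s n)]. *)
Lemma sorted_enumeration : exists s : nat -> I, [/\ injective s,
  forall i, exists n, s n = i,
  forall m n, m <= n -> k (s m) <= k (s n) &
  forall n, n < size (cand (k (s n)))].
Proof.
pose N n := ex_minn (below_unbounded n).
pose s n := nth (f 0) (below (N n)) n.
have NP n : n < size (below (N n)) by rewrite /N; case: ex_minnP.
have nth_prefix m n j : m <= n -> j < size (below m) ->
    nth (f 0) (below n) j = nth (f 0) (below m) j.
  by move=> /below_prefix /prefixP[r ->] jm; rewrite nth_cat jm.
have sE n j : j < size (below n) -> nth (f 0) (below n) j = s j.
  move=> jn; rewrite /s; case: (leqP n (N j)) => [|/ltnW] h; last exact: nth_prefix.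
  by rewrite (nth_prefix n (N j)).
have s_index n i : i \in below n -> s (index i (below n)) = i.
  by move=> ib; rewrite -(sE n) ?index_mem// nth_index.
have s_surj i : exists n, s n = i.
  by exists (index i (below (k i).+1)); apply: s_index; rewrite mem_below.
have s_lt n j : j < size (below n) -> k (s j) < n.
  by move=> jn; rewrite -mem_below -(sE n)// mem_nth.
have s_inj : injective s.
  move=> m n smn; pose M := maxn (N m) (N n).
  have size_le a b : a <= b -> size (below a) <= size (below b).
    by move=> /below_prefix /prefixP[r ->]; rewrite size_cat leq_addr.
  have mM : m < size (below M) by apply: leq_trans (NP m) (size_le _ _ (leq_maxl _ _)).
  have nM : n < size (below M) by apply: leq_trans (NP n) (size_le _ _ (leq_maxr _ _)).
  apply/eqP; rewrite -(nth_uniq (f 0) mM nM (below_uniq M)).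
  by rewrite !(sE M)// smn.
have s_bound n : n < size (below (k (s n)).+1).
  have sb : s n \in below (k (s n)).+1 by rewrite mem_below.
  by rewrite -[X in X < _](s_inj _ _ (s_index _ _ sb)) index_mem.
exists s; split => //.
- move=> m n mn; rewrite -ltnS; apply: s_lt.
  exact: leq_ltn_trans mn (s_bound n).
- by move=> n; apply: leq_trans (s_bound n) (below_size _).
Qed.

End sorted_enumeration.

(** * The bijection between the modes of the two unions *)

Section frequencies.
Local Open Scope nat_scope.
Local Notation I := ((nat * nat) + (nat * nat))%type.

(* Eigenvalues in units of [pi ^+ 2 / 4]. *)
Definition freqA (x : I) : nat :=
  match x with
  | inl i => 4 * (i.1.+1 ^ 2 + i.2.+1 ^ 2)
  | inr i => (i.1 + i.2).+2 ^ 2 + i.1.+1 ^ 2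
  end.

Definition freqB (x : I) : nat :=
  match x with
  | inl i => 4 * i.1.+1 ^ 2 + i.2.+1 ^ 2
  | inr i => 2 * ((i.1 + i.2).+2 ^ 2 + i.1.+1 ^ 2)
  end.

(* [m ^ 2 + n ^ 2] is [2 * (((m + n) / 2) ^ 2 + ((m - n) / 2) ^ 2)] when [m] and
   [n] have the same parity, and [4 * p ^ 2 + q ^ 2] with [q] odd otherwise. The
   squares account for the [4 * p ^ 2 + q ^ 2] with [q] even. *)
Definition transplant (x : I) : I :=
  match x with
  | inl (a, b) => inl (a, b.*2.+1)
  | inr (a, b) =>
      if odd b then inr (b./2, a)
      else if odd a then inl (a./2, (a + b).+1) else inl ((a + b)./2, a)
  end.

(** For even [d] the frequency [q = d + 1] is odd, and the triangle pair consists of [2 p] and [q];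
    the inner test decides which of them is the larger. *)
Definition transplant_inv (x : I) : I :=
  match x with
  | inl (c, d) =>
      if odd d then inl (c, d./2)
      else if c.*2.+1 < d then inr (c.*2.+1, d - c.*2.+2) else inr (d, c.*2 - d)
  | inr (a, b) => inr (b, a.*2.+1)
  end.

Lemma transplantK : cancel transplant transplant_inv.
Proof.
case=> [[a b]|[a b]] /=.
  by rewrite odd_double /= uphalf_double.
case: ifP => ob /=; first by congr (inr (_, _)); lia.
case: ifP => oa /=.
  rewrite ifF; last by lia.
  by rewrite ifT; [congr (inr (_, _)); lia|lia].
rewrite oa ifF; last by lia.
by congr (inr (_, _)); lia.
Qed.

Lemma transplant_invK : cancel transplant_inv transplant.
Proof.
case=> [[c d]|[a b]] /=; last by rewrite odd_double /= uphalf_double.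
case: ifP => od /=; first by congr (inl (_, _)); lia.
case: ifP => cd /=.
  rewrite ifF; last by lia.
  by rewrite ifT; [congr (inl (_, _)); lia|lia].
rewrite ifF; last by lia.
by rewrite ifF; [congr (inl (_, _)); lia|lia].
Qed.

Lemma transplant_freq x : freqB (transplant x) = freqA x.
Proof.
case: x => [[a b]|[a b]] /=; first by nia.
case: ifP => ob /=.
  (* With the half as a variable of its own, the identity is polynomial. *)
  have : b = b./2.*2.+1 by lia.
  by move: b./2 => c ->; nia.
case: ifP => oa /=.
  have : a = a./2.*2.+1 by lia.
  by move: a./2 => c ->; nia.
have : a + b = (a + b)./2.*2 by lia.
by move: (a + b)./2 => c ->; nia.
Qed.

(** The value 8 belongs to the ground mode of the square; in units of [pi ^+ 2 / 4] it is the
    exponent [2 * pi ^+ 2] of the remainder. *)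
Lemma freqA_min x : x = inr (0, 0) \/ 8 <= freqA x.
Proof.
case: x => [[a b]|[[|a] [|b]]] /=; [right; nia|by left|right; nia|right; nia|right; nia].
Qed.

(** Both coordinates of an index of frequency at most [n] are less than [n], so each component
    offers [n ^ 2] candidates, whence the factor 2 and the square. *)
Lemma freqA_enumeration : exists s : nat -> I, [/\ injective s,
  forall i, exists n, s n = i,
  forall m n, m <= n -> freqA (s m) <= freqA (s n) &
  forall n, n.+1 <= 2 * freqA (s n) ^ 2].
Proof.
pose sq n := [seq (a, b) | a <- iota 0 n, b <- iota 0 n].
pose cand n : seq I := [seq inl i | i <- sq n] ++ [seq inr i | i <- sq n].
have sq_size n : size (sq n) = n ^ 2 by rewrite size_allpairs size_iota mulnn.
have sq_uniq n : uniq (sq n).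
  by apply: allpairs_uniq; rewrite ?iota_uniq// => -[? ?] [? ?].
have sq_mem n a b : a < n -> b < n -> (a, b) \in sq n.
  by move=> an bn; apply/allpairsP; exists (a, b); rewrite !mem_iota.
have [|||s [s1 s2 s3 s4]] := @sorted_enumeration I freqA cand (fun n => inl (n, 0)).
- by move=> m n [].
- move=> [[a b]|[a b]] n /= h; rewrite mem_cat; apply/orP; [left|right];
    apply: map_f; apply: sq_mem; nia.
- move=> n; rewrite cat_uniq !map_inj_uniq ?sq_uniq ?andbT//=; last 2 first.
  + by move=> i j [].
  + by move=> i j [].
  by apply/hasPn => x /mapP[i _ ->]; apply/mapP => -[].
exists s; split => // n; have := s4 n.
by rewrite /cand size_cat !size_map sq_size mul2n -addnn.
Qed.

End frequencies.

(** * Common spectrum and two-sided heat bounds *)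

Section spectra.
Variable R : realType.
Local Notation mu := (@leb2 R).
Local Notation I := ((nat * nat) + (nat * nat))%type.

Let mode_unit : R := pi ^+ 2 / 4.
Let mode_unit_gt0 : 0 < mode_unit. Proof. by rewrite divr_gt0// exprn_gt0// pi_gt0. Qed.

Lemma freqA_eigenvalue (x : I) :
  union_lam (@rectangle_eigenvalue R 1 1) (@triangle_eigenvalue R 2) x = mode_unit * (freqA x)%:R.
Proof.
case: x => [[a b]|[a b]];
  rewrite /= /rectangle_eigenvalue /triangle_eigenvalue ?natrM natrD !natrX /mode_unit /=;
  move: (pi : R) => P; by field.
Qed.

Lemma freqB_eigenvalue (x : I) :
  union_lam (@rectangle_eigenvalue R 1 2) (@triangle_eigenvalue R (Num.sqrt 2)) x =
  mode_unit * (freqB x)%:R.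
Proof.
have s2 : Num.sqrt 2 ^+ 2 = 2 :> R by rewrite sqr_sqrtr.
case: x => [[a b]|[a b]].
  rewrite /= /rectangle_eigenvalue natrD natrM !natrX /mode_unit /=.
  by move: (pi : R) => P; field.
rewrite /= /triangle_eigenvalue !expr_div_n s2 natrM natrD !natrX /mode_unit /=.
by move: (pi : R) => P; field.
Qed.

Let freq_growth (s : nat -> I) (freq : I -> nat) (lam : I -> R) :
  (forall x, lam x = mode_unit * (freq x)%:R) ->
  (forall n, (n.+1 <= 2 * freq (s n) ^ 2)%N) ->
  forall n, n.+1%:R <= 2 / mode_unit ^+ 2 * lam (s n) ^+ 2.
Proof.
have E (u y : R) : u != 0 -> 2 / u ^+ 2 * (u * y) ^+ 2 = 2 * y ^+ 2 by move=> u0; field.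
move=> lamE fs n; rewrite lamE E ?gt_eqF//.
by rewrite -natrX -natrM ler_nat.
Qed.

Let union_lty (M S T : set (R * R)) : open S -> open T -> M = S `|` T ->
  (mu S < +oo)%E -> (mu T < +oo)%E -> (mu M < +oo)%E.
Proof.
move=> oS oT -> fS fT; apply: le_lt_trans (measureU2 _ _ _) _.
- exact: open_measurable2.
- exact: open_measurable2.
- by rewrite lte_add_pinfty.
Qed.

Variables (SA TA SB TB A B : set (R * R)).
Hypotheses (hSA : open_square 1 SA) (hTA : open_right_isosceles_triangle 2 TA).
Hypotheses (hdA : SA `&` TA = set0) (hA : A = SA `|` TA).
Hypotheses (hSB : open_rectangle 1 2 SB) (hTB : open_right_isosceles_triangle (Num.sqrt 2) TB).
Hypotheses (hdB : SB `&` TB = set0) (hB : B = SB `|` TB).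

(** Explicit bounds for all positive times, including the sign of the remainder: besides the
    asymptotics they give the separation of the two heat contents. *)
Lemma spectra : exists lam : nat -> R,
  [/\ dirichlet_eigenvalues A lam, dirichlet_eigenvalues B lam,
    forall t, 0 < t -> 0 <= heat_content A t - 1024 / (9 * pi ^+ 4) * expR (- (5 * pi ^+ 2 * t / 4)) <=
      nrm2 A (fun=> 1) * expR (- (2 * pi ^+ 2 * t)) &
    forall t, 0 < t -> 0 <= heat_content B t - 1152 / (9 * pi ^+ 4) * expR (- (5 * pi ^+ 2 * t / 4)) <=
      nrm2 B (fun=> 1) * expR (- (2 * pi ^+ 2 * t))].
Proof.
have s20 : 0 < Num.sqrt 2 :> R by rewrite sqrtr_gt0.
have [oSA fSA HSA] := rectangle_region (@ltr01 R) (@ltr01 R) hSA.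
have [oTA fTA HTA] := triangle_region (ltr0Sn R 1) hTA.
have [oSB fSB HSB] := rectangle_region (@ltr01 R) (ltr0Sn R 1) hSB.
have [oTB fTB HTB] := triangle_region s20 hTB.
have fA := union_lty oSA oTA hA fSA fTA; have fB := union_lty oSB oTB hB fSB fTB.
have [pSA [gSA [bSA [sysSA _]]]] := HSA A TA oTA hdA hA fA.
(* The triangle is now the distinguished component, so the two components trade places. *)
have [pTA [gTA [bTA [sysTA cTA]]]] :=
  HTA A SA oSA (etrans (setIC _ _) hdA) (etrans hA (setUC _ _)) fA.
have [pSB [gSB [bSB [sysSB cSB]]]] := HSB B TB oTB hdB hB fB.
have [pTB [gTB [bTB [sysTB _]]]] :=
  HTB B SB oSB (etrans (setIC _ _) hdB) (etrans hB (setUC _ _)) fB.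
have [s [s_inj s_surj s_mono s_grow]] := freqA_enumeration.
(* The enumeration for [B] is carried over from that for [A], which makes the two eigenvalue
   sequences equal term by term. *)
pose r n := transplant (s n).
have rB n : freqB (r n) = freqA (s n) by exact: transplant_freq.
have r_inj : injective r by apply: inj_comp => //; exact: can_inj transplantK.
have r_surj k : exists n, r n = k.
  by have [n sn] := s_surj (transplant_inv k); exists n; rewrite /r sn transplant_invK.
have s0 : s 0%N = inr (0, 0)%N.
  have [n sn] := s_surj (inr (0, 0)%N).
  have [//|h8] := freqA_min (s 0%N).
  by have := leq_trans h8 (s_mono 0%N n (leq0n n)); rewrite sn.
have freq_ge n : (0 < n)%N -> (8 <= freqA (s n))%N.
  move=> n0; have [sn|//] := freqA_min (s n).
  by have := s_inj 0%N n; rewrite s0 sn => /(_ erefl) n0'; rewrite -n0' in n0.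
have freqA_gt0 k : (0 < freqA k)%N by have [->//|] := freqA_min k; apply: leq_trans.
pose lamA := union_lam (@rectangle_eigenvalue R 1 1) (@triangle_eigenvalue R 2).
pose lamB := union_lam (@rectangle_eigenvalue R 1 2) (@triangle_eigenvalue R (Num.sqrt 2)).
have lamE : (fun n => lamB (r n)) = (fun n => lamA (s n)).
  by apply/funext => n; rewrite /lamA /lamB freqA_eigenvalue freqB_eigenvalue rB.
have lamA_pos k : 0 < lamA k.
  by rewrite /lamA freqA_eigenvalue mulr_gt0// ltr0n.
have lamB_pos k : 0 < lamB k.
  have [n <-] := r_surj k; have /= -> := congr1 (fun f => f n) lamE; exact: lamA_pos.
have monoA : nondecreasing_seq (fun n => lamA (s n)).
  by move=> m n mn; rewrite /lamA !freqA_eigenvalue ler_pM2l// ler_nat s_mono.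
have monoB : nondecreasing_seq (fun n => lamB (r n)) by rewrite lamE.
have growA := freq_growth freqA_eigenvalue s_grow.
have growB : forall n, n.+1%:R <= 2 / mode_unit ^+ 2 * lamB (r n) ^+ 2.
  by apply: (freq_growth freqB_eigenvalue) => n; rewrite rB.
have lam_ge n : (0 < n)%N -> 2 * pi ^+ 2 <= lamA (s n).
  move=> n0; rewrite /lamA freqA_eigenvalue.
  have -> : 2 * pi ^+ 2 = mode_unit * 8%:R by rewrite /mode_unit; move: (pi : R) => P; field.
  by rewrite ler_pM2l// ler_nat freq_ge.
have lam0 : lamA (s 0%N) = 5 * pi ^+ 2 / 4.
  by rewrite /lamA freqA_eigenvalue s0 /mode_unit /=; move: (pi : R) => P; field.
have lamB0 : lamB (r 0%N) = 5 * pi ^+ 2 / 4.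
  by have /= -> := congr1 (fun f => f 0%N) lamE.
have lamB_ge n : (0 < n)%N -> 2 * pi ^+ 2 <= lamB (r n).
  by have /= -> := congr1 (fun f => f n) lamE; exact: lam_ge.
exists (fun n => lamA (s n)); split.
- exact: (union_dirichlet_eigenvalues oSA oTA hdA hA fA sysSA sysTA s_inj s_surj monoA).
- by rewrite -lamE; exact: (union_dirichlet_eigenvalues oSB oTB hdB hB fB sysSB sysTB r_inj r_surj monoB).
- move=> t t0.
  have := union_heat_content oSA oTA hdA hA fA sysSA sysTA s_inj s_surj lamA_pos growA t0 lam_ge.
  rewrite -/(lamA _) lam0 s0 /= cTA mulrC.
  have -> : 256 * 2 ^+ 2 / (9 * pi ^+ 4) = 1024 / (9 * pi ^+ 4) :> R by congr (_ / _); ring.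
  by have -> : 5 * pi ^+ 2 / 4 * t = 5 * pi ^+ 2 * t / 4 :> R by rewrite mulrAC.
- move=> t t0.
  have := union_heat_content oSB oTB hdB hB fB sysSB sysTB r_inj r_surj lamB_pos growB t0 lamB_ge.
  rewrite -/(lamB _) lamB0 /r s0 /= cSB mulrC.
  (* 128 is 1152 / 9: the common denominator 9 comes from the triangle. *)
  have -> : 64 * (1 * 2) / pi ^+ 4 = 1152 / (9 * pi ^+ 4) :> R.
    have := @pi_gt0 R; move: (pi : R) => P P0; by field; rewrite gt_eqF.
  by have -> : 5 * pi ^+ 2 / 4 * t = 5 * pi ^+ 2 * t / 4 :> R by rewrite mulrAC.
Qed.

End spectra.

Theorem theorem7 (R : realType) (SA TA SB TB A B : set (R * R))
  (hSA : open_square 1 SA)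
  (hTA : open_right_isosceles_triangle 2 TA)
  (hdA : SA `&` TA = set0)
  (hA : A = SA `|` TA)
  (hSB : open_rectangle 1 2 SB)
  (hTB : open_right_isosceles_triangle (Num.sqrt 2) TB)
  (hdB : SB `&` TB = set0)
  (hB : B = SB `|` TB) :
  [/\ isospectral A B,
      ~ isoheat A B,
      bigO_pinfty
        (fun t => heat_content A t -
                  1024 / (9 * pi ^+ 4) * expR (- (5 * pi ^+ 2 * t / 4)))
        (fun t => expR (- (2 * pi ^+ 2 * t))) &
      bigO_pinfty
        (fun t => heat_content B t -
                  1152 / (9 * pi ^+ 4) * expR (- (5 * pi ^+ 2 * t / 4)))
        (fun t => expR (- (2 * pi ^+ 2 * t)))].
Proof.
have [lam [eA eB QA QB]] := spectra hSA hTA hdA hA hSB hTB hdB hB.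
have bigO (Q : R -> R) (N : set (R * R)) :
    (forall t, 0 < t -> 0 <= Q t <= nrm2 N (fun=> 1) * expR (- (2 * pi ^+ 2 * t))) ->
    bigO_pinfty Q (fun t => expR (- (2 * pi ^+ 2 * t))).
  move=> HQ; exists (nrm2 N (fun=> 1) + 1); first by rewrite ltr_wpDl// nrm2_ge0.
  exists 0; split; first exact: num_real.
  move=> t t0; have /andP[q0 q1] := HQ t t0.
  rewrite !ger0_norm ?expR_ge0//; apply: le_trans q1 _.
  by rewrite ler_wpM2r ?expR_ge0// lerDl.
split; [by exists lam| |exact: bigO QA|exact: bigO QB].
move=> QAB; have pi0 := @pi_gt0 R.
(* The gap between the leading constants, [1152 - 1024 = 128]. *)
pose c : R := 128 / (9 * pi ^+ 4).
have c0 : 0 < c by rewrite divr_gt0// mulr_gt0// exprn_gt0.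
have n0 : 0 <= nrm2 A (fun=> 1 : R) by exact: nrm2_ge0.
(* The exponents differ by [3 * pi ^+ 2 / 4], so at this [t] the remainder is smaller than the
   leading exponential by [expR (- x)], while [c * (1 + x)] exceeds the squared norm of 1 on [A]. *)
pose x := nrm2 A (fun=> 1) / c + 1; pose t := x / (3 * pi ^+ 2 / 4).
have x0 : 0 < x by rewrite ltr_wpDl// divr_ge0// ltW.
have p34 : 0 < 3 * pi ^+ 2 / 4 :> R by rewrite divr_gt0// mulr_gt0// exprn_gt0.
have t0 : 0 < t by rewrite divr_gt0.
have := QA t t0; have := QB t t0; rewrite -(QAB t t0).
have -> : 2 * pi ^+ 2 * t = 5 * pi ^+ 2 * t / 4 + x.
  rewrite /t; move: (pi : R) pi0 => P P0; move: (x) => y.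
  by field; rewrite gt_eqF.
have -> : 1152 / (9 * pi ^+ 4) = 1024 / (9 * pi ^+ 4) + c.
  by rewrite /c -mulrDl; congr (_ / _); ring.
rewrite opprD expRD; set E := expR (- (5 * pi ^+ 2 * t / 4)).
have E0 : 0 < E by exact: expR_gt0.
(* The lower bound for [B] against the upper bound for [A], at equal heat contents. *)
move=> /andP[h1 _] /andP[_ h2].
have h3 : c * E <= nrm2 A (fun=> 1) * (E * expR (- x)) by lra.
have h4 : c <= nrm2 A (fun=> 1) * expR (- x).
  by rewrite -(ler_pM2r E0); apply: le_trans h3 _; rewrite mulrAC mulrA.
move: h4; rewrite expRN ler_pdivlMr ?expR_gt0// => h4.
have h5 : nrm2 A (fun=> 1) < c * expR x.
  apply: lt_le_trans (_ : c * (1 + x) <= _); last by rewrite ler_pM2l// expR_ge1Dx.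
  by rewrite /x 2!mulrDr mulr1 mulrC divfK ?gt_eqF//; lra.
by move: (lt_le_trans h5 h4); rewrite ltxx.
Qed.
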